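(* Let $\phi$ be a bounded measurable function on $\Sigma$ that is supported on some compact cube $K=[-q\mathbf 1,q\mathbf 1]\subseteq\mathbb R^d$ ($q>0$), i.e. $\phi(\sigma)$ is a measurable function of $(\sigma(x))_{x\in K}$. Then for every $\sigma\in\Sigma$ and every $t>0$, $$E^\sigma[\phi(\sigma(t))]-\phi(\sigma)=\int_0^t E^\sigma[\mathcal L\phi(\sigma(s))]\,ds,$$ where $\sigma(s)=\sigma(\cdot,s)$ and $\mathcal L\phi(\sigma)=\int_{\mathbb R^d}[\phi(\sigma^y)-\phi(\sigma)]\,dy$.
   Context: Order conventions: for $x,y\in\mathbb R^\nu$ write $x\le y$ if $x_i\le y_i$ for all $i$, and $x<y$ if $x_i<y_i$ for all $i$; rectangles are $(a,b]=\{x:a<x\le b\}$, $[a,b]=\{x:a\le x\le b\}$, etc.; $\mathbf 1=(1,\dots,1)$; $|x|_\infty=\max_i|x_i|$. Fix a dimension $d\ge 2$. Let $\mathbb Z^*=\mathbb Z\cup\{\pm\infty\}$. The state space $\Sigma$ is the set of functions $\sigma:\mathbb R^d\to\mathbb Z^*$ such that (i) $x\le y$ implies $\sigma(x)\le\sigma(y)$; (ii) for every cube $[-q\mathbf 1,q\mathbf 1]$ there are finite partitions $-q=s_i^0<s_i^1<\dots<s_i^{m_i}=q$ of each coordinate axis $i=1,\dots,d$ such that $\sigma$ is constant on each rectangle $\prod_{i=1}^d[s_i^{k_i},s_i^{k_i+1})$; (iii) for every $b\in\mathbb R^d$, $\lim_{M\to\infty}\sup\{|y|_\infty^{-d/(d+1)}\sigma(y):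 y\le b,\ |y|_\infty\ge M\}=-\infty$. Measurability on $\Sigma$ refers to the $\sigma$-field generated by the maps $\sigma\mapsto\sigma(x)$. Dynamics: let a rate-one homogeneous Poisson point process on space-time $\mathbb R^d\times(0,\infty)$ be given. For $y\le x$ in $\mathbb R^d$ and $t>0$, $\mathbf H((y,0),(x,t))$ is the maximal $m\ge0$ such that there are Poisson points $p^1<p^2<\dots<p^m$ (strict coordinatewise order in $\mathbb R^{d+1}$) all lying in $((y,0),(x,t)]=\{(\eta,s):y<\eta\le x,\ 0<s\le t\}$. Given an initial state $\sigma\in\Sigma$, the height process is $\sigma(x,0)=\sigma(x)$ and, for $t>0$, $\sigma(x,t)=\sup_{y\in\mathbb R^d:\,y\le x}\{\sigma(y)+\mathbf H((y,0),(x,t))\}$. $P^\sigma,E^\sigma$ denote probability and expectation for this process started from $\sigma$. For $\sigma\in\Sigma$ and $y\in\mathbb R^d$, $\sigma^y$ is defined by $\sigma^y(x)=\sigma(x)+1$ if $x\ge y$ and $\sigma(x)=\sigma(y)$ with $\sigma(y)$ finite, and $\sigma^y(x)=\sigma(x)$ otherwise (so $\sigma^y=\sigma$ if $\sigma(y)=\pm\infty$). *)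

(* Defs.v *)
From HB Require Import structures.
From mathcomp Require Import all_boot all_order all_algebra.
From mathcomp Require Import all_classical all_reals all_analysis.
Set Implicit Arguments. Unset Strict Implicit. Unset Printing Implicit Defensive.
Import Order.TTheory GRing.Theory Num.Theory.
Local Open Scope classical_set_scope.
Local Open Scope ring_scope.

Section Hammersley.
Variables (R : realType) (d : nat).

Definition pt := d.-tuple R.
Definition stpt := (pt * R)%type.

Definition tle (x y : pt) : Prop := forall i : 'I_d, tnth x i <= tnth y i.
Definition tlt (x y : pt) : Prop := forall i : 'I_d, tnth x i < tnth y i.
Definition stlt (p p' : stpt) : Prop := tlt p.1 p'.1 /\ p.2 < p'.2.
Definition supnorm (x : pt) : R := \big[Num.max/0]_(i < d) `|tnth x i|.
Definition cube (q : R) : set pt := [set x | forall i : 'I_d, -q <= tnth x i <= q].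

Definition Zstar (v : \bar R) : Prop :=
  v = +oo%E \/ v = -oo%E \/ exists z : int, v = (z%:~R)%:E.

Definition state := pt -> \bar R.

Definition in_Sigma (s : state) : Prop :=
  (forall x, Zstar (s x)) /\
  (forall x y, tle x y -> (s x <= s y)%E) /\
  (forall q : R, 0 < q -> exists part : 'I_d -> seq R,
     (forall i, (2 <= size (part i))%N /\ sorted <%R (part i) /\
                head 0 (part i) = - q /\ last 0 (part i) = q) /\
     (forall x x' : pt,
        (forall i : 'I_d, exists k : nat, (k.+1 < size (part i))%N /\
            (part i)`_k <= tnth x i < (part i)`_k.+1 /\
            (part i)`_k <= tnth x' i < (part i)`_k.+1) ->
        s x = s x')) /\
  (forall (b : pt) (A : R), exists M : R, 0 < M /\
     forall y : pt, tle y b -> M <= supnorm y ->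
       ((powR (supnorm y) (- (d%:R / d.+1%:R)))%:E * s y <= A%:E)%E).

Definition shift (s : state) (y : pt) : state := fun x =>
  if `[< tle y x /\ s x = s y /\ s y \is a fin_num >] then (s x + 1%:E)%E else s x.

Definition stbox (a b : pt) (u v : R) : set stpt :=
  [set p | (forall i : 'I_d, tnth a i < tnth p.1 i <= tnth b i) /\ u < p.2 <= v].
Definition stvol (a b : pt) (u v : R) : R :=
  (\prod_(i < d) (tnth b i - tnth a i)) * (v - u).

Definition poisson_prob_at (lam : R) (n : nat) : R :=
  expR (- lam) * lam ^+ n / n`!%:R.

Definition is_rate1_PPP (dO : measure_display) (Omega : measurableType dO)
  (P : probability Omega R) (N : Omega -> set stpt) : Prop :=
  (forall w p, N w p -> 0 < p.2) /\
  (forall (k : nat) (a b : 'I_k -> pt) (u v : 'I_k -> R) (n : 'I_k -> nat),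
     (forall i, tle (a i) (b i) /\ 0 <= u i /\ u i <= v i) ->
     (forall i j, i != j ->
        stbox (a i) (b i) (u i) (v i) `&` stbox (a j) (b j) (u j) (v j) = set0) ->
     let E := [set w | forall i, ((N w `&` stbox (a i) (b i) (u i) (v i)) #= `I_(n i))%card] in
     measurable E /\
     P E = (\prod_(i < k) poisson_prob_at (stvol (a i) (b i) (u i) (v i)) (n i))%:E).

Definition Hlen (Nw : set stpt) (y x : pt) (t : R) : \bar R :=
  ereal_sup [set (m%:R)%:E | m in [set m : nat | exists c : seq stpt,
     size c = m /\
     (forall p, p \in c -> Nw p /\ tlt y p.1 /\ tle p.1 x /\ 0 < p.2 <= t) /\
     (forall i, (i.+1 < size c)%N -> stlt (nth ((nseq_tuple d (0:R), 0) : stpt) c i) (nth ((nseq_tuple d (0:R), 0) : stpt) c i.+1))]].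

Definition height (Nw : set stpt) (s : state) (t : R) : state := fun x =>
  if t <= 0 then s x
  else ereal_sup [set (s y + Hlen Nw y x t)%E | y in [set y | tle y x]].

(* Lebesgue integral over R^n, written as an iterated integral *)
Fixpoint itint (n : nat) : (n.-tuple R -> \bar R) -> \bar R :=
  match n with
  | 0%N => fun f => f [tuple]
  | n'.+1 => fun f =>
      (\int[@lebesgue_measure R]_y itint (fun z : n'.-tuple R => f [tuple of y :: z]))%E
  end.

Definition gen (phi : state -> R) (s : state) : \bar R :=
  itint (fun y : pt => (phi (shift s y) - phi s)%:E).

(* phi is a measurable function of (sigma(x))_{x in K} on Sigma, K = cube q:
   measurable w.r.t. the trace on Sigma of the sigma-field generated by the
   evaluations sigma |-> sigma(x), x in K. *)
Definition supported_measurable (q : R) (phi : state -> R) : Prop :=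
  let G := [set A : set state | exists x, cube q x /\
                 exists v, Zstar v /\ A = [set s | s x = v]] in
  forall B : set R, measurable B ->
    exists A, <<s G >> A /\ in_Sigma `&` phi @^-1` B = in_Sigma `&` A.

End Hammersley.

(* Main.v *)
(* Keep only the Poisson points with spatial coordinate in (-L, L]^d.  In a time
   strip of length h there is then at most one of them, up to an event of
   probability O(h^2).  A single new point at Y can only end a chain, so it turns
   the state into its shift at Y, unless Y lies on one of the finitely many
   hyperplanes where the state jumps; given the past, Y is uniform in the box (a
   Mecke formula, proved by identifying two measures on a pi-system of void
   events of dyadic cells).  Hence the mean u of phi and the mean G of the
   generator satisfy u(r+h) - u(r) = h G(r) + O(h^2), which integrates to the
   identity for the truncated process.

   A first-moment bound on the number of long chains shows that, almost surely,
   chains started far away are too short to compensate the decay of the initial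
   state.  The truncated process therefore agrees with the full one on the cube
   as soon as L exceeds a random level whose d-th power is integrable, and
   dominated convergence lets L tend to infinity. *)
Require Import Defs.
From HB Require Import structures.
From mathcomp Require Import all_boot all_order all_algebra.
From mathcomp Require Import all_classical all_reals all_analysis.
From mathcomp Require Import measurable_realfun ring lra zify.
Set Implicit Arguments. Unset Strict Implicit. Unset Printing Implicit Defensive.
Import Order.TTheory GRing.Theory Num.Theory.
Local Open Scope classical_set_scope.
Local Open Scope ring_scope.
Import numFieldNormedType.Exports.

(** * Integer-valued heights and chains *)

Section extended_integers.
Context {R : realType}.
Implicit Types a b : \bar R.

(** The truncation answers a first obstacle: in all of space points arrive at infinite total rate,
    so there is no first jump, whereas in (-L, L]^d the rate is the finite volume [lam]. The
    exponent d/(d+1) of the growth condition is the scale of longest chains: a box of volume m^d b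
    in d+1 dimensions holds chains of order m^(d/(d+1)), and the initial state falls faster than any
    multiple of this. Measurability is the second obstacle. The hypothesis on [N] gives only the
    events that count points in boxes, and [phi] is controlled on Sigma only. Heights are extended
    integers, so they are determined by the inequalities v <= height, each witnessed by a start and
    a finite chain. Such a chain is detected by the occupied cells of some dyadic level, which makes
    heights functions of void events. On a null set the configuration is replaced by the empty one,
    so that every state met lies in Sigma. *)

Lemma Zstar_ltW a (v : int) : Zstar a ->
  ((v - 1)%:~R%:E < a)%E -> (v%:~R%:E <= a)%E.
Proof.
case=> [->|[->|[z ->]]]; rewrite ?leey ?ltNyr//.
rewrite lte_fin lee_fin ltr_int ler_int; lia.
Qed.

(** An integer a is its own threshold, and +oo exceeds an integer above any real b. Equalities of
    heights are reduced to such thresholds. *)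
Lemma Zstar_le a b : Zstar a ->
  (forall v : int, (v%:~R%:E <= a)%E -> (v%:~R%:E <= b)%E) -> (a <= b)%E.
Proof.
case=> [->|[->|[z ->]]] H; rewrite ?leNye//; last exact: H.
case: b H => [r||] H //; last by have := H 0 (leey _).
have := H (Num.floor r + 1) (leey _); rewrite lee_fin => h.
by have := floorD1_gt r; rewrite ltNge h.
Qed.

Lemma Zstar_ext a b : Zstar a -> Zstar b ->
  (forall v : int, (v%:~R%:E <= a)%E <-> (v%:~R%:E <= b)%E) -> a = b.
Proof.
move=> Za Zb H; apply/eqP; rewrite eq_le.
by apply/andP; split; apply: Zstar_le => // v /H.
Qed.

Lemma Zstar_nat (n : nat) : Zstar (n%:R%:E : \bar R).
Proof. by right; right; exists n%:Z. Qed.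

Lemma Zstar_add a b : Zstar a -> Zstar b -> Zstar (a + b)%E.
Proof.
case=> [->|[->|[z ->]]]; case=> [->|[->|[z' ->]]] //=; rewrite /Zstar; auto.
by right; right; exists (z + z'); rewrite intrD.
Qed.

(** A finite supremum is attained: an integer z of [A] within 1/2 of it cannot be exceeded in [A],
    since z + 1 already overshoots. *)
Lemma Zstar_ereal_sup (A : set (\bar R)) :
  (forall a, A a -> Zstar a) -> Zstar (ereal_sup A).
Proof.
move=> HA; case E : (ereal_sup A) => [r||]; rewrite /Zstar; auto.
right; right.
have [a Aa] : exists2 a, A a & ((r - 2^-1)%:E < a)%E.
  by apply: ereal_sup_gt; rewrite E lte_fin; lra.
have ar : (a <= r%:E)%E by rewrite -E; exact: ereal_sup_ubound.
have Za := HA _ Aa.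
case: Za ar Aa => [->|[->|[z ->]]]//; rewrite lee_fin => zr Az.
rewrite lte_fin => rz; exists z; congr EFin; apply/eqP.
rewrite eq_le zr andbT leNgt; apply/negP => zr'.
have [b Ab] : exists2 b, A b & (z%:~R%:E < b)%E.
  by apply: ereal_sup_gt; rewrite E lte_fin.
have br : (b <= r%:E)%E by rewrite -E; exact: ereal_sup_ubound.
have Zb := HA _ Ab.
case: Zb br => [->|[->|[z' ->]]]//; rewrite lee_fin lte_fin => z'r.
rewrite ltr_int => zz'.
have : ((z + 1)%:~R : R) <= z'%:~R by rewrite ler_int; lia.
rewrite intrD; lra.
Qed.

End extended_integers.

Section chains.
Context {R : realType} {d : nat}.
Implicit Types (Nw : set (stpt R d)) (x y z : pt R d) (c : seq (stpt R d)).
Implicit Types (s : state R d).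

Lemma tle_refl x : tle x x. Proof. by move=> i. Qed.
Lemma tle_trans y x z : tle x y -> tle y z -> tle x z.
Proof. by move=> h h' i; exact: le_trans (h i) (h' i). Qed.
Lemma tlt_tle_trans y x z : tlt x y -> tle y z -> tlt x z.
Proof. by move=> h h' i; exact: lt_le_trans (h i) (h' i). Qed.
Lemma tle_tlt_trans y x z : tle x y -> tlt y z -> tlt x z.
Proof. by move=> h h' i; exact: le_lt_trans (h i) (h' i). Qed.
Lemma tltW x y : tlt x y -> tle x y.
Proof. by move=> h i; exact: ltW. Qed.

Definition stltb (p p' : stpt R d) : bool := `[< stlt p p' >].

Lemma stltb_trans : transitive stltb.
Proof.
move=> p2 p1 p3 /asboolP[h1 h2] /asboolP[h3 h4]; apply/asboolP; split.
  by move=> i; exact: lt_trans (h1 i) (h3 i).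
exact: lt_trans h2 h4.
Qed.

(** The witnesses of [Hlen], with the consecutive comparisons restated as [sorted], so that
    transitivity compares any two points. *)
Definition chain Nw (t : R) y x c :=
  (forall p, p \in c -> Nw p /\ tlt y p.1 /\ tle p.1 x /\ 0 < p.2 <= t) /\
  sorted stltb c.

Lemma chain_nil Nw t y x : chain Nw t y x [::].
Proof. by []. Qed.

Lemma chain_sub Nw Nw' t t' y y' x x' c :
  (forall p, p \in c -> Nw p -> Nw' p) -> t <= t' -> tle y' y -> tle x x' ->
  chain Nw t y x c -> chain Nw' t' y' x' c.
Proof.
move=> sN tt' yy xx [h1 h2]; split=> // p pc.
have [Np [yp [px /andP[t0 t1]]]] := h1 _ pc.
split; first exact: sN.
split; first exact: tle_tlt_trans yy yp.
by split; [exact: tle_trans px xx|rewrite t0 (le_trans t1)].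
Qed.

Lemma chainP Nw t y x c : chain Nw t y x c <->
  (forall p, p \in c -> Nw p /\ tlt y p.1 /\ tle p.1 x /\ 0 < p.2 <= t) /\
  (forall i, (i.+1 < size c)%N ->
     stlt (nth ((nseq_tuple d (0:R), 0) : stpt R d) c i)
          (nth ((nseq_tuple d (0:R), 0) : stpt R d) c i.+1)).
Proof.
split=> -[h1 h2]; split=> //.
  by move=> i ic; apply/asboolP; move/(sortedP (nseq_tuple d (0:R), 0)) : h2; exact.
by apply/(sortedP (nseq_tuple d (0:R), 0)) => i ic; apply/asboolP; exact: h2.
Qed.

Lemma chain_rcons_last Nw t y x c p :
  chain Nw t y x (rcons c p) -> forall p', p' \in c -> stlt p' p.
Proof.
move=> [_ h] p' p'c; apply/asboolP; move: h.
rewrite sorted_pairwise; last exact: stltb_trans.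
by rewrite pairwise_rcons => /andP[/allP h _]; exact: h.
Qed.

Lemma chain_belast Nw t y x c p :
  chain Nw t y x (rcons c p) -> chain Nw t y x c.
Proof.
move=> [h1 h2]; split.
  by move=> u uc; apply: h1; rewrite mem_rcons inE uc orbT.
move: h2; rewrite !sorted_pairwise; try exact: stltb_trans.
by rewrite pairwise_rcons => /andP[].
Qed.

(** z is the location of the last point, or y for the empty chain. Ending the chain there leaves
    room for a new point strictly above it. *)
Lemma chain_top Nw t y x c : chain Nw t y x c ->
  exists z, [/\ tle y z, (forall u, u \in c -> tle u.1 z) &
    z = y \/ exists2 u, u \in c & z = u.1].
Proof.
case/lastP: c => [|c u] ch.
  by exists y; split; [exact: tle_refl| |left].
exists u.1; split.
- by apply: tltW; case: (proj1 ch u); rewrite ?mem_rcons ?mem_head// => _ [].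
- move=> w; rewrite mem_rcons inE => /orP[/eqP->|wc]; first exact: tle_refl.
  exact/tltW/(proj1 (chain_rcons_last ch wc)).
- by right; exists u => //; rewrite mem_rcons mem_head.
Qed.

Lemma chain_uniq Nw t y x c : chain Nw t y x c -> uniq c.
Proof.
move=> [_ h]; apply: sorted_uniq h; first exact: stltb_trans.
by move=> p; apply/asboolP => -[_]; rewrite ltxx.
Qed.

Lemma Hlen_chain Nw t y x c : chain Nw t y x c ->
  ((size c)%:R%:E <= Hlen Nw y x t)%E.
Proof.
move=> /chainP ch; apply: ereal_sup_ubound; exists (size c) => //.
by exists c; split.
Qed.

Lemma Hlen_gt Nw t y x (a : \bar R) : (a < Hlen Nw y x t)%E ->
  exists2 c, chain Nw t y x c & (a < (size c)%:R%:E)%E.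
Proof.
move=> /ereal_sup_gt[_ [m [c [cm hc]] <-]] am.
by exists c; [exact/chainP|rewrite cm].
Qed.

Lemma Zstar_Hlen Nw y x t : Zstar (Hlen Nw y x t).
Proof. by apply: Zstar_ereal_sup => _ [m _ <-]; exact: Zstar_nat. Qed.

Definition regular_state s :=
  (forall x, Zstar (s x)) /\ (forall x y, tle x y -> (s x <= s y)%E).

Lemma Zstar_height Nw s t x : regular_state s -> Zstar (height Nw s t x).
Proof.
move=> [Zs _]; rewrite /height; case: ifP => // _.
apply: Zstar_ereal_sup => _ [y _ <-]; apply: Zstar_add => //.
exact: Zstar_Hlen.
Qed.

(** Every integer lower bound on a height has a finite witness. For t <= 0 only the empty chain
    exists, and by monotonicity of [s] the best start is x itself. *)
Lemma height_geP Nw s t x (v : int) : regular_state s ->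
  (v%:~R%:E <= height Nw s t x)%E <->
  exists y c, [/\ tle y x, chain Nw t y x c &
     (v%:~R%:E <= s y + (size c)%:R%:E)%E].
Proof.
move=> [Zs ms]; rewrite /height; case: ifPn => [t0|t0].
  split=> [h|[y [c [yx [h1 h2] h3]]]].
    by exists x, [::]; split=> //; rewrite ?adde0//; exact: tle_refl.
  apply: le_trans (ms _ _ yx); case: c h1 h3 {h2} => [|p c h1].
    by rewrite adde0.
  have [_ [_ [_ /andP[p0 pt]]]] := h1 p (mem_head _ _).
  by have := lt_le_trans p0 (le_trans pt t0); rewrite ltxx.
split=> [h|[y [c [yx ch h3]]]]; last first.
  apply: (le_trans h3); apply: (@le_trans _ _ (s y + Hlen Nw y x t)%E).
    by rewrite leeD2l// Hlen_chain.
  by apply: ereal_sup_ubound; exists y.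
(* Lowering v to v - 1 makes the bound strict, which yields a member of the set; integrality
   restores v at the end. *)
have : ((v - 1)%:~R%:E < ereal_sup
    [set (s y + Hlen Nw y x t)%E | y in [set y | tle y x]])%E.
  by apply: lt_le_trans h; rewrite lte_fin ltr_int; lia.
move=> /ereal_sup_gt[_ [y yx <-]] vy.
suff [c ch hc] : exists2 c, chain Nw t y x c &
    ((v - 1)%:~R%:E < s y + (size c)%:R%:E)%E.
  exists y, c; split=> //; apply: Zstar_ltW => //.
  by apply: Zstar_add => //; exact: Zstar_nat.
case: (Zs y) vy => [->|[->|[z ->]]] vy.
- by exists [::]; [exact: chain_nil|rewrite addye// ltry].
- by move: vy; rewrite addNye ltNge leNye.
- have : ((v - 1 - z)%:~R%:E < Hlen Nw y x t)%E.
    by rewrite intrB EFinB lteBlDl.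
  move=> /Hlen_gt[c ch hc]; exists c => //.
  by move: hc; rewrite intrB EFinB lteBlDl.
Qed.

Lemma height_mono Nw s t x x' : regular_state s -> tle x x' ->
  (height Nw s t x <= height Nw s t x')%E.
Proof.
move=> rs xx'; apply: Zstar_le; first exact: Zstar_height.
move=> v /height_geP-/(_ rs)[y [c [yx ch h]]]; apply/(height_geP _ _ _ _ rs).
exists y, c; split=> //; first exact: tle_trans yx xx'.
exact: chain_sub ch.
Qed.

Lemma height_regular Nw s t : regular_state s -> regular_state (height Nw s t).
Proof.
by move=> rs; split=> [x|x y]; [exact: Zstar_height|exact: height_mono].
Qed.

Lemma height_ge_init Nw s t x : regular_state s -> (s x <= height Nw s t x)%E.
Proof.
move=> rs; apply: Zstar_le; first by case: rs.
move=> v h; apply/(height_geP _ _ _ _ rs); exists x, [::].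
by split; [exact: tle_refl| |rewrite adde0].
Qed.

Lemma height_ext Nw Nw' s t t' x x' : regular_state s ->
  (forall v : int, (v%:~R%:E <= height Nw s t x)%E <->
                   (v%:~R%:E <= height Nw' s t' x')%E) ->
  height Nw s t x = height Nw' s t' x'.
Proof. by move=> rs h; apply: Zstar_ext => //; exact: Zstar_height. Qed.

End chains.

(** * The state space *)

Section state_space.
Context {R : realType} {d : nat}.
Implicit Types (x y z : pt R d) (s : state R d) (D : seq R).

Definition in_halfopen (q : R) x := forall i, - q <= tnth x i < q.

Definition same_side D x x' :=
  forall i a, a \in D -> (a <= tnth x i) = (a <= tnth x' i).

(* Condition (ii) with one list of breakpoints common to all the axes. *)
Definition stepwise s (q : R) D := forall x x',
  in_halfopen q x -> in_halfopen q x' -> same_side D x x' -> s x = s x'.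

Definition stepwise_partition s (q : R) := exists part : 'I_d -> seq R,
     (forall i, (2 <= size (part i))%N /\ sorted <%R (part i) /\
                head 0 (part i) = - q /\ last 0 (part i) = q) /\
     (forall x x' : pt R d,
        (forall i : 'I_d, exists k : nat, (k.+1 < size (part i))%N /\
            (part i)`_k <= tnth x i < (part i)`_k.+1 /\
            (part i)`_k <= tnth x' i < (part i)`_k.+1) ->
        s x = s x').

Definition growth s := forall (b : pt R d) (A : R), exists M : R, 0 < M /\
     forall y : pt R d, tle y b -> M <= supnorm y ->
       ((powR (supnorm y) (- (d%:R / d.+1%:R)))%:E * s y <= A%:E)%E.

(** The partitions of all axes are merged into one list. The interval of x on an axis starts at the
    last breakpoint not above x, and agreement of sides puts x' into the same interval. *)
Lemma stepwise_of_partition s q :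
  stepwise_partition s q -> exists D, stepwise s q D.
Proof.
move=> [part [hp hs]]; exists (flatten [seq part i | i <- enum 'I_d]).
move=> x x' hx hx' xx'; apply: hs => i.
have [sz [_ [h0 hl]]] := hp i.
pose Q j := (j < size (part i))%N && ((part i)`_j <= tnth x i).
have Q0 : exists j, Q j.
  exists 0%N; rewrite /Q (leq_trans _ sz)//= nth0 h0.
  by have /andP[] := hx i.
have Qb j : Q j -> (j <= size (part i))%N by move=> /andP[/ltnW].
case: (ex_maxnP Q0 Qb) => k /andP[ks kx] kmax.
have ks1 : (k.+1 < size (part i))%N.
  rewrite ltn_neqAle ks andbT; apply/eqP => ek.
  have /andP[_] := hx i; rewrite ltNge -[X in X <= _]hl -nth_last.
  by rewrite -ek/= kx.
have kx1 : tnth x i < (part i)`_k.+1.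
  rewrite ltNge; apply/negP => h.
  by have := kmax k.+1; rewrite /Q ks1 h ltnn => /(_ isT).
have inD j : (j < size (part i))%N ->
    (part i)`_j \in flatten [seq part i | i <- enum 'I_d].
  move=> js; apply/flattenP; exists (part i); last exact: mem_nth.
  by apply/mapP; exists i => //; rewrite mem_enum.
exists k; split=> //; split; first by rewrite kx kx1.
by rewrite -(xx' i) ?inD// kx ltNge -(xx' i) ?inD// -ltNge kx1.
Qed.

(** Every axis gets the same partition: the breakpoints inside (-q, q) and the two ends. The
    discarded breakpoints separate no two points of the half-open cube. *)
Lemma partition_of_stepwise s q D :
  0 < q -> stepwise s q D -> stepwise_partition s q.
Proof.
move=> q0 hs.
pose E := undup (- q :: q :: [seq a <- D | - q < a < q]).
pose p := sort <=%R E.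
have memp a : (a \in p) = [|| a == - q, a == q | (- q < a < q) && (a \in D)].
  by rewrite mem_sort mem_undup !inE mem_filter.
have sp : sorted <%R p by rewrite sort_lt_sorted undup_uniq.
have ple a : a \in p -> - q <= a <= q.
  by rewrite memp => /or3P[/eqP->|/eqP->|/andP[/andP[h1 h2] _]]; apply/andP; split; lra.
have sz : (2 <= size p)%N.
  have /uniq_leq_size : uniq [:: - q; q].
    by rewrite /= inE andbT; apply/eqP; lra.
  by apply=> a; rewrite !inE memp => /orP[->|->]; rewrite ?orbT.
have mono i j : (i < size p)%N -> (j < size p)%N -> (i <= j)%N -> p`_i <= p`_j.
  move=> hi hj ij; apply: (sorted_leq_nth le_trans) => //.
  by apply: sub_sorted sp => u v /ltW.
have h0 : head 0 p = - q.
  rewrite -nth0; apply/eqP; rewrite eq_le; apply/andP; split.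
    have : - q \in p by rewrite memp eqxx.
    by move=> /(nthP 0)[j js <-]; apply: mono => //; exact: leq_trans sz.
  have h : p`_0 \in p by rewrite mem_nth// (leq_trans _ sz).
  by have /andP[] := ple _ h.
have hl : last 0 p = q.
  have lp : ((size p).-1 < size p)%N by rewrite prednK// (leq_trans _ sz).
  rewrite -nth_last; apply/eqP; rewrite eq_le; apply/andP; split.
    by have /andP[] := ple _ (mem_nth 0 lp).
  have : q \in p by rewrite memp eqxx orbT.
  move=> /(nthP 0)[j js <-]; apply: mono => //.
  by rewrite -ltnS prednK// (leq_trans _ sz).
exists (fun=> p); split=> // x x' h; apply: hs.
- move=> i; have [k [ks [/andP[h1 h2] _]]] := h i.
  have /andP[a1 _] := ple _ (mem_nth 0 (ltnW ks)).
  have /andP[_ a2] := ple _ (mem_nth 0 ks).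
  by rewrite (le_trans a1)// (lt_le_trans h2).
- move=> i; have [k [ks [_ /andP[h1 h2]]]] := h i.
  have /andP[a1 _] := ple _ (mem_nth 0 (ltnW ks)).
  have /andP[_ a2] := ple _ (mem_nth 0 ks).
  by rewrite (le_trans a1)// (lt_le_trans h2).
- move=> i a aD; have [k [ks [/andP[x1 x2] /andP[x'1 x'2]]]] := h i.
  have /andP[a1 _] := ple _ (mem_nth 0 (ltnW ks)).
  have /andP[_ a2] := ple _ (mem_nth 0 ks).
  have [aq|aq] := leP a (- q); first by rewrite !(le_trans aq)//; lra.
  have [aq'|aq'] := leP q a.
    by rewrite !leNgt !(lt_le_trans _ aq')//; lra.
  have : a \in p by rewrite memp aq aq' aD !orbT.
  move=> /(nthP 0)[j js <-]; have [jk|jk] := leqP j k.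
    have m1 := mono _ _ js (ltnW ks) jk.
    by rewrite (le_trans m1 x1) (le_trans m1 x'1).
  have m1 := mono _ _ ks js jk.
  by rewrite !leNgt (lt_le_trans x2 m1) (lt_le_trans x'2 m1).
Qed.

Lemma in_SigmaP s : in_Sigma s <->
  [/\ regular_state s, forall q, 0 < q -> exists D, stepwise s q D & growth s].
Proof.
split=> [[h1 [h2 [h3 h4]]]|[[h1 h2] h3 h4]].
  by split=> // q /h3 h; exact: stepwise_of_partition.
do 3 split=> //; move=> q q0; have [D] := h3 _ q0.
exact: partition_of_stepwise.
Qed.

Lemma in_Sigma_regular s : in_Sigma s -> regular_state s.
Proof. by move=> /in_SigmaP[]. Qed.

Lemma in_Sigma_stepwise s q : in_Sigma s -> 0 < q -> exists D, stepwise s q D.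
Proof. by move=> /in_SigmaP[_ h _]; exact: h. Qed.

Lemma supnorm_ge0 x : 0 <= supnorm x.
Proof. by rewrite /supnorm; elim/big_ind: _ => // u v; rewrite le_max => ->. Qed.

Lemma supnorm_ge x i : `|tnth x i| <= supnorm x.
Proof. by rewrite /supnorm (bigD1 i)//= le_max lexx. Qed.

Lemma supnorm_le x (a : R) : 0 <= a -> (forall i, `|tnth x i| <= a) ->
  supnorm x <= a.
Proof.
move=> a0 h; rewrite /supnorm; elim/big_ind: _ => // u v hu hv.
by rewrite ge_max hu hv.
Qed.

(** Beyond norm 1 the weight is at most 1, so adding K costs at most K; this is absorbed by asking
    [s] for the bound A - K. *)
Lemma growth_addK s s' (K : R) : 0 <= K -> growth s ->
  (forall x, (s' x <= s x + K%:E)%E) -> growth s'.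
Proof.
move=> K0 gs ss' b A; have [M [M0 hM]] := gs b (A - K).
exists (Num.max M 1); split; first by rewrite lt_max M0.
move=> y yb; rewrite ge_max => /andP[My y1].
have := hM _ yb My; set c := powR _ _.
have c1 : 0 < c <= 1.
  rewrite powR_gt0 ?(lt_le_trans ltr01)//= /c powRN invf_le1.
    have := @ler_powR _ _ y1 0 (d%:R / d.+1%:R).
    by rewrite powRr0; apply; rewrite divr_ge0.
  by rewrite powR_gt0 ?(lt_le_trans ltr01).
case/andP: c1 => c0 c1.
move=> h; apply: (@le_trans _ _ (c%:E * (s y + K%:E))%E).
  by rewrite lee_pmul2l// ?lte_fin.
case: (s y) h => [r||].
- rewrite -EFinD -!EFinM !lee_fin; nra.
- by rewrite gt0_muley ?lte_fin.
- by rewrite addNye gt0_muleNy ?lte_fin// !leNye.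
Qed.

Lemma pos_gap (l : seq (R * R)) : exists2 e : R, 0 < e &
  forall a b, (a, b) \in l -> a < b -> a + e <= b.
Proof.
elim: l => [|[a b] l [e e0 he]]; first by exists 1.
have [ab|ab] := ltP a b.
  exists (Num.min e (b - a)); first by rewrite lt_min e0 subr_gt0.
  move=> a' b'; rewrite inE => /orP[/eqP[-> ->] _|h h'].
    by rewrite -lerBrDl ge_min lexx orbT.
  by apply: le_trans (he _ _ h h'); rewrite lerD2l ge_min lexx.
exists e => // a' b'; rewrite inE => /orP[/eqP[-> ->]|].
  by rewrite ltNge ab.
exact: he.
Qed.

Lemma in_halfopen_supnorm x (q : R) : supnorm x < q -> in_halfopen q x.
Proof.
move=> h i; have := le_lt_trans (supnorm_ge x i) h.
by rewrite ltr_norml => /andP[/ltW -> ->].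
Qed.

(** The rectangles of condition (ii) are closed on the left; e keeps z below the next breakpoint and
    below the edge q. *)
Lemma Sigma_right_const s x : in_Sigma s ->
  exists2 e : R, 0 < e & forall z, tle x z ->
    (forall i, tnth z i < tnth x i + e) -> s z = s x.
Proof.
move=> hs; set q := supnorm x + 1.
have q0 : 0 < q by rewrite ltr_wpDl// supnorm_ge0.
have [D hD] := in_Sigma_stepwise hs q0.
have hx : in_halfopen q x by apply: in_halfopen_supnorm; rewrite ltrDl.
have [e e0 he] := pos_gap [seq (tnth x i, a) | i <- enum 'I_d, a <- q :: D].
have xD i a : a \in q :: D -> tnth x i < a -> tnth x i + e <= a.
  move=> aD; apply: he; apply/allpairsP; exists (i, a).
  by split=> //=; rewrite mem_enum.
exists e => // z xz zx; apply: hD => //.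
  move=> i; have /andP[h1 h2] := hx i.
  rewrite (le_trans h1)//= (lt_le_trans (zx i))// xD// mem_head//.
move=> i a aD; apply/idP/idP => h; last exact: le_trans (xz i).
rewrite leNgt; apply/negP => h'.
have := xD i a _ h'; rewrite inE aD orbT => /(_ isT) h2.
by have := lt_le_trans (zx i) (le_trans h2 h); rewrite ltxx.
Qed.

(** Left constancy fails only on hyperplanes through breakpoints. It reconciles a new point, which
    extends chains ending strictly below it, with [shift], which reads the value at the point
    itself. *)
Lemma Sigma_left_const s q : in_Sigma s -> 0 < q -> exists D, forall y,
  (forall i, - q < tnth y i < q) -> (forall i, tnth y i \notin D) ->
  exists2 z, tlt z y & s z = s y.
Proof.
move=> hs q0; have [D hD] := in_Sigma_stepwise hs q0.
exists D => y hy yD.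
have [e e0 he] := pos_gap [seq (a, tnth y i) | i <- enum 'I_d, a <- - q :: D].
have xD i a : a \in - q :: D -> a < tnth y i -> a + e <= tnth y i.
  move=> aD; apply: he; apply/allpairsP; exists (i, a).
  by split=> //=; rewrite mem_enum.
exists [tuple tnth y i - e | i < d].
  by move=> i; rewrite tnth_mktuple ltrBlDr ltrDl.
apply: hD.
- move=> i; rewrite tnth_mktuple; have /andP[h1 h2] := hy i.
  by rewrite lerBrDr xD ?mem_head//= ltrBlDr (lt_trans h2)// ltrDl.
- by move=> i; have /andP[/ltW -> ->] := hy i.
- move=> i a aD; rewrite tnth_mktuple; apply/idP/idP => h.
    by rewrite (le_trans h)// lerBlDr lerDl ltW.
  rewrite lerBrDr xD ?inE ?aD ?orbT// lt_neqAle h andbT.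
  by apply: contraNneq (yD i) => <-.
Qed.

Lemma height_finite_bound Nw s t : regular_state s -> finite_set Nw ->
  exists2 K : R, 0 <= K & forall x, (height Nw s t x <= s x + K%:E)%E.
Proof.
move=> rs /finite_seqP[l Nl]; exists (size l)%:R => // x.
apply: Zstar_le; first exact: Zstar_height.
move=> v /(height_geP _ _ _ _ rs)[y [c [yx ch h]]]; apply: (le_trans h).
apply: leeD; first by case: rs => _; apply.
rewrite lee_fin ler_nat; apply: uniq_leq_size; first exact: chain_uniq ch.
by move=> p /(proj1 ch); rewrite Nl => -[].
Qed.

(* Starting points of chains can be raised into a cube containing the points of
   the configuration, so that the breakpoints of [s] on that cube, together
   with the coordinates of the configuration, are breakpoints of the height. *)
Lemma height_finite_Sigma Nw s t : in_Sigma s -> finite_set Nw ->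
  in_Sigma (height Nw s t).
Proof.
move=> hs fN; have rs := in_Sigma_regular hs.
apply/in_SigmaP; split; first exact: height_regular.
- move=> q q0; have /finite_seqP[l Nl] := fN.
  pose M := q + \sum_(p <- l) supnorm p.1 + 1.
  have Mp p : p \in l -> supnorm p.1 < M.
    move=> pl; rewrite /M (big_rem p)//=.
    have : 0 <= \sum_(y <- rem p l) supnorm y.1.
      by apply: sumr_ge0 => *; exact: supnorm_ge0.
    lra.
  have qM : q < M.
    have : 0 <= \sum_(y <- l) supnorm y.1.
      by apply: sumr_ge0 => *; exact: supnorm_ge0.
    rewrite /M; lra.
  have [D hD] := in_Sigma_stepwise hs (lt_trans q0 qM).
  exists (D ++ flatten [seq tval p.1 | p <- l]).
  suff H x x' : in_halfopen q x -> in_halfopen q x' ->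
      same_side (D ++ flatten [seq tval p.1 | p <- l]) x x' ->
      forall v : int, (v%:~R%:E <= height Nw s t x)%E ->
                      (v%:~R%:E <= height Nw s t x')%E.
    move=> x x' hx hx' xx'; apply: height_ext => // v; split; apply: H => //.
    by move=> i a aD; rewrite (xx' i).
  move=> hx hx' xx' v /(height_geP _ _ _ _ rs)[y [c [yx ch h]]].
  pose y1 : pt R d := [tuple Num.max (tnth y i) (- M) | i < d].
  (* [y2] lowers the start under [x']. No breakpoint is crossed: one below [y1] is below [x], hence
     below [x']. *)
  pose y2 : pt R d := [tuple Num.min (tnth y1 i) (tnth x' i) | i < d].
  have y1x i : tnth y1 i <= tnth x i.
    rewrite tnth_mktuple ge_max (yx i)/=; have /andP[] := hx i; lra.
  have sy2 : s y2 = s y1.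
    apply: hD.
    - move=> i; rewrite !tnth_mktuple le_min le_max lexx orbT/=.
      have /andP[h1 h2] := hx' i.
      by rewrite gt_min (lt_trans h2)// orbT andbT; lra.
    - move=> i; rewrite !tnth_mktuple le_max lexx orbT/=.
      have := y1x i; rewrite tnth_mktuple => /le_lt_trans; apply.
      by have /andP[h1 h2] := hx i; exact: lt_trans qM.
    - move=> i a aD; rewrite [tnth y2 i]tnth_mktuple le_min.
      apply/andP/idP => [[]//|ay]; split=> //.
      rewrite -(xx' i) ?mem_cat ?aD//.
      exact: le_trans (y1x i).
  apply/(height_geP _ _ _ _ rs); exists y2, c; split.
  - by move=> i; rewrite tnth_mktuple ge_min lexx orbT.
  - case: ch => ch1 ch2; split=> // p pc.
    have [Np [yp [px pt]]] := ch1 _ pc; split=> //.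
    have pl : p \in l by move: Np; rewrite Nl.
    split; [|split=> //] => i.
    + rewrite !tnth_mktuple gt_min gt_max (yp i)/=; apply/orP; left.
      have := le_lt_trans (supnorm_ge p.1 i) (Mp _ pl).
      by rewrite ltr_norml => /andP[].
    + rewrite -(xx' i) ?(px i)// mem_cat; apply/orP; right.
      apply/flattenP; exists (tval p.1); last exact: mem_tnth.
      by apply/mapP; exists p.
  - rewrite sy2; apply: (le_trans h); rewrite leeD2r//.
    by case: rs => _; apply=> i; rewrite tnth_mktuple le_max lexx.
- have [K K0 hK] := height_finite_bound t rs fN.
  by apply: (growth_addK K0 _ hK); case/in_SigmaP: hs.
Qed.

(** The clause s x = s y of [shift] disappears: if s y < s x, then v - 1 <= s y already gives v <= s
    x by integrality. *)
Lemma shift_geP s y x (v : int) : regular_state s ->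
  (v%:~R%:E <= Defs.shift s y x)%E <->
  (v%:~R%:E <= s x)%E \/ (tle y x /\ ((v - 1)%:~R%:E <= s y)%E).
Proof.
move=> [Zs ms]; rewrite /Defs.shift; case: asboolP => [[yx [sxy fy]]|h].
  case: (Zs y) sxy fy => [->//|[->//|[z ->]]] -> _.
  rewrite -EFinD -[1%R]/(1%:~R) -intrD !lee_fin !ler_int.
  split; first by right; split=> //; lia.
  by case=> [|[_]]; lia.
split; [by left|case=> // -[yx vy]].
have := ms _ _ yx; rewrite le_eqVlt => /orP[/eqP sxy|lt].
  case: (Zs y) sxy vy => [Ey|[Ey|[z Ey]]] sxy vy.
  - by rewrite -sxy Ey leey.
  - by move: vy; rewrite Ey leeNy_eq.
  - by exfalso; apply: h; rewrite -sxy Ey.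
by apply: Zstar_ltW => //; exact: le_lt_trans lt.
Qed.

Lemma Zstar_shift s y x : regular_state s -> Zstar (Defs.shift s y x).
Proof.
move=> [Zs _]; rewrite /Defs.shift; case: ifP => // _.
by apply: Zstar_add => //; exact: (Zstar_nat 1).
Qed.

Lemma shift_Sigma s y : in_Sigma s -> in_Sigma (Defs.shift s y).
Proof.
move=> hs; have rs := in_Sigma_regular hs.
apply/in_SigmaP; split.
- split=> [x|x x' xx']; first exact: Zstar_shift.
  apply: Zstar_le; first exact: Zstar_shift.
  move=> v /(shift_geP _ _ _ rs)h; apply/(shift_geP _ _ _ rs).
  case: h => [h|[h1 h2]]; [left|right].
    by apply: (le_trans h); case: rs => _; apply.
  by split=> //; exact: tle_trans xx'.
- move=> q q0; have [D hD] := in_Sigma_stepwise hs q0.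
  exists (D ++ tval y) => x x' hx hx' xx'.
  have sxx' : s x = s x'.
    by apply: hD => // i a aD; apply: xx'; rewrite mem_cat aD.
  rewrite /Defs.shift sxx'; congr (if _ then _ else _).
  apply: asbool_equiv_eq; split=> -[h h']; split=> // i.
    by rewrite -(xx' i) ?h// mem_cat mem_tnth orbT.
  by rewrite (xx' i) ?h// mem_cat mem_tnth orbT.
- apply: (@growth_addK s _ 1) => //; first by case/in_SigmaP: hs.
  move=> x; rewrite /Defs.shift; case: ifP => // _.
  by rewrite leeDl// lee_fin.
Qed.

(** The arrival time is left existential because the resulting height depends on the location
    alone. *)
Definition add_points (Nw Nw' : set (stpt R d)) (r t : R) (Y : pt R d) :=
  (forall p, p.2 <= r -> Nw p <-> Nw' p) /\
  (exists tau, r < tau <= t /\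
   forall p, r < p.2 <= t -> (Nw' p <-> p = (Y, tau))).

(* A point added after time [r] can only be the last point of a chain. *)
Lemma height_add_point Nw Nw' s r t Y x (v : int) : regular_state s -> r <= t ->
  0 <= r -> add_points Nw Nw' r t Y ->
  (v%:~R%:E <= height Nw' s t x)%E <->
  (v%:~R%:E <= height Nw s r x)%E \/
  (tle Y x /\ exists2 z, tlt z Y & ((v - 1)%:~R%:E <= height Nw s r z)%E).
Proof.
move=> rs rt r0 [hN [tau [/andP[rtau taut] hY]]]; split.
  move=> /(height_geP _ _ _ _ rs)[y [c [yx ch h]]].
  have [/allP call|/allPn[p pc pr]] := boolP (all (fun p => p.2 <= r) c).
    left; apply/(height_geP _ _ _ _ rs); exists y, c; split=> //.
    case: ch => ch1 ch2; split=> // p pc; have [Np [? [? /andP[? _]]]] := ch1 _ pc.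
    by split; [exact/hN/Np/call|do 2 split=> //; apply/andP; split=> //; exact: call].
  right.
  have newE p' : p' \in c -> r < p'.2 -> p' = (Y, tau).
    move=> p'c rp'; apply/hY; have [Np [_ [_ /andP[_ pt]]]] := proj1 ch _ p'c => //.
    by rewrite rp' pt.
  rewrite -ltNge in pr.
  case/lastP: c pc ch h newE => [//|c p'] pc ch h newE.
  have lastc := chain_rcons_last ch.
  have p'E : p' = (Y, tau).
    move: pc; rewrite mem_rcons inE => /orP[/eqP E|pc].
      by rewrite -E; apply: newE => //; rewrite E mem_rcons mem_head.
    apply: newE; first by rewrite mem_rcons mem_head.
    exact: lt_trans pr (proj2 (lastc _ pc)).
  have cr u : u \in c -> u.2 <= r.
    move=> uc; rewrite leNgt; apply/negP => ur.
    have := newE u; rewrite mem_rcons inE uc orbT => /(_ isT ur) uE.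
    by have := proj2 (lastc _ uc); rewrite uE p'E/= ltxx.
  have [_ [yY [Yx _]]] : Nw' p' /\ tlt y p'.1 /\ tle p'.1 x /\ 0 < p'.2 <= t.
    by apply: (proj1 ch); rewrite mem_rcons mem_head.
  rewrite p'E/= in yY Yx; split=> //.
  have chc := chain_belast ch.
  have [z [yz cz zE]] := chain_top chc.
  exists z.
    by case: zE => [->//|[u /lastc[+ _] ->]]; rewrite p'E.
  apply/(height_geP _ _ _ _ rs); exists y, c; split=> //.
    case: ch => ch1 _; split; last exact: (proj2 chc).
    move=> u uc; have ur : u \in rcons c p' by rewrite mem_rcons inE uc orbT.
    have [Nu [yu [_ /andP[u0 _]]]] := ch1 _ ur.
    split; first by apply/hN => //; exact: cr.
    by do 2 (split; auto); rewrite u0 cr.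
  move: h; rewrite size_rcons -natr1 EFinD addeA intrB EFinB.
  by rewrite leeBlDr.
case=> [|[Yx [z zY]]] /(height_geP _ _ _ _ rs)[y [c [yx ch h]]];
    apply/(height_geP _ _ _ _ rs).
  exists y, c; split=> //; apply: (chain_sub _ rt _ _ ch); try exact: tle_refl.
  move=> p pc Np; apply/hN => //.
  by have [_ [_ [_ /andP[_ ->]]]] := proj1 ch _ pc.
exists y, (rcons c (Y, tau)); split.
- exact: tle_trans yx (tle_trans (tltW zY) Yx).
- case: ch => ch1 ch2; split.
    move=> p; rewrite mem_rcons inE => /orP[/eqP->/=|pc].
      split; first by apply/hY => //=; rewrite rtau.
      split; first exact: tle_tlt_trans yx zY.
      by split=> //; rewrite taut (le_lt_trans r0 rtau).
    have [Np [yp [pz /andP[p0 pr]]]] := ch1 _ pc.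
    split; first exact/hN.
    split=> //; split; first exact: tle_trans pz (tle_trans (tltW zY) Yx).
    by rewrite p0 (le_trans pr).
  rewrite sorted_pairwise; last exact: stltb_trans.
  rewrite pairwise_rcons -sorted_pairwise ?ch2 ?andbT; last exact: stltb_trans.
  apply/allP => u /ch1[_ [_ [uz /andP[_ ur]]]]; apply/asboolP.
  by split; [exact: tle_tlt_trans uz zY|exact: le_lt_trans ur rtau].
- rewrite size_rcons -natr1 EFinD addeA.
  by move: h; rewrite intrB EFinB leeBlDr.
Qed.

End state_space.

(** * Localization of the height *)

Section localization.
Context {R : realType} {d : nat}.
Implicit Types (x y z : pt R d) (s : state R d) (Nw : set (stpt R d)).

Definition diag (a : R) : pt R d := [tuple a | i < d].

Definition spbox (L : R) : set (pt R d) := [set y | forall i, - L < tnth y i <= L].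

Definition trunc Nw (L T : R) : set (stpt R d) :=
  [set p | Nw p /\ spbox L p.1 /\ 0 < p.2 <= T].

Local Notation alpha := (d%:R / d.+1%:R : R).

(* Twice the mean number of points of (-m, b]^d x (0, b] is at most
   [kap b * m ^ d / expR d.+1], which makes chains of [klen b m] points
   exponentially unlikely. *)
Definition kap (b : nat) : nat :=
  (Num.trunc (2 ^+ d * b%:R * expR d.+2%:R : R)).+1.

Lemma klen_ex b (m : nat) : exists k, (kap b * m ^ d <= k ^ d.+1)%N.
Proof.
exists (kap b * m ^ d)%N; case: (_ * _)%N => [|n]; first by rewrite exp0n.
by rewrite expnS leq_pmulr// expn_gt0.
Qed.

Definition klen (b m : nat) : nat := ex_minn (klen_ex b m).

Lemma klen_ge b m : (kap b * m ^ d <= klen b m ^ d.+1)%N.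
Proof. by rewrite /klen; case: ex_minnP. Qed.

Lemma klen_le b m : (0 < m)%N ->
  (klen b m)%:R <= (1 + (kap b)%:R) * (m%:R `^ alpha) :> R.
Proof.
move=> m0; set a := m%:R `^ alpha.
have a1 : 1 <= a.
  have m1 : 1 <= m%:R :> R by rewrite ler1n.
  have := @ler_powR _ _ m1 0 alpha.
  by rewrite powRr0; apply; rewrite divr_ge0.
have ad : a ^+ d.+1 = m%:R ^+ d.
  rewrite -powR_mulrn; last by lra.
  by rewrite /a -powRrM divfK ?pnatr_eq0// powR_mulrn.
rewrite /klen; case: ex_minnP => -[|k] _ kmin.
  by rewrite mulr_ge0 ?addr_ge0//; lra.
rewrite -natr1 addrC mulrDl mul1r lerD// leNgt; apply/negP => h.
(* A k above [kap b * a] would already meet the condition that [klen] minimizes, because 1 <= kap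
   gives kap <= kap^(d+1). *)
have : (k.+1 <= k)%N.
  apply: kmin; rewrite -(ler_nat R) natrM !natrX -ad.
  have k1 : (1 <= (kap b)%:R :> R) by rewrite ler1n.
  have : (a * (kap b)%:R) ^+ d.+1 <= k%:R ^+ d.+1.
    apply: lerXn2r; [by rewrite nnegrE mulr_ge0//; lra|by rewrite nnegrE|].
    by rewrite mulrC ltW.
  apply: le_trans; rewrite exprMn mulrC ler_wpM2l// ?exprn_ge0//; first lra.
  by rewrite -[X in X <= _]expr1; apply: ler_weXn2l.
by rewrite ltnn.
Qed.

Definition short_chains Nw (b ms : nat) := forall m c, (ms <= m)%N ->
  chain Nw b%:R (diag (- m%:R)) (diag b%:R) c -> (size c < klen b m)%N.

Lemma short_chains_le Nw b ms ms' : (ms <= ms')%N ->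
  short_chains Nw b ms -> short_chains Nw b ms'.
Proof. by move=> mm h m c mm'; apply: h; exact: leq_trans mm'. Qed.

(** Growth is used with A - 2 * cb. A chain started at z fits in the box of level m = floor |z| + 1
    <= 2 |z|, so it has at most cb * m^alpha <= 2 * cb * |z|^alpha points, as alpha <= 1. *)
Lemma chain_weight_bound s (b : nat) (A : R) : in_Sigma s ->
  exists2 M : nat, (0 < M)%N & forall Nw ms, (M <= ms)%N ->
  short_chains Nw b ms -> forall (t : R) z y c, t <= b%:R ->
  tle y (diag b%:R) -> tle z y -> ms%:R <= supnorm z -> chain Nw t z y c ->
  (s z + (size c)%:R%:E <= (A * supnorm z `^ alpha)%:E)%E.
Proof.
move=> /in_SigmaP[_ _ gs]; set cb : R := 1 + (kap b)%:R.
have cb0 : 0 <= cb by rewrite addr_ge0.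
have [M [M0 hM]] := gs (diag b%:R) (A - 2 * cb).
exists (Num.trunc M).+1 => // Nw ms Mms hs t z y c tb yb zy msz ch.
have Mz : M <= supnorm z.
  apply: le_trans msz; apply: ltW; apply: lt_le_trans (truncnS_gt M) _.
  by rewrite ler_nat.
have ms1 : (0 < ms)%N by exact: leq_trans Mms.
have z1 : 1 <= supnorm z by apply: le_trans msz; rewrite ler1n.
set m := (Num.trunc (supnorm z)).+1.
have /andP[ml mu] := truncn_itv (supnorm_ge0 z).
have msm : (ms <= m)%N by rewrite -(ler_nat R); exact/ltW/(le_lt_trans msz).
have cm : (size c < klen b m)%N.
  apply: (hs m c msm).
  apply: (chain_sub _ tb _ _ ch) => //.
    move=> i; rewrite tnth_mktuple; have := supnorm_ge z i.
    rewrite ler_norml => /andP[h _]; apply: le_trans h.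
    by rewrite lerN2 ltW.
have z0 : 0 < supnorm z by lra.
have a0 : 0 < supnorm z `^ alpha by exact: powR_gt0.
have cle : (size c)%:R <= 2 * cb * supnorm z `^ alpha.
  apply: (@le_trans _ _ (klen b m)%:R); first by rewrite ler_nat ltnW.
  apply: le_trans (klen_le b _) _ => //.
  rewrite (mulrC 2) -mulrA ler_wpM2l//.
  apply: (@le_trans _ _ ((2 * supnorm z) `^ alpha)).
    apply: ge0_ler_powR; rewrite ?divr_ge0 ?nnegrE//; first by lra.
    by rewrite /m -natr1; lra.
  rewrite powRM ?supnorm_ge0// ler_wpM2r ?powR_ge0//.
  have := @ler_powR _ 2 _ alpha 1; rewrite powRr1//; apply; first by lra.
  by rewrite ler_pdivrMr// mul1r ler_nat.
have := hM z (tle_trans zy yb) Mz; rewrite powRN.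
case: (s z) => [r||].
- rewrite -EFinM -EFinD !lee_fin => h.
  have : r <= (A - 2 * cb) * supnorm z `^ alpha by rewrite -ler_pdivrMr// mulrC.
  lra.
- by rewrite gt0_muley// lte_fin invr_gt0.
- by rewrite addNye leNye.
Qed.

(** If some coordinate of z were at most -ms, then |z| >= 1 and the slope -(|m0| + 1) would push the
    total below m0. *)
Lemma chain_start_bound s (b : nat) (m0 : int) : in_Sigma s ->
  exists2 M : nat, (0 < M)%N & forall Nw ms, (M <= ms)%N ->
  short_chains Nw b ms -> forall (t : R) z y c, t <= b%:R ->
  tle y (diag b%:R) -> tle z y -> chain Nw t z y c ->
  (m0%:~R%:E <= s z + (size c)%:R%:E)%E -> forall i, - ms%:R < tnth z i.
Proof.
move=> hs; have [M M0 hM] := chain_weight_bound b (- (`|m0|%:~R + 1)) hs.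
exists M => // Nw ms Mms hsc t z y c tb yb zy ch h i.
rewrite ltNge; apply/negP => zi.
have msz : ms%:R <= supnorm z.
  apply: le_trans (supnorm_ge z i); rewrite ler_normr; apply/orP; right.
  by rewrite lerNr.
have := hM _ _ Mms hsc _ _ _ _ tb yb zy msz ch.
have z1 : 1 <= supnorm z.
  by apply: le_trans msz; rewrite ler1n (leq_trans M0).
have a1 : 1 <= supnorm z `^ alpha.
  have := @ler_powR _ _ z1 0 alpha.
  by rewrite powRr0; apply; rewrite divr_ge0.
move=> /(le_trans h); rewrite lee_fin.
have : (0 : R) <= `|m0|%:~R by rewrite ler0z.
have : (- `|m0|%:~R : R) <= m0%:~R by rewrite -intrN ler_int lerNl ler_normr lexx orbT.
nra.
Qed.

Lemma height_Ny Nw s t x : regular_state s -> s x = -oo%E ->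
  height Nw s t x = -oo%E.
Proof.
move=> rs sx; apply/eqP; rewrite -leeNy_eq.
apply: Zstar_le; first exact: Zstar_height.
move=> v /(height_geP _ _ _ _ rs)[y [c [yx _]]].
have sy := proj2 rs _ _ yx; rewrite sx leeNy_eq in sy.
by rewrite (eqP sy) addNye.
Qed.

Lemma trunc_sub Nw L T : trunc Nw L T `<=` Nw.
Proof. by move=> p []. Qed.

Lemma height_trunc_le Nw s t L T x : regular_state s ->
  (height (trunc Nw L T) s t x <= height Nw s t x)%E.
Proof.
move=> rs; apply: Zstar_le; first exact: Zstar_height.
move=> v /(height_geP _ _ _ _ rs)[y [c [yx ch h]]].
apply/(height_geP _ _ _ _ rs); exists y, c; split=> //.
by apply: chain_sub ch => // p _ /trunc_sub.
Qed.

(** Finitely many sign patterns against the breakpoints occur, each carrying a single value; minus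
    the sum of the absolute values bounds all finite ones from below. The cube of size q + 1 is used
    because [cube q] contains its upper faces. *)
Lemma Sigma_cube_min s (q : R) : in_Sigma s -> 0 < q ->
  exists m0 : int, forall x, cube q x -> s x = -oo%E \/ (m0%:~R%:E <= s x)%E.
Proof.
move=> hs q0; have q1 : 0 < q + 1 by rewrite addr_gt0.
have [D hD] := in_Sigma_stepwise hs q1.
pose pat x : {ffun 'I_d * 'I_(size D) -> bool} :=
  [ffun u : 'I_d * 'I_(size D) => D`_u.2 <= tnth x u.1].
have H (f : {ffun 'I_d * 'I_(size D) -> bool}) : exists m : int,
    forall x, cube q x -> pat x = f -> s x = -oo%E \/ (m%:~R%:E <= s x)%E.
  have [[x0 [qx0 fx0]]|nex] := pselect (exists x0, cube q x0 /\ pat x0 = f);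
    last by exists 0 => x qx xf; exfalso; apply: nex; exists x.
  have sx x : cube q x -> pat x = f -> s x = s x0.
    move=> qx xf; apply: hD.
    - by move=> i; have := qx i; lra.
    - by move=> i; have := qx0 i; lra.
    - move=> i a /(nthP 0)[j js <-].
      have := xf; rewrite -fx0 => /ffunP/(_ (i, Ordinal js)).
      by rewrite !ffunE.
  case: (proj1 (in_Sigma_regular hs) x0) => [E|[E|[z E]]].
  - by exists 0 => x qx xf; right; rewrite sx// E leey.
  - by exists 0 => x qx xf; left; rewrite sx.
  - by exists z => x qx xf; right; rewrite sx// E.
have [m hm] := fin_all_exists H.
exists (- \sum_f `|m f|) => x qx; have [->|h] := hm (pat x) x qx erefl; first by left.
right; apply: le_trans h; rewrite lee_fin ler_int lerNl.
rewrite (bigD1 (pat x))//= ler_wpDr//; first by apply: sumr_ge0.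
by rewrite -normrN ler_norm.
Qed.

Definition nice Nw :=
  (forall L : nat, finite_set (trunc Nw L%:R L%:R)) /\
  (forall b, exists ms, short_chains Nw b ms).

Lemma trunc_finite Nw (L T : nat) : nice Nw -> finite_set (trunc Nw L%:R T%:R).
Proof.
move=> [h _]; apply: sub_finite_set (h (maxn L T)) => p [Np [bp /andP[p0 pT]]].
split=> //; split.
  move=> i; have /andP[h1 h2] := bp i.
  have hL : (L%:R : R) <= (maxn L T)%:R by rewrite ler_nat leq_maxl.
  by apply/andP; split; lra.
by rewrite p0 (le_trans pT)// ler_nat leq_maxr.
Qed.

(* The threshold [M] depends on the initial state only, not on the
   configuration. *)
Lemma height_localized s (b : nat) (m0 : int) : in_Sigma s ->
  exists2 M : nat, (0 < M)%N & forall Nw ms L, (M <= ms)%N ->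
  short_chains Nw b ms -> (ms <= L)%N -> (b <= L)%N ->
  forall (t : R) y (v : int), t <= b%:R -> tle y (diag b%:R) -> m0 <= v ->
  (v%:~R%:E <= height Nw s t y)%E ->
  (forall i, - ms%:R < tnth y i) /\
  (v%:~R%:E <= height (trunc Nw L%:R b%:R) s t y)%E.
Proof.
move=> hs; have [M M0 hM] := chain_start_bound b m0 hs.
have rs := in_Sigma_regular hs.
exists M => // Nw ms L Mms hsc msL bL t y v tb yb m0v.
move=> /(height_geP _ _ _ _ rs)[z [c [zy ch h]]].
have zms := hM _ _ Mms hsc _ _ _ _ tb yb zy ch (le_trans _ h).
have {}zms : forall i, - ms%:R < tnth z i.
  by apply: zms; rewrite lee_fin ler_int.
split; first by move=> i; exact: lt_le_trans (zms i) (zy i).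
apply/(height_geP _ _ _ _ rs); exists z, c; split=> //.
split; last by case: ch.
move=> p /(proj1 ch)[Np [zp [py /andP[p0 pt]]]].
do 2 (split=> //); last by rewrite p0.
split; last by rewrite p0 (le_trans pt).
move=> i; have := zms i; have := zp i; have := py i; have := yb i.
rewrite tnth_mktuple.
have : (ms%:R : R) <= L%:R by rewrite ler_nat.
have : (b%:R : R) <= L%:R by rewrite ler_nat.
by move=> *; apply/andP; split; lra.
Qed.

(** Heights never drop below the initial state and stay -oo where it is -oo, so on the cube only
    thresholds from m0 on matter, and these are localized. A shift at y is visible on the cube only
    if the height at y reaches m0, which keeps y above -ms; this bounds the support of the
    generator's integrand. *)
Lemma height_localized_eq s (b : nat) (q : R) : in_Sigma s -> 0 < q <= b%:R ->
  exists2 M : nat, (0 < M)%N & forall Nw ms L, (M <= ms)%N ->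
  short_chains Nw b ms -> (ms <= L)%N -> (b <= L)%N ->
  forall (t : R), t <= b%:R ->
  [/\ forall x, cube q x -> height Nw s t x = height (trunc Nw L%:R b%:R) s t x,
   forall x y, cube q x -> Defs.shift (height Nw s t) y x =
     Defs.shift (height (trunc Nw L%:R b%:R) s t) y x &
   forall x y i, cube q x -> tnth y i <= - ms%:R \/ q < tnth y i ->
     Defs.shift (height Nw s t) y x = height Nw s t x].
Proof.
move=> hs /andP[q0 qb]; have [m0 hm0] := Sigma_cube_min hs q0.
have rs := in_Sigma_regular hs.
have [M M0 hM] := height_localized b m0 hs.
exists M => // Nw ms L Mms hsc msL bL t tb.
have qd x : cube q x -> tle x (diag b%:R).
  by move=> qx i; rewrite tnth_mktuple; have /andP[_ h] := qx i; exact: le_trans qb.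
have loc := hM _ _ _ Mms hsc msL bL t _ _ tb.
have rh := height_regular Nw t rs.
have rh' := height_regular (trunc Nw L%:R b%:R) t rs.
have E1 x : cube q x -> height Nw s t x = height (trunc Nw L%:R b%:R) s t x.
  move=> qx; case: (hm0 x qx) => [sx|m0x]; first by rewrite !height_Ny.
  apply: height_ext => // v; split=> [h|/le_trans]; last first.
    by apply; exact: height_trunc_le.
  have [vm|vm] := leP m0 v; first exact: (proj2 (loc _ _ (qd _ qx) vm h)).
  apply: le_trans (height_ge_init _ _ _ rs); apply: le_trans m0x.
  by rewrite lee_fin ler_int ltW.
split=> //.
- move=> x y qx; case: (hm0 x qx) => [sx|m0x].
    have hx : height Nw s t x = -oo%E by exact: height_Ny.
    rewrite /Defs.shift -E1// hx.
    have nf (h : state R d) : (if `[< tle y x /\ -oo%E = h y /\ h y \is a fin_num >]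
      then -oo + 1%:E else -oo)%E = -oo%E :> \bar R by case: asboolP.
    by rewrite !nf.
  apply: Zstar_ext; try exact: Zstar_shift.
  move=> v; split.
    move=> /(shift_geP _ _ _ rh) h; apply/(shift_geP _ _ _ rh').
    case: h => [h|[yx h]]; first by left; rewrite -E1.
    have [vm|vm] := leP m0 (v - 1).
      by right; split=> //; apply: (proj2 (loc _ _ (tle_trans yx (qd _ qx)) vm h)).
    left; apply: le_trans (height_ge_init _ _ _ rs); apply: le_trans m0x.
    by rewrite lee_fin ler_int; lia.
  move=> /(shift_geP _ _ _ rh') h; apply/(shift_geP _ _ _ rh).
  case: h => [h|[yx h]]; first by left; rewrite E1.
  by right; split=> //; apply: (le_trans h); exact: height_trunc_le.
- move=> x y i qx hy; rewrite /Defs.shift; case: asboolP => // -[yx [hxy fy]].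
  exfalso; case: hy => [hy|hy]; last first.
    by have := yx i; have /andP[_] := qx i; lra.
  have m0y : (m0%:~R%:E <= height Nw s t y)%E.
    rewrite -hxy; case: (hm0 x qx) => [sx|m0x].
      by move: fy; rewrite -hxy height_Ny.
    exact: le_trans m0x (height_ge_init _ _ _ rs).
  have [/(_ i) + _] := loc _ _ (tle_trans yx (qd _ qx)) (lexx m0) m0y.
  by rewrite ltNge hy.
Qed.

(** On a cube the height agrees with that of a finite truncation, which gives condition (ii). Growth
    is [chain_weight_bound] with slope -|A|, uniformly over the starts below y. *)
Lemma nice_height_Sigma Nw s t : in_Sigma s -> nice Nw -> in_Sigma (height Nw s t).
Proof.
move=> hs nN; have rs := in_Sigma_regular hs.
apply/in_SigmaP; split; first exact: height_regular.
- move=> q q0; set b := maxn (Num.trunc q).+1 (Num.trunc t).+1.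
  have qb : 0 < q <= b%:R.
    rewrite q0/=; apply/ltW/(lt_le_trans (truncnS_gt q)).
    by rewrite ler_nat leq_maxl.
  have tb : t <= b%:R.
    by apply/ltW/(lt_le_trans (truncnS_gt t)); rewrite ler_nat leq_maxr.
  have [M M0 hM] := height_localized_eq hs qb.
  have [ms hsc] := proj2 nN b.
  have hsc' := short_chains_le (leq_maxl ms M) hsc.
  have [E _ _] := hM _ _ (maxn (maxn ms M) b) (leq_maxr _ _) hsc' (leq_maxl _ _) (leq_maxr _ _) t tb.
  have fT := trunc_finite (maxn (maxn ms M) b) b nN.
  have [D hD] := in_Sigma_stepwise (height_finite_Sigma t hs fT) q0.
  exists D => x x' hx hx' xx'; rewrite !E.
  + exact: hD.
  + by move=> i; have := hx' i; lra.
  + by move=> i; have := hx i; lra.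
- move=> bb A; set b := maxn (Num.trunc (supnorm bb)).+1 (Num.trunc t).+1.
  have tb : t <= b%:R.
    by apply/ltW/(lt_le_trans (truncnS_gt t)); rewrite ler_nat leq_maxr.
  have bbb : tle bb (diag b%:R).
    move=> i; rewrite tnth_mktuple; apply: le_trans (ler_norm _) _.
    apply: le_trans (supnorm_ge _ _) _.
    apply/ltW/(lt_le_trans (truncnS_gt _)); by rewrite ler_nat leq_maxl.
  have [M M0 hM] := chain_weight_bound b (- `|A|) hs.
  have [ms hsc] := proj2 nN b.
  have hsc' := short_chains_le (leq_maxl ms M) hsc.
  (* The summand b forces the norm of y <= bb to come from a negative coordinate, so that every z <=
     y has at least the same norm. *)
  exists ((maxn ms M) + b)%:R; split.
    by rewrite ltr0n addn_gt0 leq_max M0 orbT.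
  move=> y ybb My.
  have y0 : 0 < supnorm y.
    by apply: lt_le_trans My; rewrite ltr0n addn_gt0 leq_max M0 orbT.
  have a0 : 0 < supnorm y `^ alpha by exact: powR_gt0.
  have zy z : tle z y -> supnorm y <= supnorm z.
    move=> zy; rewrite leNgt; apply/negP => h.
    suff : supnorm y <= Num.max (supnorm z) b%:R.
      rewrite le_max leNgt h/= => h'; have := le_trans My h'.
      by rewrite ler_nat leqNgt -[X in (X < _)%N]add0n ltn_add2r leq_max M0 orbT.
    apply: supnorm_le; first by rewrite le_max supnorm_ge0.
    move=> i; rewrite ler_norml; apply/andP; split.
      rewrite lerNl; apply: (@le_trans _ _ (- tnth z i)); first by rewrite lerN2.
      by rewrite le_max (le_trans _ (supnorm_ge z i))// -normrN ler_norm.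
    rewrite le_max; apply/orP; right.
    by have := tle_trans ybb bbb i; rewrite tnth_mktuple.
  have : (height Nw s t y <= (- `|A| * supnorm y `^ alpha)%:E)%E.
    apply: Zstar_le; first exact: Zstar_height.
    move=> v /(height_geP _ _ _ _ rs)[z [c [zy' ch h]]]; apply: (le_trans h).
    have msz : (maxn ms M)%:R <= supnorm z.
      apply: le_trans (zy _ zy'); apply: le_trans My.
      by rewrite ler_nat leq_addr.
    have := hM _ _ (leq_maxr ms M) hsc' _ _ _ _ tb (tle_trans ybb bbb) zy' msz ch.
    move=> /le_trans; apply; rewrite lee_fin !mulNr lerN2 ler_wpM2l//.
    apply: ge0_ler_powR; rewrite ?divr_ge0 ?nnegrE ?supnorm_ge0//.
    exact: zy.
  rewrite powRN; case: (height Nw s t y) => [r||]//.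
    rewrite -EFinM !lee_fin => h; rewrite mulrC ler_pdivrMr//.
    apply: (le_trans h); rewrite ler_pM2r// lerNl -normrN ler_norm//.
  by rewrite gt0_muleNy ?leNye// lte_fin invr_gt0.
Qed.

End localization.

(** * Dyadic cells and Poisson counts *)

Section dyadic_index.
Context {R : realType}.
Implicit Types (lo w x z : R) (n k : nat).

Definition gridpt lo w n k : R := lo + w * k%:R / 2 ^+ n.

(** Cells are open on the left and closed on the right, like [stbox]; hence the ceiling minus
    one. *)
Definition idx1 lo w n x : nat := `|Num.ceil ((x - lo) / w * 2 ^+ n) - 1|%N.

Lemma gridpt_le lo w n k k' : 0 < w -> (gridpt lo w n k <= gridpt lo w n k') = (k <= k')%N.
Proof.
by move=> w0; rewrite lerD2l ler_pM2r ?invr_gt0 ?exprn_gt0// ler_pM2l// ler_nat.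
Qed.

Lemma gridpt_lt lo w n k k' : 0 < w -> (gridpt lo w n k < gridpt lo w n k') = (k < k')%N.
Proof. by move=> w0; rewrite !ltNge gridpt_le// -ltnNge. Qed.

Lemma gridpt_scale lo w n m k : gridpt lo w (n + m) (k * 2 ^ m) = gridpt lo w n k.
Proof.
rewrite /gridpt exprD natrM natrX; congr (_ + _).
have p0 j : (2 ^+ j : R) != 0 by rewrite expf_neq0.
by field; rewrite !p0.
Qed.

Lemma gridpt0 lo w n : gridpt lo w n 0 = lo.
Proof. by rewrite /gridpt mulr0 mul0r addr0. Qed.

Lemma gridpt_top lo w n : gridpt lo w n (2 ^ n) = lo + w.
Proof. by rewrite /gridpt natrX mulfK// expf_neq0. Qed.

Lemma idx1P lo w n x k : 0 < w -> lo < x ->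
  idx1 lo w n x = k <-> gridpt lo w n k < x <= gridpt lo w n k.+1.
Proof.
move=> w0 lx; have p0 : 0 < (2 ^+ n : R) by exact: exprn_gt0.
have u0 : 0 < (x - lo) / w * 2 ^+ n by rewrite mulr_gt0 ?divr_gt0 ?subr_gt0.
rewrite /idx1; set u := _ * _ in u0 *.
have xE : x = lo + w * u / 2 ^+ n.
  by rewrite /u; field; rewrite !gt_eqF.
have E1 : (gridpt lo w n k < x) = (k%:~R < u).
  by rewrite xE ltrD2l ltr_pM2r ?invr_gt0// ltr_pM2l.
have E2 : (x <= gridpt lo w n k.+1) = (u <= k.+1%:~R).
  by rewrite {1}xE lerD2l ler_pM2r ?invr_gt0// ler_pM2l.
rewrite E1 E2 -ceil_gt_int -ceil_le_int.
have : 0 < Num.ceil u by rewrite ceil_gt0.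
move: (Num.ceil u) => c c0; split=> [<-|/andP[h1 h2]]; last by lia.
by apply/andP; split; lia.
Qed.

Lemma idx1_itv lo w n x : 0 < w -> lo < x ->
  gridpt lo w n (idx1 lo w n x) < x <= gridpt lo w n (idx1 lo w n x).+1.
Proof. by move=> w0 lx; exact/idx1P. Qed.

Lemma idx1_lt lo w n x : 0 < w -> lo < x <= lo + w -> (idx1 lo w n x < 2 ^ n)%N.
Proof.
move=> w0 /andP[lx xw]; have /andP[h _] := idx1_itv n w0 lx.
by rewrite -(gridpt_lt lo n _ _ w0) gridpt_top; exact: lt_le_trans xw.
Qed.

Lemma idx1_le lo w n x x' : 0 < w -> lo < x -> x <= x' ->
  (idx1 lo w n x <= idx1 lo w n x')%N.
Proof.
move=> w0 lx xx'; have /andP[h1 _] := idx1_itv n w0 lx.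
have /andP[_ h2] := idx1_itv n w0 (lt_le_trans lx xx').
by rewrite -ltnS -(gridpt_lt lo n _ _ w0) (lt_le_trans h1)// (le_trans xx').
Qed.

Lemma idx1_lt_lt lo w n x x' : 0 < w -> lo < x' ->
  (idx1 lo w n x < idx1 lo w n x')%N -> x < x'.
Proof.
by move=> w0 lx; rewrite ltnNge ltNge; apply: contra => h; exact: idx1_le.
Qed.

Lemma idx1_div lo w n m x : 0 < w -> lo < x ->
  idx1 lo w n x = (idx1 lo w (n + m) x %/ 2 ^ m)%N.
Proof.
move=> w0 lx; apply/idx1P => //; set k := idx1 _ _ (n + m) x.
have /andP[h1 h2] := idx1_itv (n + m) w0 lx.
have p0 : (0 < 2 ^ m)%N by rewrite expn_gt0.
apply/andP; split; rewrite -(gridpt_scale _ _ n m).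
  by apply: le_lt_trans h1; rewrite gridpt_le// leq_trunc_div.
by apply: (le_trans h2); rewrite gridpt_le// ltn_ceil.
Qed.

Lemma idx1_lt_succ lo w n m x x' : 0 < w -> lo < x -> lo < x' -> (n <= m)%N ->
  (idx1 lo w n x < idx1 lo w n x')%N -> (idx1 lo w m x < idx1 lo w m x')%N.
Proof.
move=> w0 lx lx' nm; rewrite (idx1_div n (m - n) w0 lx) (idx1_div n (m - n) w0 lx').
rewrite subnKC// !ltnNge; apply: contra => h.
exact: leq_div2r.
Qed.

Lemma mesh_small w (e : R) : 0 < w -> 0 < e ->
  exists n0 : nat, forall n, (n0 <= n)%N -> w / 2 ^+ n < e.
Proof.
move=> w0 e0; exists (Num.trunc (w / e)).+1 => n hn.
rewrite ltr_pdivrMr ?exprn_gt0// mulrC -ltr_pdivrMr//.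
apply: (lt_le_trans (truncnS_gt _)); apply: (@le_trans _ _ n%:R).
  by rewrite ler_nat.
by rewrite -natrX ler_nat ltnW// ltn_expl.
Qed.

Lemma gridptS lo w n k : gridpt lo w n k.+1 = gridpt lo w n k + w / 2 ^+ n.
Proof. by rewrite /gridpt -natr1; ring. Qed.

(** Two points cannot share a cell once the mesh w / 2^n is below their distance. *)
Lemma idx1_sep lo w x x' : 0 < w -> lo < x -> x < x' ->
  exists n0 : nat, forall n, (n0 <= n)%N ->
    (idx1 lo w n x < idx1 lo w n x')%N.
Proof.
move=> w0 lx xx'; have e0 : 0 < x' - x by rewrite subr_gt0.
have [n0 hn0] := mesh_small w0 e0; exists n0 => n /hn0 h.
rewrite ltn_neqAle idx1_le ?andbT//; last exact: ltW.
apply/eqP => E; have /andP[h1 _] := idx1_itv n w0 lx.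
have /andP[_ h2] := idx1_itv n w0 (lt_trans lx xx').
rewrite -E gridptS in h2; lra.
Qed.

Lemma idx1_low lo w x z : 0 < w -> lo < x -> z < x ->
  exists n0 : nat, forall n, (n0 <= n)%N ->
    z <= gridpt lo w n (idx1 lo w n x).
Proof.
move=> w0 lx xx'; have e0 : 0 < x - z by rewrite subr_gt0.
have [n0 hn0] := mesh_small w0 e0; exists n0 => n /hn0 h.
have /andP[_ h2] := idx1_itv n w0 lx; rewrite gridptS in h2; lra.
Qed.

Lemma gridpt_idx1 lo w n x k : 0 < w -> lo < x ->
  (gridpt lo w n k < x) = (k <= idx1 lo w n x)%N.
Proof.
move=> w0 lx; have /andP[h1 h2] := idx1_itv n w0 lx.
apply/idP/idP => h; last by apply: le_lt_trans h1; rewrite gridpt_le.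
by rewrite -ltnS -(gridpt_lt lo n _ _ w0); exact: lt_le_trans h2.
Qed.

Lemma idx1_approx_le lo w x x' : 0 < w -> lo < x -> lo < x' ->
  x <= x' <-> forall n, (idx1 lo w n x <= idx1 lo w n x')%N.
Proof.
move=> w0 lx lx'; split=> [xx' n|h]; first exact: idx1_le.
rewrite leNgt; apply/negP => xx'.
by have [n0 /(_ _ (leqnn _))] := idx1_sep w0 lx' xx'; rewrite ltnNge h.
Qed.

End dyadic_index.

Section poisson_family.
Context {R : realType} {d : nat} {dO : measure_display} {Omega : measurableType dO}.
Variables (P : probability Omega R) (N : Omega -> set (stpt R d)).
Hypothesis HN : is_rate1_PPP P N.

Lemma poisson_fin (I : finType) (a b : I -> pt R d) (u v : I -> R) (n : I -> nat) :
  (forall i, tle (a i) (b i) /\ 0 <= u i /\ u i <= v i) ->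
  (forall i j, i != j ->
     stbox (a i) (b i) (u i) (v i) `&` stbox (a j) (b j) (u j) (v j) = set0) ->
  let E := [set w | forall i, ((N w `&` stbox (a i) (b i) (u i) (v i)) #= `I_(n i))%card] in
  measurable E /\
  P E = (\prod_i poisson_prob_at (stvol (a i) (b i) (u i) (v i)) (n i))%:E.
Proof.
move=> hab hdis E; case: HN => _ H.
pose ev (i : 'I_#|I|) : I := enum_val i.
have [mE PE] := H #|I| (a \o ev) (b \o ev) (u \o ev) (v \o ev) (n \o ev)
  (fun i => hab _)
  (fun i j ij => hdis _ _ (contra_neq (@enum_val_inj _ _ _ _) ij)).
have EE : E = [set w | forall i, (N w `&` stbox ((a \o ev) i) ((b \o ev) i)
    ((u \o ev) i) ((v \o ev) i) #= `I_((n \o ev) i))%card].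
  apply/seteqP; split=> w h i /=; first exact: h.
  by have := h (enum_rank i); rewrite /ev/= enum_rankK.
rewrite EE; split=> //; rewrite PE; congr EFin.
rewrite (reindex ev)//=.
by exists enum_rank => i _; [exact: enum_valK|exact: enum_rankK].
Qed.

Lemma card_I0 (T : Type) (A : set T) : (A #= `I_0)%card <-> A = set0.
Proof. by rewrite II0 card_eq0; split=> [/eqP|->]. Qed.

Definition void (a b : pt R d) (u v : R) : set Omega :=
  [set w | N w `&` stbox a b u v = set0].

Variables (I : finType) (a b : I -> pt R d) (u v : I -> R).
Hypothesis hab : forall i, tle (a i) (b i) /\ 0 <= u i /\ u i <= v i.
Hypothesis hdis : forall i j, i != j ->
  stbox (a i) (b i) (u i) (v i) `&` stbox (a j) (b j) (u j) (v j) = set0.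

Let vol i := stvol (a i) (b i) (u i) (v i).

(* A box outside [A] is emptied by collapsing its time interval. *)
Lemma poisson_void (A : {set I}) :
  let E := [set w | forall i, i \in A -> void (a i) (b i) (u i) (v i) w] in
  measurable E /\ P E = (\prod_(i in A) expR (- vol i))%:E.
Proof.
move=> E; pose v' i := if i \in A then v i else u i.
have sub i : stbox (a i) (b i) (u i) (v' i) `<=` stbox (a i) (b i) (u i) (v i).
  move=> p; rewrite /v'; case: ifP => // _ [_ /andP[h1 h2]].
  by have := lt_le_trans h1 h2; rewrite ltxx.
have [||mE PE] := @poisson_fin I a b u v' (fun=> 0%N).
- by move=> i; have [h1 [h2 h3]] := hab i; rewrite /v'; case: ifP.
- move=> i j ij; rewrite -subset0 -(hdis ij); exact: setISS.
have EE : E = [set w | forall i, (N w `&` stbox (a i) (b i) (u i) (v' i) #= `I_0)%card].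
  apply/seteqP; split=> w h i /=.
    rewrite card_I0; case: (boolP (i \in A)) => iA.
      by rewrite /v' iA; exact: h.
    rewrite /v' (negbTE iA) -subset0 => p [_ [_ /andP[h1 h2]]].
    by have := lt_le_trans h1 h2; rewrite ltxx.
  by move=> iA; have := h i; rewrite /v' iA card_I0.
rewrite EE; split=> //; rewrite PE; congr EFin.
rewrite [RHS]big_mkcond/=; apply: eq_bigr => i _.
rewrite /poisson_prob_at expr0 fact0 divr1 mulr1 /v'; case: ifP => // _.
by rewrite /stvol subrr mulr0 oppr0 expR0.
Qed.

(** Induction on B: for j in B, the event for (A, B) is the event for (A, B minus j) without the one
    for (A plus j, B minus j). *)
Lemma poisson_void_nonvoid (A B : {set I}) : (forall i, i \in A -> i \notin B) ->
  let E := [set w | (forall i, i \in A -> void (a i) (b i) (u i) (v i) w) /\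
                    (forall i, i \in B -> ~ void (a i) (b i) (u i) (v i) w)] in
  measurable E /\
  P E = (\prod_(i in A) expR (- vol i) * \prod_(i in B) (1 - expR (- vol i)))%:E.
Proof.
move: {2}#|B| (erefl #|B|) => n; elim: n A B => [|n IH] A B.
  move=> /eqP; rewrite cards_eq0 => /eqP -> _ E.
  have [mE PE] := poisson_void A.
  have -> : E = [set w | forall i, i \in A -> void (a i) (b i) (u i) (v i) w].
    apply/seteqP; split=> w; first by case.
    by move=> h; split=> // i; rewrite inE.
  by split=> //; rewrite PE big_set0 mulr1.
move=> cB dAB E.
have /card_gt0P[j jB] : (0 < #|B|)%N by rewrite cB.
have jA : j \notin A by apply: contraL jB; exact: dAB.
have cB' : #|B :\ j| = n by move: cB; rewrite (cardsD1 j) jB => -[].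
have d1 i : i \in A -> i \notin B :\ j.
  by move=> /dAB iB; rewrite !inE negb_and iB orbT.
have d2 i : i \in j |: A -> i \notin B :\ j.
  by rewrite !inE => /orP[->//|/dAB iB]; rewrite negb_and iB orbT.
have [m1 P1] := IH A _ cB' d1.
have [m2 P2] := IH (j |: A) _ cB' d2.
set E1 := [set w | _] in m1 P1; set E2 := [set w | _] in m2 P2.
have E21 : E2 `<=` E1.
  by move=> w [h1 h2]; split=> // i iA; apply: h1; rewrite !inE iA orbT.
have EE : E = E1 `\` E2.
  apply/seteqP; split=> w.
    move=> [h1 h2]; split.
      by split=> // i; rewrite !inE => /andP[_]; exact: h2.
    by move=> [h3 _]; apply: (h2 _ jB); apply: h3; rewrite !inE eqxx.
  move=> [[h1 h2] h3]; split=> // i iB hi.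
  have [ij|ij] := eqVneq i j; last by apply: (h2 i) => //; rewrite !inE ij.
  apply: h3; split=> // i'; rewrite !inE => /orP[/eqP->|]; last exact: h1.
  by rewrite -ij.
rewrite EE; split; first exact: measurableD.
have P1lt : (P E1 < +oo)%E by rewrite P1 ltry.
have := measureD (mu := P) m1 m2 P1lt; rewrite (setIidr E21) => H.
transitivity (P E1 - P E2)%E; first exact: H.
rewrite P1 P2 -EFinB; congr EFin.
rewrite big_setU1//= [X in _ = _ * X](big_setD1 j)//=.
move: (\prod_(i in A) _) (\prod_(i in B :\ j) _) (expR _) => X Y Z.
ring.
Qed.

End poisson_family.

(** * Long chains are rare *)

Lemma measure_finU_le {d : measure_display} {T : measurableType d} {R : realType}
    (mu : {measure set T -> \bar R}) (I : eqType) (r : seq I) (A : I -> set T) :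
  (forall i, i \in r -> measurable (A i)) ->
  measurable (\big[setU/set0]_(i <- r) A i) /\
  (mu (\big[setU/set0]_(i <- r) A i) <= \sum_(i <- r) mu (A i))%E.
Proof.
elim: r => [_|i r IH h]; first by rewrite !big_nil measure0.
have [mr lr] := IH (fun j jr => h j (mem_behead (s := i :: r) jr)).
have mi : measurable (A i) by apply: h; exact: mem_head.
rewrite !big_cons; split; first exact: measurableU.
apply: le_trans (measureU2 mu mi mr) _; exact: leeD2l.
Qed.

Lemma bin_fact_le (n k : nat) : ('C(n, k) * k`! <= n ^ k)%N.
Proof.
rewrite bin_ffact; elim: k => [|k IH]; first by rewrite ffactn0.
by rewrite ffactnSr expnSr leq_mul// leq_subr.
Qed.

Lemma expR_ge_term {R : realType} (x : R) (n : nat) : 0 <= x ->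
  x ^+ n / n`!%:R <= expR x.
Proof.
move=> x0; case: n => [|n]; first by rewrite expr0 fact0 divr1 -[leLHS]expR0 ler_expR.
by apply: le_trans (expR_ge1Dxn n x0); rewrite lerDr.
Qed.

Section chain_tail.
Context {R : realType} {d : nat} {dO : measure_display} {Omega : measurableType dO}.
Variables (P : probability Omega R) (N : Omega -> set (stpt R d)).
Hypothesis HN : is_rate1_PPP P N.
Variables (lo W T : R).
Hypotheses (W0 : 0 < W) (T0 : 0 < T).

(** [option 'I_d] indexes the d+1 axes of space-time, [None] being time. *)
Definition crd (p : stpt R d) (o : option 'I_d) : R :=
  if o is Some i then tnth p.1 i else p.2.
Definition lows (o : option 'I_d) : R := if o is Some _ then lo else 0.
Definition widths (o : option 'I_d) : R := if o is Some _ then W else T.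
Definition pidx n p o := idx1 (lows o) (widths o) n (crd p o).
Definition inbig p := forall o, lows o < crd p o <= lows o + widths o.

Lemma widths_gt0 o : 0 < widths o. Proof. by case: o. Qed.

Definition cell_lo n (f : option 'I_d -> nat) : pt R d :=
  [tuple gridpt lo W n (f (Some i)) | i < d].
Definition cell n (f : option 'I_d -> nat) : set (stpt R d) :=
  stbox (cell_lo n f) (cell_lo n (fun o => (f o).+1))
        (gridpt 0 T n (f None)) (gridpt 0 T n (f None).+1).

Lemma cellE n f p : cell n f p <->
  forall o, gridpt (lows o) (widths o) n (f o) < crd p o
             <= gridpt (lows o) (widths o) n (f o).+1.
Proof.
split=> [[h1 h2] [i|//]|h].
  by have := h1 i; rewrite !tnth_mktuple.
split; last exact: (h None).
by move=> i; rewrite !tnth_mktuple; exact: (h (Some i)).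
Qed.

Lemma cellP n f p : inbig p -> cell n f p <-> forall o, pidx n p o = f o.
Proof.
move=> hp; rewrite cellE; split=> h o; have /andP[h1 _] := hp o.
  by apply/idx1P => //; exact: widths_gt0.
by apply/idx1P; [exact: widths_gt0|exact: h1|exact: h].
Qed.

Lemma cell_inbig n f p : (forall o, (f o < 2 ^ n)%N) -> cell n f p -> inbig p.
Proof.
move=> hf /cellE h o; have /andP[h1 h2] := h o.
apply/andP; split.
  by apply: le_lt_trans h1; rewrite -[X in X <= _](gridpt0 _ (widths o) n)
    gridpt_le ?widths_gt0.
by apply: (le_trans h2); rewrite -(gridpt_top _ _ n) gridpt_le ?widths_gt0.
Qed.

Lemma cell_disjoint n f g : (exists o, f o != g o) ->
  (forall o, (f o < 2 ^ n)%N) -> cell n f `&` cell n g = set0.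
Proof.
move=> [j fg] hf; rewrite -subset0 => u [uf ug].
have hu := cell_inbig hf uf.
have := (cellP n f hu).1 uf j; have := (cellP n g hu).1 ug j.
by move=> -> E; rewrite E eqxx in fg.
Qed.

Lemma cell_wf n f : tle (cell_lo n f) (cell_lo n (fun o => (f o).+1)) /\
  0 <= gridpt 0 T n (f None) /\ gridpt 0 T n (f None) <= gridpt 0 T n (f None).+1.
Proof.
split; first by move=> i; rewrite !tnth_mktuple gridpt_le.
split; last by rewrite gridpt_le.
by rewrite -[X in X <= _](gridpt0 0 T n) gridpt_le.
Qed.

Lemma cell_vol n f : stvol (cell_lo n f) (cell_lo n (fun o => (f o).+1))
    (gridpt 0 T n (f None)) (gridpt 0 T n (f None).+1)
  = (W ^+ d * T) / (2 ^+ n) ^+ d.+1.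
Proof.
rewrite /stvol (eq_bigr (fun=> W / 2 ^+ n)); last first.
  by move=> i _; rewrite !tnth_mktuple gridptS addrC addKr.
rewrite big_const_ord iter_mulr_1 gridptS [_ + T / _]addrC addrK.
by rewrite expr_div_n mulf_div -exprSr.
Qed.

Definition sepb n (p p' : stpt R d) := [forall o, (pidx n p o < pidx n p' o)%N].

(** A discretized [long k]: the points must lie in cells whose indices strictly increase on every
    axis. It depends only on which cells are occupied, and it increases with n to [long k]. *)
Definition sep n k : set Omega := [set w | exists c : seq (stpt R d),
  [/\ size c = k, forall p, p \in c -> N w p /\ inbig p & sorted (sepb n) c]].

Definition long k : set Omega := [set w | exists c,
  chain (N w) T (diag lo) (diag (lo + W)) c /\ size c = k].

Lemma inbigP w p : (N w p /\ inbig p) <->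
  N w p /\ tlt (diag lo) p.1 /\ tle p.1 (diag (lo + W)) /\ 0 < p.2 <= T.
Proof.
split=> -[Np h]; split=> //.
  split; first by move=> i; rewrite tnth_mktuple; have /andP[] := h (Some i).
  split; first by move=> i; rewrite tnth_mktuple; have /andP[] := h (Some i).
  by have := h None; rewrite /= add0r.
case: h => h1 [h2 h3] [i|]; last by rewrite /= add0r.
by have := h1 i; have := h2 i; rewrite !tnth_mktuple /= => -> ->.
Qed.

Lemma sepb_stltb n p p' : inbig p -> inbig p' -> sepb n p p' -> stltb p p'.
Proof.
move=> hp hp' /forallP h; apply/asboolP.
have H o : crd p o < crd p' o.
  have /andP[h2 _] := hp' o.
  by apply: (idx1_lt_lt (widths_gt0 o) h2); exact: h.
by split; [move=> i; exact: (H (Some i))|exact: (H None)].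
Qed.

Lemma sepb_mono n m p p' : (n <= m)%N -> inbig p -> inbig p' ->
  sepb n p p' -> sepb m p p'.
Proof.
move=> nm hp hp' /forallP h; apply/forallP => o.
have /andP[h1 _] := hp o; have /andP[h2 _] := hp' o.
exact: (idx1_lt_succ (widths_gt0 o) h1 h2 nm (h o)).
Qed.

Lemma sepb_ex p p' : inbig p -> inbig p' -> stlt p p' ->
  exists n, sepb n p p'.
Proof.
move=> hp hp' [h1 h2].
have H o : exists n0 : nat, forall n, (n0 <= n)%N -> (pidx n p o < pidx n p' o)%N.
  have /andP[lp _] := hp o; apply: idx1_sep => //; first exact: widths_gt0.
  by case: o lp => [i|] _ /=; [exact: h1|exact: h2].
have [n0 hn0] := fin_all_exists H.
exists (\max_o n0 o)%N; apply/forallP => o; apply: hn0.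
exact: leq_bigmax.
Qed.

Lemma sorted_sepb_mono n m c : (n <= m)%N -> (forall p, p \in c -> inbig p) ->
  sorted (sepb n) c -> sorted (sepb m) c.
Proof.
move=> nm hc; have H : {in [pred p | p \in c] &, subrel (sepb n) (sepb m)}.
  by move=> p p' pc p'c; apply: sepb_mono => //; exact: hc.
by apply: (sub_in_sorted H) => //; apply/allP.
Qed.

Lemma sorted_sepb_ex c : (forall p, p \in c -> inbig p) -> sorted stltb c ->
  exists n, sorted (sepb n) c.
Proof.
elim: c => [|p c IH] hb so; first by exists 0%N.
have [n hn] := IH (fun u uc => hb u (mem_behead (s := p :: c) uc)) (path_sorted so).
case: c hn so hb {IH} => [|p' c] hn so hb; first by exists 0%N.
have pI : inbig p by apply: hb; exact: mem_head.
have p'I : inbig p' by apply: hb; rewrite !inE eqxx orbT.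
have [n' hn'] : exists n, sepb n p p'.
  by apply: sepb_ex => //; apply/asboolP; case/andP: so.
exists (maxn n n'); rewrite /sorted/=; apply/andP; split.
  exact: sepb_mono (leq_maxr _ _) _ _ hn'.
apply: (sorted_sepb_mono (leq_maxl n n') _ hn) => u uc.
by apply: hb; rewrite inE; apply/orP; right.
Qed.

Lemma sep_mono k : {homo sep^~ k : n m / (n <= m)%N >-> (n <= m)%O}.
Proof.
move=> n m nm; apply/subsetPset => w [c [sc hc so]]; exists c; split=> //.
by apply: sorted_sepb_mono nm _ so => p /hc[].
Qed.

Lemma long_sep k : long k = \bigcup_n sep n k.
Proof.
apply/seteqP; split=> w.
  move=> [c [[hc so] sc]].
  have hb p : p \in c -> N w p /\ inbig p by move=> /hc; rewrite -inbigP.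
  have [n hn] := sorted_sepb_ex (fun p pc => (hb p pc).2) so.
  by exists n => //; exists c.
move=> [n _ [c [sc hc so]]]; exists c; split=> //; split.
  by move=> p /hc; rewrite inbigP.
have H : {in [pred p | p \in c] &, subrel (sepb n) stltb}.
  by move=> p p' pc p'c; apply: sepb_stltb; [exact: (hc _ pc).2|exact: (hc _ p'c).2].
by apply: (sub_in_sorted H) => //; apply/allP.
Qed.

Section level.
Variables n k : nat.
Local Notation J := {ffun option 'I_d -> k.-tuple 'I_(2 ^ n)}.

(** A chain of k cells is stored axis by axis, as one index tuple per axis. With increasing tuples
    this leaves C(2^n, k)^(d+1) choices. *)
Definition fcell (f : J) (j : 'I_k) (o : option 'I_d) : nat := tnth (f o) j.

Definition sortedt : {set k.-tuple 'I_(2 ^ n)} :=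
  [set t : k.-tuple 'I_(2 ^ n) | sorted ltn [seq val i | i <- t]]%SET.

Definition hit (f : J) : set Omega := [set w | forall j : 'I_k,
  ~ (N w `&` cell n (fcell f j) = set0)].

Lemma sortedt_lt (t : k.-tuple 'I_(2 ^ n)) (j j' : 'I_k) :
  t \in sortedt -> (j < j')%N -> (tnth t j < tnth t j')%N.
Proof.
rewrite inE => st jj'.
have := sorted_ltn_nth ltn_trans 0%N st.
move=> /(_ j j'); rewrite !inE !size_map !size_tuple !ltn_ord => /(_ isT isT jj').
by rewrite !(nth_map (tnth t j)) ?size_tuple// -!tnth_nth.
Qed.

Lemma sep_hit : sep n k = \big[setU/set0]_(f <- enum (ffun_on (mem sortedt))) hit f.
Proof.
apply/seteqP; split=> w; rewrite -bigcup_seq.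
  pose p0 : stpt R d := (diag 0, 0).
  move=> [c [sc hc so]].
  have cI (j : 'I_k) : inbig (nth p0 c j).
    by apply: (hc _ _).2; rewrite mem_nth// sc.
  have lt o (j : 'I_k) : (pidx n (nth p0 c j) o < 2 ^ n)%N.
    by apply: idx1_lt; [exact: widths_gt0|exact: cI].
  pose f : J := [ffun o => [tuple Ordinal (lt o j) | j < k]].
  exists f => /=.
    rewrite mem_enum; apply/ffun_onP => o; rewrite inE.
    have -> : [seq val i | i <- f o] = [seq pidx n p o | p <- c].
      apply: (@eq_from_nth _ 0%N); first by rewrite !size_map sc size_tuple.
      move=> i; rewrite size_map size_tuple => ik.
      rewrite (nth_map (Ordinal (lt o (Ordinal ik)))) ?size_tuple//.
      rewrite (nth_map p0) ?sc//.
      by rewrite -[i]/(val (Ordinal ik)) -tnth_nth ffunE tnth_mktuple.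
    rewrite sorted_map; apply: sub_sorted so => p p' /forallP; exact.
  move=> j; apply/eqP/set0P; exists (nth p0 c j); split.
    by apply: (hc _ _).1; rewrite mem_nth// sc.
  apply/cellP => // o; by rewrite /fcell ffunE tnth_mktuple.
move=> [f /=]; rewrite mem_enum => /ffun_onP fs hf.
have : forall j : 'I_k, exists p, N w p /\ cell n (fcell f j) p.
  by move=> j; have /eqP/set0P[p [Np cp]] := hf j; exists p.
move=> /fin_all_exists[p hp].
have pI j : inbig (p j) by apply: (@cell_inbig n (fcell f j)); [move=> o; exact: ltn_ord|case: (hp j)].
exists [seq p j | j <- enum 'I_k]; split.
- by rewrite size_map size_enum_ord.
- by move=> _ /mapP[j _ ->]; split; [case: (hp j)|exact: pI].
- rewrite sorted_map.
  have : sorted ltn [seq val j | j <- enum 'I_k] by rewrite val_enum_ord iota_ltn_sorted.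
  rewrite sorted_map; apply: sub_sorted => j j' /= jj'.
  apply/forallP => o.
  rewrite ((cellP n (fcell f j) (pI j)).1 (proj2 (hp j)) o).
  rewrite ((cellP n (fcell f j') (pI j')).1 (proj2 (hp j')) o).
  by apply: sortedt_lt => //; exact: fs.
Qed.

(** The cells are disjoint, so their occupations are independent, each of probability 1 - exp(-v) <=
    v, where v is the volume of a cell. *)
Lemma hit_bound f : f \in ffun_on (mem sortedt) ->
  measurable (hit f) /\
  (P (hit f) <= (((W ^+ d * T) / (2 ^+ n) ^+ d.+1) ^+ k)%:E)%E.
Proof.
move=> /ffun_onP fs.
have [|||] := @poisson_void_nonvoid _ _ _ _ P N HN 'I_k
  (fun j => cell_lo n (fcell f j)) (fun j => cell_lo n (fun o => (fcell f j o).+1))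
  (fun j => gridpt 0 T n (fcell f j None)) (fun j => gridpt 0 T n (fcell f j None).+1)
  _ _ finset.set0 [set: 'I_k]%SET.
- by move=> j; exact: cell_wf.
- move=> i j ij; apply: cell_disjoint; last by move=> o; exact: ltn_ord.
  (* Increasing indices on a single axis already make the cells differ; time is an axis present for
     every d. *)
  exists None; rewrite neq_ltn; apply/orP.
  move: ij; rewrite -val_eqE neq_ltn => /orP[h|h]; [left|right];
    exact: sortedt_lt (fs _) h.
- by move=> i; rewrite inE.
set E := [set w | _] => mE PE.
have -> : hit f = E.
  apply/seteqP; split=> w h.
    by split=> [i|i _]; [rewrite inE|exact: h].
  by case: h => _ h j; apply: h; rewrite inE.
split=> //; rewrite PE lee_fin big_set0 mul1r.
rewrite (eq_bigl xpredT); last by move=> i; rewrite inE.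
rewrite (eq_bigr (fun=> 1 - expR (- ((W ^+ d * T) / (2 ^+ n) ^+ d.+1)))); last first.
  by move=> i _; rewrite cell_vol.
rewrite big_const_ord iter_mulr_1.
have v0 : 0 <= (W ^+ d * T) / (2 ^+ n) ^+ d.+1.
  by rewrite divr_ge0 ?mulr_ge0 ?exprn_ge0// ltW.
apply: lerXn2r; rewrite ?nnegrE//.
  by rewrite subr_ge0 -[leRHS]expR0 ler_expR oppr_le0.
by rewrite lerBlDr -lerBlDl; have := expR_ge1Dx (- ((W ^+ d * T) / (2 ^+ n) ^+ d.+1)).
Qed.

(** Union bound over the chains of cells: C(2^n, k) k! <= 2^(nk) cancels the mesh and leaves a bound
    free of n, which passes to the limit. *)
Lemma sep_bound : measurable (sep n k) /\
  (P (sep n k) <= ((W ^+ d * T) ^+ k / (k`!%:R) ^+ d.+1)%:E)%E.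
Proof.
have [|mU lU] := @measure_finU_le _ _ _ P _ (enum (ffun_on (mem sortedt))) hit.
  by move=> f; rewrite mem_enum => /hit_bound[].
rewrite sep_hit; split=> //; apply: (le_trans lU).
have v0 : 0 <= (W ^+ d * T) / (2 ^+ n) ^+ d.+1.
  by rewrite divr_ge0 ?mulr_ge0 ?exprn_ge0// ltW.
apply: (@le_trans _ _ (\sum_(f <- enum (ffun_on (mem sortedt)))
   (((W ^+ d * T) / (2 ^+ n) ^+ d.+1) ^+ k)%:E)%E).
  by rewrite !big_seq; apply: lee_sum => f; rewrite mem_enum => /hit_bound[].
rewrite sumEFin lee_fin big_const_seq count_predT iter_addr_0 -cardE.
rewrite card_ffun_on card_ltn_sorted_tuples card_option card_ord.
rewrite -[X in X <= _]mulr_natr expr_div_n -mulrA.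
rewrite ler_wpM2l ?exprn_ge0 ?mulr_ge0 ?exprn_ge0 ?(ltW W0) ?(ltW T0)//.
rewrite ler_pdivrMl ?exprn_gt0// ler_pdivlMr ?exprn_gt0 ?ltr0n ?fact_gt0//.
have -> : 2 ^+ n ^+ d.+1 ^+ k = (((2 ^ n) ^ d.+1) ^ k)%:R :> R by rewrite !natrX.
have -> : (((2 ^ n) ^ d.+1) ^ k = ((2 ^ n) ^ k) ^ d.+1)%N.
  by rewrite -!(expnM (2 ^ n)) mulnC.
by rewrite -natrX -natrM ler_nat -expnMn leq_exp2r//; exact: bin_fact_le.
Qed.

End level.

Lemma long_bound k : measurable (long k) /\
  (P (long k) <= ((W ^+ d * T) ^+ k / (k`!%:R) ^+ d.+1)%:E)%E.
Proof.
have mb n := proj1 (sep_bound n k).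
have mU : measurable (\bigcup_n sep n k) by exact: bigcup_measurable.
rewrite long_sep; split=> //.
apply: (@cvge_le _ \oo _ _ (P \o sep^~ k)); last first.
  by apply: nondecreasing_cvg_mu => //; exact: sep_mono.
by near=> n; exact: (sep_bound n k).2.
Unshelve. all: by end_near. Qed.

End chain_tail.

(** * Decay of the long-chain probabilities *)

Section tail_estimate.
Context {R : realType}.

(** Comparison with a telescoping sum: n terms add up to at most 2 - 1/n. *)
Lemma sum_inv_sqr_le (n : nat) :
  \sum_(m < n) (m.+1%:R ^+ 2)^-1 <= 2 :> R.
Proof.
case: n => [|n]; first by rewrite big_ord0.
suff : \sum_(m < n.+1) (m.+1%:R ^+ 2)^-1 <= 2 - n.+1%:R^-1 :> R.
  by move=> /le_trans; apply; rewrite lerBlDr lerDl invr_ge0.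
elim: n => [|n IH]; first by rewrite big_ord1 expr1n invr1; lra.
rewrite big_ord_recr/=; apply: le_trans (lerD IH (lexx _)) _.
have n0 : 0 < n.+1%:R :> R by [].
rewrite -(natr1 n.+1); move: (n.+1%:R : R) n0 => x n0.
have x1 : x + 1 != 0 by rewrite gt_eqF//; lra.
have -> : 2 - x^-1 + (x + 1) ^- 2 = 2 - (x + 1)^-1 - (x * (x + 1) ^+ 2)^-1.
  by field; rewrite x1 gt_eqF.
by rewrite lerBlDr lerDl invr_ge0 mulr_ge0 ?sqr_ge0 ?ltW.
Qed.

Lemma nneseries_inv_sqr_lty (u : nat -> \bar R) (K : R) : 0 <= K ->
  (forall m, (0 <= u m)%E) ->
  (forall m, (u m <= (K * (m.+1%:R ^+ 2)^-1)%:E)%E) ->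
  (\sum_(m <oo) u m < +oo)%E.
Proof.
move=> K0 u0 uK; apply: (@le_lt_trans _ _ (K * 2)%:E); last by rewrite ltry.
apply: lime_le; first exact: is_cvg_nneseries.
near=> n; rewrite big_mkord.
apply: (@le_trans _ _ (\sum_(m < n) (K * (m.+1%:R ^+ 2)^-1)%:E)%E).
  exact: lee_sum.
rewrite sumEFin lee_fin -mulr_sumr ler_wpM2l//.
exact: sum_inv_sqr_le.
Unshelve. all: by end_near. Qed.

Variable d : nat.
Hypothesis d0 : (0 < d)%N.

Lemma klen_gt0 (b m : nat) : (0 < m)%N -> (0 < klen (R := R) (d := d) b m)%N.
Proof.
move=> m0; rewrite lt0n; apply/eqP => k0.
have := @klen_ge R d b m; rewrite k0 exp0n// leqn0 muln_eq0 expn_eq0 /kap/=.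
by rewrite eqn0Ngt m0.
Qed.

(** Writing k for [klen b m], m^d <= k^(d+1) <= k^(2d), because d + 1 <= 2d. *)
Lemma klen_sqr (b m : nat) : (0 < m)%N -> (m <= klen (R := R) (d := d) b m ^ 2)%N.
Proof.
move=> m0; have k0 := klen_gt0 b m0; set k := klen b m in k0 *.
rewrite -(leq_exp2r _ _ d0) -expnM.
apply: leq_trans (leq_trans _ (@klen_ge R d b m)) _.
  by rewrite leq_pmull.
by rewrite leq_pexp2l//; lia.
Qed.

(** With V the volume of the box, the choice of [kap] gives V e^(d+2) <= k^(d+1). The bound k! >=
    (k/e)^k uses up d+1 of the factors e, and the last one leaves e^(-k). As m <= k^2, this is at
    most a constant over m^(d+2), summable even against a weight of order m^d. *)
Lemma tail_term_le (b m k : nat) : (0 < b)%N -> (b <= m)%N ->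
  k = klen (R := R) (d := d) b m ->
  ((m%:R + b%:R) ^+ d * b%:R) ^+ k / (k`!%:R) ^+ d.+1
    <= (2 * d.+2)`!%:R / m%:R ^+ d.+2 :> R.
Proof.
move=> b0 bm kE; have m0 : (0 < m)%N by exact: leq_trans b0 bm.
have k0 : (0 < k)%N by rewrite kE; exact: klen_gt0.
set V := (m%:R + b%:R) ^+ d * b%:R.
have V0 : 0 <= V by rewrite mulr_ge0 ?exprn_ge0.
set e := expR (1 : R); have e0 : 0 < e := expR_gt0 1.
have eX j : expR j%:R = e ^+ j by rewrite -[j%:R]mulr1 expRM_natl.
have kR : 0 < (k%:R : R) by rewrite ltr0n.
have kX j : 0 < (k%:R ^+ j : R) by exact: exprn_gt0.
have V1 : V * e ^+ d.+2 <= k%:R ^+ d.+1.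
  apply: (@le_trans _ _ ((kap (R := R) (d := d) b * m ^ d)%:R)); last first.
    by rewrite -natrX ler_nat kE; exact: klen_ge.
  apply: (@le_trans _ _ (2 ^+ d * b%:R * expR d.+2%:R * m%:R ^+ d)); last first.
    rewrite natrM natrX ler_wpM2r ?exprn_ge0//; apply: ltW; exact: truncnS_gt.
  rewrite eX /V.
  have : (m%:R + b%:R) ^+ d <= (2 * m%:R) ^+ d :> R.
    apply: lerXn2r; rewrite ?nnegrE ?mulr_ge0 ?addr_ge0//.
    by have : (b%:R <= m%:R :> R) by [rewrite ler_nat]; lra.
  rewrite exprMn => h.
  rewrite [leRHS](_ : _ = 2 ^+ d * m%:R ^+ d * (b%:R * e ^+ d.+2)); last by ring.
  by rewrite -[leLHS]mulrA ler_wpM2r// mulr_ge0// exprn_ge0// ltW.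
have fk : (k`!%:R : R)^-1 <= e ^+ k / k%:R ^+ k.
  have := @expR_ge_term R k%:R k (ltW kR); rewrite eX => h.
  have f0 : 0 < (k`!%:R : R) by rewrite ltr0n fact_gt0.
  by rewrite ler_pdivlMr// mulrC.
apply: (@le_trans _ _ ((e^-1) ^+ k)).
  apply: (@le_trans _ _ (V ^+ k * (e ^+ k / k%:R ^+ k) ^+ d.+1)).
    rewrite ler_wpM2l ?exprn_ge0// -exprVn.
    apply: lerXn2r => //; rewrite nnegrE ?invr_ge0//.
    by rewrite divr_ge0// exprn_ge0// ltW.
  rewrite -expr_div_n -exprM mulnC exprM -exprMn.
  apply: lerXn2r; [|by rewrite nnegrE invr_ge0 ltW|].
    by rewrite nnegrE mulr_ge0// exprn_ge0// divr_ge0// ltW.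
  rewrite expr_div_n mulrA ler_pdivrMr// ler_pdivlMl//.
  by rewrite mulrCA -exprS.
rewrite exprVn -eX.
have := @expR_ge_term R k%:R (2 * d.+2) (ltW kR) => h.
have f0 : 0 < ((2 * d.+2)`!%:R : R) by rewrite ltr0n fact_gt0.
apply: (@le_trans _ _ ((2 * d.+2)`!%:R / k%:R ^+ (2 * d.+2))).
  rewrite -[leRHS]invf_div lef_pV2 ?posrE ?divr_gt0// expR_gt0//.
rewrite ler_pM2l// lef_pV2 ?posrE ?exprn_gt0 ?ltr0n//.
rewrite exprM; apply: lerXn2r; rewrite ?nnegrE ?exprn_ge0//.
by rewrite -natrX ler_nat kE; exact: klen_sqr.
Qed.

End tail_estimate.

(** * Almost sure regularity of the configuration *)

Section almost_sure.
Context {R : realType} {d : nat} {dO : measure_display} {Omega : measurableType dO}.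
Variables (P : probability Omega R) (N : Omega -> set (stpt R d)).
Hypothesis (d0 : (0 < d)%N) (HN : is_rate1_PPP P N).

Definition longb (b m : nat) : set Omega :=
  long N (- m%:R) (m%:R + b%:R) b%:R (klen (R := R) (d := d) b m).

Lemma longb_bound b m : (0 < b)%N -> (b <= m)%N -> measurable (longb b m) /\
  (P (longb b m) <= ((2 * d.+2)`!%:R / m%:R ^+ d.+2)%:E)%E.
Proof.
move=> b0 bm; have bR : 0 < (b%:R : R) by rewrite ltr0n.
have mR : 0 < (m%:R + b%:R : R) by rewrite ltr_wpDl.
have [mL lL] := long_bound HN (- m%:R) mR bR (klen (R := R) (d := d) b m).
split=> //; apply: (le_trans lL); rewrite lee_fin; exact: tail_term_le.
Qed.

Lemma chain_take Nw (t : R) (y x : pt R d) c j :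
  chain Nw t y x c -> chain Nw t y x (take j c).
Proof.
move=> [h1 h2]; split; first by move=> p /mem_take; exact: h1.
by apply: take_sorted => //; exact: stltb_trans.
Qed.

(** A chain that is too long has an initial segment of exactly [klen] points. *)
Lemma short_chains_longb w b ms : (forall m, (ms <= m)%N -> ~ longb b m w) <->
  short_chains (N w) b ms.
Proof.
have E (m : nat) : diag (- m%:R + (m%:R + b%:R)) = diag b%:R :> pt R d.
  by rewrite addKr.
split=> h m.
  move=> c msm ch; rewrite ltnNge; apply/negP => hk; apply: (h m msm).
  exists (take (klen (R := R) (d := d) b m) c); split; last exact: size_takel.
  by rewrite E; exact: chain_take.
move=> msm [c []]; rewrite E => /(h m c msm) + sc.
by rewrite sc ltnn.
Qed.

(** Levels below M count as bad, so that a level with nothing bad from it on is automatically at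
    least M. *)
Definition bad (b M m : nat) : set Omega := if (m < M)%N then setT else longb b m.

(** It exceeds the volume of (-(m+1), m+1]^d, the cube that is relevant when m is the last bad
    level. *)
Definition weight (m : nat) : R := (2 * m.+2%:R) ^+ d.

Lemma bad_measurable b M m : (0 < b)%N -> (b <= M)%N -> measurable (bad b M m).
Proof.
move=> b0 bM; rewrite /bad; case: ifPn => //; rewrite -leqNgt => Mm.
by have [] := longb_bound b0 (leq_trans bM Mm).
Qed.

Lemma weight_ge0 m : 0 <= weight m.
Proof. by rewrite exprn_ge0// mulr_ge0. Qed.

Lemma bad_summable b M : (0 < b)%N -> (b <= M)%N ->
  (\sum_(m <oo) (weight m)%:E * P (bad b M m) < +oo)%E.
Proof.
move=> b0 bM; set C : R := (2 * d.+2)`!%:R.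
(* The first term serves the levels m < M; the second the others, through 2(m+2) <= 6m and (m+1)^2
   <= 4m^2. *)
pose K : R := weight M * M.+1%:R ^+ 2 + 6 ^+ d * C * 4.
have K1 : 0 <= weight M * M.+1%:R ^+ 2 by rewrite mulr_ge0 ?weight_ge0 ?exprn_ge0.
have K2 : 0 <= 6 ^+ d * C * 4 by rewrite !mulr_ge0 ?exprn_ge0.
apply: (@nneseries_inv_sqr_lty _ _ K); first by rewrite addr_ge0.
  by move=> m; rewrite mule_ge0// lee_fin weight_ge0.
move=> m; have mP : 0 < (m.+1%:R ^+ 2 : R) by rewrite exprn_gt0.
rewrite /bad; case: ifPn => [mM|].
  rewrite probability_setT mule1 lee_fin ler_pdivlMr//.
  apply: (@le_trans _ _ (weight M * M.+1%:R ^+ 2)); last by rewrite lerDl.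
  apply: ler_pM; rewrite ?weight_ge0 ?exprn_ge0//.
    apply: lerXn2r; rewrite ?nnegrE ?mulr_ge0// ler_wpM2l// ler_nat; lia.
  by apply: lerXn2r; rewrite ?nnegrE// ler_nat; lia.
rewrite -leqNgt => Mm; have m0 : (0 < m)%N by lia.
have [_ h] := longb_bound b0 (leq_trans bM Mm).
apply: (@le_trans _ _ ((weight m)%:E * (C / m%:R ^+ d.+2)%:E)%E).
  by rewrite lee_wpmul2l// lee_fin weight_ge0.
have mR : 1 <= (m%:R : R) by rewrite ler1n.
rewrite -EFinM lee_fin ler_pdivlMr//.
apply: (@le_trans _ _ (6 ^+ d * C * 4)); last by rewrite lerDr.
have h1 : weight m <= 6 ^+ d * m%:R ^+ d.
  rewrite -exprMn; apply: lerXn2r; rewrite ?nnegrE ?mulr_ge0//.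
  by rewrite -natr1 -natr1; lra.
have h2 : m.+1%:R ^+ 2 <= 4 * m%:R ^+ 2 :> R.
  rewrite -natr1; nra.
rewrite [leLHS](_ : _ = (weight m * m.+1%:R ^+ 2) * (C / m%:R ^+ d.+2)); last by ring.
apply: (@le_trans _ _ ((6 ^+ d * m%:R ^+ d) * (4 * m%:R ^+ 2) * (C / m%:R ^+ d.+2))).
  apply: ler_wpM2r; first by rewrite divr_ge0 ?exprn_ge0.
  by apply: ler_pM; rewrite ?weight_ge0 ?exprn_ge0.
rewrite le_eqVlt; apply/orP; left; apply/eqP.
rewrite -[d.+2]addn2 exprD; field.
by rewrite !expf_neq0// gt_eqF//; lra.
Qed.

(** Borel-Cantelli; the weights are at least 1, so the weighted sum dominates the plain one. *)
Lemma longb_finitely_many b : (0 < b)%N ->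
  exists2 G : set Omega, measurable G & P (~` G) = 0%E /\
   forall w, G w -> exists ms, short_chains (N w) b ms.
Proof.
move=> b0; pose F := bad b b.
have mF k : measurable (F k) by exact: bad_measurable.
exists (~` lim_sup_set F); last split.
- apply: measurableC; apply: bigcap_measurable => // k _.
  by apply: bigcup_measurable => j _; exact: mF.
- rewrite setCK; apply: lim_sup_set_cvg0 => //.
  apply: le_lt_trans (bad_summable b0 (leqnn b)).
  apply: lee_nneseries => [i _ _|n _]; first exact: measure_ge0.
  rewrite -[leLHS]mul1e lee_wpmul2r// lee_fin /weight.
  apply: exprn_ege1; have : (1 : R) <= n.+2%:R by rewrite ler1n.
  lra.
- move=> w; rewrite /lim_sup_set => h.
  have [n hn] : exists n, forall j, (n <= j)%N -> ~ F j w.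
    apply: contrapT => H; apply: h => n _.
    apply: contrapT => H'; apply: H; exists n => j nj Fj; apply: H'.
    by exists j.
  exists (maxn n b); apply/short_chains_longb => m.
  rewrite geq_max => /andP[nm bm] hm; apply: (hn m nm).
  by rewrite /F /bad ltnNge bm.
Qed.

(** The Poisson probabilities of the finite counts sum to 1, which leaves no mass for an infinite
    count. The case L = 0 is separate because [poisson_pmf] is used at a positive parameter. *)
Lemma finite_count_as (L : nat) :
  exists2 G : set Omega, measurable G & P (~` G) = 0%E /\
   forall w, G w -> finite_set (trunc (N w) L%:R L%:R).
Proof.
pose bx : set (stpt R d) := stbox (diag (- L%:R)) (diag L%:R) 0 L%:R.
have tE w : trunc (N w) L%:R L%:R = N w `&` bx.
  apply/seteqP; split=> p.
    by move=> [Np [h1 h2]]; do 2 (split=> //); move=> i; rewrite !tnth_mktuple; exact: h1.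
  by move=> [Np [h1 h2]]; do 2 (split=> //); move=> i; have := h1 i; rewrite !tnth_mktuple.
have [L0|L0] := posnP L.
  exists setT => //; split; first by rewrite setCT measure0.
  move=> w _; suff -> : trunc (N w) L%:R L%:R = set0 by exact: finite_set0.
  rewrite -subset0 => p [_ [_ /andP[h1 h2]]].
  by have := lt_le_trans h1 h2; rewrite L0 ltxx.
have LR : 0 < (L%:R : R) by rewrite ltr0n.
pose E n : set Omega := [set w | (N w `&` bx #= `I_n)%card].
pose lam : R := stvol (diag (- L%:R) : pt R d) (diag L%:R) 0 L%:R.
have lam0 : 0 < lam.
  rewrite /lam /stvol mulr_gt0 ?subr0//.
  by apply: prodr_gt0 => i _; rewrite !tnth_mktuple opprK addr_gt0.
have HE n : measurable (E n) /\ P (E n) = (poisson_pmf lam n)%:E.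
  have [||mE PE] := @poisson_fin _ _ _ _ P N HN unit (fun=> diag (- L%:R))
    (fun=> diag L%:R) (fun=> 0) (fun=> L%:R) (fun=> n).
  - move=> _; split; last by split=> //; exact: ltW.
    move=> i; rewrite !tnth_mktuple.
    by lra.
  - by move=> [] [].
  have -> : E n = [set w | forall i : unit, (N w `&` bx #= `I_n)%card].
    by apply/seteqP; split=> w h => [_|]; [exact: h|exact: h tt].
  split=> //; rewrite PE; congr EFin.
  rewrite big_const card_unit/= mulr1 /poisson_pmf lam0 /poisson_prob_at.
  by rewrite -/lam; ring.
have mU : measurable (\bigcup_n E n) by apply: bigcup_measurable => n _; exact: (HE n).1.
exists (\bigcup_n E n) => //; split; last first.
  by move=> w [n _ h]; rewrite tE; exists n.
rewrite probability_setC//.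
suff -> : P (\bigcup_n E n) = 1%E by rewrite subee.
rewrite measure_semi_bigcup//; last first.
- move=> i j _ _ [w [h1 h2]].
  have : (`I_i #= `I_j)%card by apply: card_eq_trans h2; rewrite card_eq_sym.
  by move=> /card_eq_II.
- by move=> n; exact: (HE n).1.
transitivity (\sum_(i <oo) (poisson_pmf lam i)%:E)%E.
  by apply: eq_eseriesr => i _; exact: (HE i).2.
rewrite nneseries_esumT; last by move=> *; rewrite lee_fin poisson_pmf_ge0.
have /= := @probability_setT _ _ _ (poisson_prob lam 0%N).
by rewrite /poisson_prob lam0.
Qed.

(** A count event is unchanged on [G]. Off [G] the configuration is empty and the event is
    everything or nothing, so it stays measurable without completing P. *)
Lemma poisson_modification (G : set Omega) : measurable G -> P (~` G) = 0%E ->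
  is_rate1_PPP P (fun w => if `[< G w >] then N w else set0).
Proof.
move=> mG PG; case: HN => h1 h2; split.
  by move=> w p; case: ifP => // _; exact: h1.
move=> k a b u v n hab hdis E; have [mE PE] := h2 k a b u v n hab hdis.
set E0 := [set w | _] in mE PE.
set E1 := [set w | forall i, ((set0 : set (stpt R d)) `&` stbox (a i) (b i) (u i) (v i) #= `I_(n i))%card] : set Omega.
have EE : E = (E0 `&` G) `|` (E1 `&` ~` G).
  apply/seteqP; split=> w.
    by rewrite /E/=; case: asboolP => Gw h; [left|right].
  by case=> -[h Gw]; rewrite /E/=; case: asboolP.
have mE1 : measurable E1.
  have [H|H] := pselect (forall i, ((set0 : set (stpt R d)) `&` stbox (a i) (b i) (u i) (v i) #= `I_(n i))%card).
    by rewrite (_ : E1 = setT)//; apply/seteqP; split.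
  by rewrite (_ : E1 = set0)//; apply/seteqP; split.
have mE' : measurable E.
  by rewrite EE; apply: measurableU; apply: measurableI => //; exact: measurableC.
split=> //; rewrite -PE EE.
have z A : measurable A -> P (A `&` ~` G) = 0%E.
  move=> mA; apply/eqP; rewrite eq_le measure_ge0 andbT -PG.
  by apply: le_measure; rewrite ?inE//; [apply: measurableI => //; exact: measurableC|exact: measurableC].
have mI : measurable (E1 `&` ~` G) by apply: measurableI => //; exact: measurableC.
transitivity (P (E0 `&` G) + P (E1 `&` ~` G))%E.
  apply: measureU => //; first exact: measurableI.
  by rewrite -subset0 => w [[_ Gw] [_ /(_ Gw)]].
rewrite z// adde0 -[in RHS](setUIDK E0 G).
transitivity (P (E0 `&` G) + P (E0 `\` G))%E; first by rewrite setDE z// adde0.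
apply/esym/measureU; [exact: measurableI|exact: measurableD|].
by rewrite -subset0 => w [[_ Gw] [_ /(_ Gw)]].
Qed.

Lemma nice_set0 : nice (set0 : set (stpt R d)).
Proof.
split=> [L|b]; first by apply: sub_finite_set (finite_set0 _) => p [].
exists 1%N => m c m1 [h _]; case: c h => [_|p c /(_ p)]; first exact: klen_gt0.
by rewrite mem_head => /(_ isT)[].
Qed.

(** Niceness is wanted for every w, not just almost every one: [phi] is measurable and bounded on
    Sigma only, so all states have to stay there. *)
Lemma nice_modification : exists2 G : set Omega, measurable G & P (~` G) = 0%E /\
  forall w, nice (if `[< G w >] then N w else set0).
Proof.
have H1 b : exists G : set Omega, [/\ measurable G, P (~` G) = 0%E &
    forall w, G w -> exists ms, short_chains (N w) b ms].
  case: b => [|b]; last by have [G ? []] := longb_finitely_many (ltn0Sn b); exists G.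
  exists setT; split=> //; first by rewrite setCT measure0.
  move=> w _; exists 1%N => m c m1 [h _]; case: c h => [_|p c /(_ p)].
    exact: klen_gt0.
  rewrite mem_head => /(_ isT)[_ [_ [_ /andP[h3 h4]]]].
  by have := lt_le_trans h3 h4; rewrite ltxx.
have H2 L : exists G : set Omega, [/\ measurable G, P (~` G) = 0%E &
    forall w, G w -> finite_set (trunc (N w) L%:R L%:R)].
  by have [G ? []] := finite_count_as L; exists G.
have [G1 hG1] := choice H1; have [G2 hG2] := choice H2.
exists (\bigcap_b (G1 b `&` G2 b)).
  apply: bigcapT_measurable => b; have [? _ _] := hG1 b; have [? _ _] := hG2 b.
  exact: measurableI.
split; last first.
  move=> w; case: asboolP => [Gw|_]; last exact: nice_set0.
  split=> [L|b]; first by have [_ _] := hG2 L; apply; have [] := Gw L I.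
  by have [_ _] := hG1 b; apply; have [] := Gw b I.
rewrite setC_bigcap; apply/negligibleP.
  apply: bigcup_measurable => b _; apply: measurableC.
  by have [? _ _] := hG1 b; have [? _ _] := hG2 b; exact: measurableI.
apply: negligible_bigcup => b; rewrite setCI; apply: negligibleU.
  by have [? h _] := hG1 b; apply/negligibleP => //; exact: measurableC.
by have [? h _] := hG2 b; apply/negligibleP => //; exact: measurableC.
Qed.

End almost_sure.

(** * Lebesgue measure on cubes *)

Lemma bounded_integrable {dT : measure_display} {T : measurableType dT}
    {R : realType} (m : {measure set T -> \bar R}) (f : T -> R) (C : R) :
  (m setT < +oo)%E -> measurable_fun setT f -> (forall x, `|f x| <= C) ->
  m.-integrable setT (EFin \o f).
Proof.
move=> mT mf fC; apply: measurable_bounded_integrable => //.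
exists C; split; first exact: num_real.
by move=> x Cx y _; exact: le_trans (fC y) (ltW Cx).
Qed.

Section finite_pushforward.
Context {d1 d2 : measure_display} {X : measurableType d1} {Y : measurableType d2}.
Context {R : realType} (m : {measure set X -> \bar R}) (f : X -> Y).
Hypotheses (mf : measurable_fun setT f) (mfin : (m setT < +oo)%E).

(** The two proofs are arguments so that the structures of a measure and of a finite measure can be
    attached to the term. *)
Definition pushfin (_ : measurable_fun setT f) (_ : (m setT < +oo)%E) :
  set Y -> \bar R := pushforward m f.

Local Notation nu := (pushfin mf mfin).

Let nu0 : nu set0 = 0%E.
Proof. by rewrite /pushfin /pushforward preimage_set0 measure0. Qed.

Let nu_ge0 A : (0 <= nu A)%E.
Proof. exact: measure_ge0. Qed.

Let mpre A : measurable A -> measurable (f @^-1` A).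
Proof. by move=> mA; rewrite -[X in measurable X]setTI; exact: mf. Qed.

Let nu_sigma_additive : semi_sigma_additive nu.
Proof.
move=> F mF tF mUF; rewrite /pushfin /pushforward preimage_bigcup.
apply: measure_semi_sigma_additive.
- by move=> n; exact: mpre.
- apply/trivIsetP => i j _ _ ij; rewrite -preimage_setI.
  by move/trivIsetP : tF => -> //; rewrite preimage_set0.
- by rewrite -preimage_bigcup; exact: mpre.
Qed.

HB.instance Definition _ := isMeasure.Build _ _ _ nu nu0 nu_ge0 nu_sigma_additive.

Let nu_fin : fin_num_fun nu.
Proof.
move=> A mA; rewrite ge0_fin_numE ?measure_ge0//; apply: le_lt_trans mfin.
rewrite [leLHS]/(m (f @^-1` A)).
by apply: le_measure; rewrite ?inE//; exact: mpre.
Qed.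

HB.instance Definition _ := Measure_isFinite.Build _ _ _ nu nu_fin.

End finite_pushforward.

Section iterated_integral.
Context {R : realType}.
Variable L : R.
Hypothesis L0 : 0 < L.

Local Notation leb := (@lebesgue_measure R).

Definition box n (a b : n.-tuple R) : set (n.-tuple R) :=
  [set y | forall i, tnth a i < tnth y i <= tnth b i].

Lemma measurable_box n (a b : n.-tuple R) : measurable (box a b).
Proof.
have -> : box a b = \bigcap_(i in [set: 'I_n])
    ((fun y : n.-tuple R => tnth y i) @^-1` `]tnth a i, tnth b i]%classic).
  apply/seteqP; split=> y /= h i; last by have := h i I; rewrite /= in_itv/=.
  by move=> _; rewrite /= in_itv/=; exact: h.
apply: fin_bigcap_measurable.
  by apply: sub_finite_set (finite_finpred predT) => i _.
move=> i _; rewrite -[X in measurable X]setTI.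
by apply: measurable_tnth => //; exact: measurable_itv.
Qed.

Lemma measurable_hyperplane n (i : 'I_n) (a : R) :
  measurable [set y : n.-tuple R | tnth y i = a].
Proof.
rewrite -[X in measurable X]setTI.
have mt : measurable_fun setT (fun y : n.-tuple R => tnth y i) by exact: measurable_tnth.
exact: (mt measurableT [set a] (measurable_set1 a)).
Qed.

Let Iset : set (measurableTypeR R) := `]- L, L]%classic.
Let mI : measurable Iset. Proof. exact: measurable_itv. Qed.
Let lebI_lty : (leb Iset < +oo)%E.
Proof. by rewrite lebesgue_measure_itv/=; case: ifP => //; rewrite ltry. Qed.
Let lebI : {finite_measure set (measurableTypeR R) -> \bar R} := mfrestr mI lebI_lty.

Let lebIE A : lebI A = leb (A `&` Iset).
Proof. by []. Qed.

Let lebIT : lebI setT = (2 * L)%:E.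
Proof.
rewrite lebIE setTI lebesgue_measure_itv/= lte_fin ifT.
  by rewrite -EFinD opprK; congr EFin; ring.
by apply: lt_trans L0; rewrite oppr_lt0.
Qed.

Definition consT n (x : measurableTypeR R * n.-tuple R) : n.+1.-tuple R := [tuple of x.1 :: x.2].

Lemma tnth_behead_lift n (a : n.+1.-tuple R) i :
  tnth (behead_tuple a) i = tnth a (lift ord0 i).
Proof. by rewrite [in RHS](tuple_eta a) tnthS. Qed.

Lemma measurable_consT n : measurable_fun setT (@consT n).
Proof. exact: measurable_cons. Qed.

Lemma integral_lebI (F : measurableTypeR R -> \bar R) : (forall y, ~ Iset y -> F y = 0%E) ->
  (\int[leb]_y F y = \int[lebI]_y F y)%E.
Proof.
move=> F0; have E y : (F \_ Iset) y = F y.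
  rewrite patchE; case: ifPn => // /negP h; apply/esym/F0 => h'.
  by apply: h; rewrite inE.
transitivity (\int[leb]_(x in Iset) F x)%E.
  by rewrite [RHS]integral_mkcond; apply: eq_integral => y _; rewrite E.
transitivity (\int[lebI]_(x in Iset) F x)%E; last first.
  by rewrite [LHS]integral_mkcond; apply: eq_integral => y _; rewrite E.
apply: eq_measure_integral => A mA AI.
by rewrite [RHS]lebIE setIidl.
Qed.

(* The restriction of Lebesgue measure to (-L, L]^n. *)
Definition cube_measure n (mu : {finite_measure set (n.-tuple R) -> \bar R}) :=
  [/\ forall f : n.-tuple R -> R, measurable_fun setT f ->
       (exists C : R, forall x, `|f x| <= C) -> (forall x, ~ spbox L x -> f x = 0) ->
       itint (fun x => (f x)%:E) = (\int[mu]_x (f x)%:E)%E,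
     forall a b : n.-tuple R, tle a b ->
       (forall i, - L <= tnth a i /\ tnth b i <= L) ->
       mu (box a b) = (\prod_i (tnth b i - tnth a i))%:E,
     mu setT = ((2 * L) ^+ n)%:E &
     forall i a, mu [set y : n.-tuple R | tnth y i = a] = 0%E].

(** Induction on n: the product of Lebesgue measure on (-L, L] with the previous measure is carried
    over by [consT]. Since f vanishes off the box, [itint] sees only the restricted measures, and
    Fubini turns it into one integral. *)
Lemma cube_measure_ex n : exists mu, @cube_measure n mu.
Proof.
elim: n => [|n [mu [h1 h2 h3 h4]]].
  exists (\d_ [tuple] : {finite_measure set (0.-tuple R) -> \bar R}); split.
  - move=> f mf _ _; rewrite integral_dirac//= ?diracE ?mem_setT ?mul1e//.
    exact/measurable_EFinP.
  - by move=> a b _ _; rewrite big_ord0 /= diracE mem_set// => -[].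
  - by rewrite expr0 /= diracE mem_setT.
  - by case.
have PE A B : measurable A -> measurable B ->
    ((lebI \x mu) (A `*` B) = lebI A * mu B)%E by exact: product_measure1E.
have prodT : ((lebI \x mu) setT = ((2 * L) ^+ n.+1)%:E)%E.
  by rewrite -setXTT PE// lebIT h3 -EFinM -exprS.
have prod_lty : ((lebI \x mu) setT < +oo)%E by rewrite prodT ltry.
pose nu : {finite_measure set (n.+1.-tuple R) -> \bar R} :=
  pushfin (@measurable_consT n) prod_lty.
exists nu; split.
- move=> f mf [C fC] f0.
  have mfy y : measurable_fun setT (fun z : n.-tuple R => f (consT (y, z))).
    apply: measurableT_comp => //; apply: measurableT_comp (@measurable_consT n) _.
    exact: measurable_pair1.
  have fy0 y z : ~ spbox L z -> f (consT (y, z)) = 0.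
    move=> hz; apply: f0 => h; apply: hz => i.
    by have := h (lift ord0 i); rewrite /consT tnthS.
  rewrite /=.
  transitivity (\int[leb]_y \int[mu]_z (f (consT (y, z)))%:E)%E.
    apply: eq_integral => y _.
    exact: (h1 (fun z => f (consT (y, z))) (mfy y) (ex_intro _ C (fun z => fC _)) (fy0 y)).
  rewrite integral_lebI; last first.
    move=> y hy; apply: integral0_eq => z _; congr EFin; apply: f0 => h.
    by apply: hy; have := h ord0; rewrite /consT tnth0 /Iset/= in_itv.
  have mfc : measurable_fun setT (f \o @consT n).
    by apply: measurableT_comp => //; exact: measurable_consT.
  have intf : (lebI \x mu)%E.-integrable setT ((EFin \o f) \o @consT n).
    by apply: (@bounded_integrable _ _ _ _ (f \o @consT n) C) => // x; exact: fC.
  rewrite /nu /pushfin integral_pushforward//.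
  + by rewrite preimage_setT -integral12_prod_meas1.
  + exact: measurable_consT.
  + exact/measurable_EFinP.
- move=> a b ab hab.
  have E : @consT n @^-1` box a b =
      `]thead a, thead b]%classic `*` box (behead_tuple a) (behead_tuple b).
    apply/seteqP; split=> -[y z] /= h.
      split; first by have := h ord0; rewrite /consT tnth0 /= in_itv.
      by move=> i; have := h (lift ord0 i); rewrite /consT tnthS /= !tnth_behead_lift.
    case: h => hy hz i; case: (unliftP ord0 i) => [j ->|->].
      by have := hz j; rewrite /consT tnthS /= !tnth_behead_lift.
    by move: hy; rewrite /consT tnth0 /= in_itv.
  rewrite /= /pushfin /pushforward E PE//; last exact: measurable_box.
  rewrite h2; last 2 first.
  + by move=> i; rewrite !tnth_behead_lift; exact: ab.
  + by move=> i; rewrite !tnth_behead_lift; exact: hab.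
  rewrite big_ord_recl EFinM; congr (_ * _)%E; last first.
    by congr EFin; apply: eq_bigr => i _; rewrite !tnth_behead_lift.
  have [a0 _] := hab ord0; have [_ b0] := hab ord0.
  rewrite lebIE setIidl; last first.
    move=> y /=; rewrite !in_itv/= => /andP[ya yb].
    by rewrite /Iset/= in_itv/= (le_lt_trans a0 ya) (le_trans yb b0).
  rewrite lebesgue_measure_itv/= lte_fin; case: ltP => [//|h].
  by congr EFin; apply/esym/eqP; rewrite subr_eq0 eq_le h; exact: ab.
- by rewrite /= /pushfin /pushforward preimage_setT prodT.
- move=> i a; rewrite /= /pushfin /pushforward.
  case: (unliftP ord0 i) => [j ->|->].
    have -> : @consT n @^-1` [set y | tnth y (lift ord0 j) = a] =
        setT `*` [set y : n.-tuple R | tnth y j = a].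
      by apply/seteqP; split=> -[y z] /=; rewrite /consT tnthS//= => -[].
    rewrite PE// ?h4 ?mule0//.
    exact: measurable_hyperplane.
  have -> : @consT n @^-1` [set y | tnth y ord0 = a] = [set a] `*` setT.
    by apply/seteqP; split=> -[y z] /=; rewrite /consT tnth0//= => -[].
  rewrite PE//.
  suff -> : lebI [set a] = 0%E by rewrite mul0e.
  apply/eqP; rewrite eq_le measure_ge0 andbT -(lebesgue_measure_set1 a).
  by rewrite lebIE; apply: le_measure; rewrite ?inE//; exact: measurableI.
Qed.

End iterated_integral.

(** * Functionals of the state on a cube *)

Section supported_functionals.
Context {R : realType} {d : nat} (q : R) (phi : state R d -> R).
Hypothesis phi_meas : supported_measurable q phi.

Let Gq := [set A : set (state R d) | exists x, cube q x /\
                 exists v, Zstar v /\ A = [set s | s x = v]].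

(** The sets that do not separate s from s' form a sigma-algebra containing the generators, hence
    the set that represents the level set of [phi] at [phi s]. *)
Lemma supported_ext (s s' : state R d) : in_Sigma s -> in_Sigma s' ->
  (forall x, cube q x -> s x = s' x) -> phi s = phi s'.
Proof.
move=> hs hs' ss'; have [A [GA EA]] := phi_meas (measurable_set1 (phi s)).
pose F := [set A : set (state R d) | A s <-> A s'].
have sF : sigma_algebra setT F.
  split.
  - by [].
  - by move=> B; rewrite /F/= => BB; split=> -[_ h]; split=> // /BB.
  - move=> B hB; rewrite /F/=; split=> -[n _ h]; exists n => //.
      by have := hB n; rewrite /F/= => <-.
    by have := hB n; rewrite /F/= => ->.
have FA : F A.
  apply: GA; split=> // _ [x [qx [v [_ ->]]]]; rewrite /F/=.
  by rewrite ss'.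
have : (@in_Sigma R d `&` phi @^-1` [set phi s]) s by [].
rewrite EA => -[_ /FA As'].
have : (@in_Sigma R d `&` A) s' by [].
by rewrite -EA => -[_ /= ->].
Qed.

(** Thresholds at integers suffice: the event X t x = v is a countable intersection of threshold
    conditions, indexed by the nonpositive and the nonnegative integers, and good sets extend this
    to the generated sigma-field. *)
Lemma supported_measurable_comp {dT : measure_display} {T : measurableType dT}
    (X : T -> state R d) :
  (forall t, in_Sigma (X t)) ->
  (forall x (v : int), cube q x -> measurable [set t | (v%:~R%:E <= X t x)%E]) ->
  measurable_fun setT (phi \o X).
Proof.
move=> XS mX _ B mB; rewrite setTI.
have [A [GA EA]] := phi_meas mB.
have -> : (phi \o X) @^-1` B = X @^-1` A.
  apply/seteqP; split=> t /= h.
    have : (@in_Sigma R d `&` phi @^-1` B) (X t) by split.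
    by rewrite EA => -[].
  have : (@in_Sigma R d `&` A) (X t) by split.
  by rewrite -EA => -[].
pose F := [set A : set (state R d) | measurable (X @^-1` A)].
have sF : sigma_algebra setT F.
  split.
  - by rewrite /F/= preimage_set0.
  - by move=> C mC; rewrite /F/= setTD preimage_setC; exact: measurableC.
  - move=> C mC; rewrite /F/= preimage_bigcup.
    by apply: bigcup_measurable => n _; exact: mC.
suff GF : Gq `<=` F by exact: (GA F (conj sF GF)).
move=> _ [x [qx [v [Zv ->]]]]; rewrite /F/=.
have mN (z : int) : measurable [set t | ~ (z%:~R%:E <= X t x)%E].
  by apply: measurableC; exact: mX.
have ZX t : Zstar (X t x) by case: (in_Sigma_regular (XS t)).
have -> : X @^-1` [set s | s x = v] = \bigcap_(n : nat)
    ([set t | (- n%:Z)%:~R%:E <= v]%E `&` [set t | (- n%:Z)%:~R%:E <= X t x]%E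
     `|` [set t | ~ ((- n%:Z)%:~R%:E <= v)%E] `&` [set t | ~ ((- n%:Z)%:~R%:E <= X t x)%E])
   `&` \bigcap_(n : nat)
    ([set t | n%:Z%:~R%:E <= v]%E `&` [set t | n%:Z%:~R%:E <= X t x]%E
     `|` [set t | ~ (n%:Z%:~R%:E <= v)%E] `&` [set t | ~ (n%:Z%:~R%:E <= X t x)%E]).
  apply/seteqP; split=> t /=.
    move=> Xv; split=> n _ /=; rewrite Xv.
      by have [h|h] := pselect ((- n%:Z)%:~R%:E <= v)%E; [left|right].
    by have [h|h] := pselect (n%:Z%:~R%:E <= v)%E; [left|right].
  move=> [h1 h2]; apply: Zstar_ext => // z.
  case: z => n.
    by have := h2 n I => /= -[[]|[]].
  by have := h1 n.+1 I => /= -[[]|[]].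
have mc (b : bool) : measurable [set t : T | b].
  by case: b; [rewrite (_ : [set _ | _] = setT)|rewrite (_ : [set _ | _] = set0)];
    rewrite //; apply/seteqP; split.
have mc' (b : bool) : measurable [set t : T | ~ b] by apply: measurableC; exact: mc.
apply: measurableI; apply: bigcapT_measurable => n; apply: measurableU;
  apply: measurableI => //; exact: mX.
Qed.

End supported_functionals.

(** * Dyadic cells over finitely many axes and their refinement *)

Section grid_cells.
Context {R : realType} (O : finType) (lows widths : O -> R).
Hypothesis w0 : forall o, 0 < widths o.
Implicit Types (x : O -> R) (n m : nat).

Local Notation ix n := {ffun O -> 'I_(2 ^ n)}.

Definition gcell n (f : ix n) x := forall o,
  gridpt (lows o) (widths o) n (f o) < x o <= gridpt (lows o) (widths o) n (f o).+1.

Definition ginside x := forall o, lows o < x o <= lows o + widths o.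

Lemma gcell_inside n (f : ix n) x : gcell f x -> ginside x.
Proof.
move=> h o; have /andP[h1 h2] := h o; apply/andP; split.
  by apply: le_lt_trans h1; rewrite -[X in X <= _](gridpt0 _ (widths o) n) gridpt_le.
by apply: (le_trans h2); rewrite -(gridpt_top _ _ n) gridpt_le.
Qed.

Lemma gcellP n (f : ix n) x : ginside x ->
  gcell f x <-> forall o, idx1 (lows o) (widths o) n (x o) = f o.
Proof.
move=> hx; split=> h o; have /andP[h1 _] := hx o; first exact/idx1P.
by apply/idx1P => //; exact: h.
Qed.

Definition gindex n x (hx : ginside x) : ix n :=
  [ffun o => Ordinal (idx1_lt n (w0 o) (hx o))].

Lemma gcell_index n x (hx : ginside x) : gcell (gindex n hx) x.
Proof. by apply/gcellP => // o; rewrite ffunE. Qed.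

Lemma gcell_inj n (f g : ix n) x : gcell f x -> gcell g x -> f = g.
Proof.
move=> fx gx; have hx := gcell_inside fx.
apply/ffunP => o; apply: val_inj => /=.
by rewrite -((gcellP f hx).1 fx) -((gcellP g hx).1 gx).
Qed.

Definition subcell n m (f : ix n) (g : ix m) :=
  [forall o, (f o : nat) == (g o %/ 2 ^ (m - n))%N].

Lemma subcellP n m (f : ix n) (g : ix m) x : (n <= m)%N -> gcell g x ->
  subcell f g <-> gcell f x.
Proof.
move=> nm gx; have hx := gcell_inside gx.
have E o : idx1 (lows o) (widths o) n (x o) = (g o %/ 2 ^ (m - n))%N.
  have /andP[h1 _] := hx o.
  by rewrite (idx1_div n (m - n) (w0 o) h1) subnKC// ((gcellP g hx).1 gx).
split.
  by move=> /forallP h; apply/gcellP => // o; rewrite E (eqP (h o)).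
by move=> /(gcellP f hx) h; apply/forallP => o; rewrite -h E.
Qed.

Definition refine n m (J : {set ix n}) : {set ix m} :=
  [set g : ix m | [exists f : ix n, (f \in J) && subcell f g]]%SET.

Lemma refineP n m (J : {set ix n}) x : (n <= m)%N ->
  (exists2 f, f \in J & gcell f x) <-> (exists2 g, g \in refine m J & gcell g x).
Proof.
move=> nm; split=> [[f fJ fx]|[g]].
  have hx := gcell_inside fx; exists (gindex m hx); last exact: gcell_index.
  rewrite inE; apply/existsP; exists f; rewrite fJ/=.
  by apply/(subcellP f nm (gcell_index m hx)).
rewrite inE => /existsP[f /andP[fJ fg]] gx; exists f => //.
exact/(subcellP f nm gx).
Qed.

End grid_cells.

(** * The Mecke formula for a time strip *)

Lemma card_I1 (T : Type) (A : set T) : (A #= `I_1)%card <-> exists p, A = [set p].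
Proof.
split=> [/card_set_bijP[f [f1 f2 f3]]|[p ->]]; last exact: card_set1.
have [p Ap fp] : (f @` A) 0%N by apply: f3.
exists p; apply/seteqP; split=> [p' Ap'|_ -> //].
have f0 u : A u -> f u = 0%N by move=> /f1 /=; case: (f u).
by apply: f2; rewrite ?inE// !f0.
Qed.

Section strip_count.
Context {R : realType} {d : nat} {dO : measure_display} {Omega : measurableType dO}.
Variables (P : probability Omega R) (N : Omega -> set (stpt R d)).
Hypothesis HN : is_rate1_PPP P N.
Variables (L r h : R).
Hypotheses (L0 : 0 < L) (r0 : 0 <= r) (h0 : 0 < h).

Definition lam : R := (2 * L) ^+ d.

Definition strip : set (stpt R d) := stbox (diag (- L)) (diag L) r (r + h).

Lemma stripP p : strip p <-> spbox L p.1 /\ r < p.2 <= r + h.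
Proof.
split=> -[h1 h2]; split=> // i; have := h1 i; by rewrite !tnth_mktuple.
Qed.

Lemma strip_vol : stvol (diag (- L)) (diag L : pt R d) r (r + h) = lam * h.
Proof.
rewrite /stvol (eq_bigr (fun=> 2 * L)); last first.
  by move=> i _; rewrite !tnth_mktuple; ring.
by rewrite big_const_ord iter_mulr_1 [r + h]addrC addrK.
Qed.

Lemma strip_count (n : nat) : let E := [set w | (N w `&` strip #= `I_n)%card] in
  measurable E /\ P E = (poisson_prob_at (lam * h) n)%:E.
Proof.
have [||mE PE] := @poisson_fin _ _ _ _ P N HN unit (fun=> diag (- L))
    (fun=> diag L) (fun=> r) (fun=> r + h) (fun=> n).
- move=> _; split; last by split; [exact: r0|rewrite lerDl ltW].
  by move=> i; rewrite !tnth_mktuple (@le_trans _ _ 0)// ?oppr_le0 ltW.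
- by move=> [] [].
move=> E; have -> : E = [set w | forall i : unit, (N w `&` strip #= `I_n)%card].
  by apply/seteqP; split=> w hw => [_|]; [exact: hw|exact: hw tt].
split=> //; rewrite PE; congr EFin.
by rewrite big_const card_unit/= mulr1 strip_vol.
Qed.

End strip_count.

Section strip.
Context {R : realType} {d : nat} {dO : measure_display} {Omega : measurableType dO}.
Variables (P : probability Omega R) (N : Omega -> set (stpt R d)).
Hypothesis HN : is_rate1_PPP P N.
Variables (L r h : R).
Hypotheses (d0 : (0 < d)%N) (L0 : 0 < L) (r0 : 0 < r) (h0 : 0 < h).
Variable mu : {finite_measure set (pt R d) -> \bar R}.
Hypothesis hmu : cube_measure L mu.

Local Notation lam := (@lam R d L).
Local Notation strip := (@strip R d L r h).
Local Notation strip_count := (strip_count HN L0 (ltW r0) h0).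
Local Notation ixp n := {ffun option 'I_d -> 'I_(2 ^ n)}.
Local Notation ixs n := {ffun 'I_d -> 'I_(2 ^ n)}.

Definition pcell n (f : ixp n) (p : stpt R d) :=
  gcell (lows (- L)) (widths (2 * L) r) f (crd p).
Definition scell n (f : ixs n) (y : pt R d) :=
  gcell (fun=> - L) (fun=> 2 * L) f (tnth y).

Let w2 : 0 < 2 * L. Proof. by rewrite mulr_gt0. Qed.
Let wp (o : option 'I_d) : 0 < widths (2 * L) r o. Proof. by case: o. Qed.
Let ws (o : 'I_d) : 0 < 2 * L. Proof. exact: w2. Qed.

(** The probability of exactly one point in the strip, per unit volume of its location. *)
Definition rate1 : R := h * expR (- (lam * h)).

Lemma spboxE (y : pt R d) : spbox L y <-> ginside (fun=> - L) (fun=> 2 * L) (tnth y).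
Proof.
have E : - L + 2 * L = L by ring.
by split=> hy i; have := hy i; rewrite E.
Qed.

Lemma scell_spbox n (f : ixs n) y : scell f y -> spbox L y.
Proof. by move=> /(gcell_inside ws) ?; exact/spboxE. Qed.

Lemma scell_ex n y : spbox L y -> exists f : ixs n, scell f y.
Proof.
move=> /spboxE hy; exists (gindex ws n hy); exact: gcell_index.
Qed.

Definition slo n (f : ixs n) : pt R d := [tuple gridpt (- L) (2 * L) n (f i) | i < d].
Definition shi n (f : ixs n) : pt R d := [tuple gridpt (- L) (2 * L) n (f i).+1 | i < d].

Lemma scell_box n (f : ixs n) : [set y | scell f y] = box (slo f) (shi f).
Proof.
by apply/seteqP; split=> y hy i; have := hy i; rewrite !tnth_mktuple.
Qed.

Lemma scell_measurable n (f : ixs n) : measurable [set y | scell f y].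
Proof. by rewrite scell_box; exact: measurable_box. Qed.

Definition vols n : R := ((2 * L) / 2 ^+ n) ^+ d.

Lemma scell_vol n (f : ixs n) : mu [set y | scell f y] = (vols n)%:E.
Proof.
case: hmu => _ hb _ _; rewrite scell_box hb.
- congr EFin; rewrite (eq_bigr (fun=> 2 * L / 2 ^+ n)).
    by rewrite big_const_ord iter_mulr_1.
  by move=> i _; rewrite !tnth_mktuple gridptS addrC addKr.
- by move=> i; rewrite !tnth_mktuple gridpt_le.
- move=> i; rewrite !tnth_mktuple; split.
    by rewrite -[X in X <= _](gridpt0 (- L) (2 * L) n) gridpt_le.
  have E : gridpt (- L) (2 * L) n (2 ^ n) = L by rewrite gridpt_top; ring.
  by rewrite -[leRHS]E gridpt_le.
Qed.

Definition Vd n (J : {set ixp n}) : set Omega :=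
  [set w | forall p, N w p -> ~ exists2 f, f \in J & pcell f p].

Let plo n (f : ixp n) : pt R d := cell_lo (- L) (2 * L) n (fun o => f o).
Let phi_ n (f : ixp n) : pt R d := cell_lo (- L) (2 * L) n (fun o => (f o).+1).
Let ptl n (f : ixp n) : R := gridpt 0 r n (f None).
Let pth n (f : ixp n) : R := gridpt 0 r n (f None).+1.

Let pcellE n (f : ixp n) p : pcell f p <-> stbox (plo f) (phi_ f) (ptl f) (pth f) p.
Proof.
rewrite -[stbox _ _ _ _]/(cell (- L) (2 * L) r n (fun o => f o)).
by split=> hp; [apply/cellE|apply/cellE].
Qed.

Lemma Vd_void n (J : {set ixp n}) : Vd J =
  [set w | forall f, f \in J -> void N (plo f) (phi_ f) (ptl f) (pth f) w].
Proof.
apply/seteqP; split=> w hw.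
  move=> f fJ; rewrite /void/= -subset0 => p [Np fp].
  by apply: (hw p Np); exists f => //; exact/pcellE.
by move=> p Np [f fJ /pcellE fp]; have : set0 p by rewrite -(hw f fJ).
Qed.

Let pwf n (f : ixp n) : tle (plo f) (phi_ f) /\ 0 <= ptl f /\ ptl f <= pth f.
Proof. exact: cell_wf. Qed.

Let pdis n (f g : ixp n) : f != g ->
  stbox (plo f) (phi_ f) (ptl f) (pth f) `&` stbox (plo g) (phi_ g) (ptl g) (pth g) = set0.
Proof.
move=> fg; rewrite -subset0 => p [/pcellE fp /pcellE gp].
by move: fg; rewrite (gcell_inj wp fp gp) eqxx.
Qed.

Lemma Vd_measurable n (J : {set ixp n}) : measurable (Vd J).
Proof. by rewrite Vd_void; have [] := poisson_void HN (@pwf n) (@pdis n) J. Qed.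

Lemma Vd_refine n m (J : {set ixp n}) : (n <= m)%N ->
  Vd J = Vd (refine m J).
Proof.
by move=> nm; apply/seteqP; split=> w hw p Np /(refineP _ wp J _ nm) hp; exact: (hw p Np).
Qed.

Lemma Vd_setU n (J J' : {set ixp n}) : Vd J `&` Vd J' = Vd (J :|: J')%SET.
Proof.
apply/seteqP; split=> w.
  move=> [h1 h2] p Np [f]; rewrite inE => /orP[fJ|fJ] fp.
    by apply: (h1 p Np); exists f.
  by apply: (h2 p Np); exists f.
move=> hw; split=> p Np [f fJ fp]; apply: (hw p Np); exists f => //.
  by rewrite inE fJ.
by rewrite inE fJ orbT.
Qed.

Definition Z1 : set Omega := [set w | (N w `&` strip #= `I_1)%card].

Lemma Z1_measurable : measurable Z1. Proof. exact: (strip_count 1).1. Qed.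

Lemma Z1_prob : P Z1 = (rate1 * lam)%:E.
Proof.
rewrite (strip_count 1).2; congr EFin; rewrite /poisson_prob_at expr1.
have -> : 1`! = 1%N by [].
by rewrite /rate1; field.
Qed.

Definition sbox n (g : ixs n) : set (stpt R d) := stbox (slo g) (shi g) r (r + h).

Lemma sboxP n (g : ixs n) p : sbox g p <-> scell g p.1 /\ r < p.2 <= r + h.
Proof.
split=> -[h1 h2]; split=> // i; have := h1 i; by rewrite !tnth_mktuple.
Qed.

Definition strip1 n (f : ixs n) : set Omega :=
  [set w | forall g : ixs n, (N w `&` sbox g #= `I_(g == f))%card].

(** The past cells and the strip boxes are disjoint, so one application of the Poisson law gives
    independence; a past cell outside [J] is collapsed in time, which makes its emptiness free. The
    void factors of all strip boxes multiply to exp(-lam h). *)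
Lemma joint_prob n (J : {set ixp n}) (f : ixs n) :
  measurable (Vd J `&` strip1 f) /\
  P (Vd J `&` strip1 f) = (P (Vd J) * (rate1 * vols n)%:E)%E.
Proof.
pose a (i : ixp n + ixs n) : pt R d := match i with inl g => plo g | inr g => slo g end.
pose b (i : ixp n + ixs n) : pt R d := match i with inl g => phi_ g | inr g => shi g end.
pose u (i : ixp n + ixs n) : R := match i with inl g => ptl g | inr g => r end.
pose v (i : ixp n + ixs n) : R :=
  match i with inl g => if g \in J then pth g else ptl g | inr g => r + h end.
pose k (i : ixp n + ixs n) : nat := match i with inl g => 0 | inr g => (g == f) end.
have pthr (g : ixp n) : pth g <= r.
  have E : gridpt 0 r n (2 ^ n) = r by rewrite gridpt_top add0r.
  by rewrite -[leRHS]E gridpt_le.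
have [||mE PE] := @poisson_fin _ _ _ _ P N HN _ a b u v k.
- case=> g /=; first by have [? [? ?]] := pwf g; case: ifP.
  split; last by split; [exact: ltW|rewrite lerDl ltW].
  by move=> i; rewrite !tnth_mktuple gridpt_le.
- have vv g : v (inl g) <= pth g by rewrite /=; case: ifP => // _; case: (pwf g) => _ [].
  have sub g : stbox (a (inl g)) (b (inl g)) (u (inl g)) (v (inl g)) `<=`
     stbox (plo g) (phi_ g) (ptl g) (pth g).
    by move=> p [h1 /andP[h2 h3]]; split=> //; rewrite h2 (le_trans h3 (vv g)).
  have lr g g' : stbox (a (inl g)) (b (inl g)) (u (inl g)) (v (inl g)) `&`
     stbox (a (inr g')) (b (inr g')) (u (inr g')) (v (inr g')) = set0.
    rewrite -subset0 => p [[_ /andP[_ h1]] [_ /andP[h2 _]]].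
    by have := lt_le_trans h2 (le_trans h1 (le_trans (vv g) (pthr g))); rewrite ltxx.
  case=> g [] g' gg'.
  + rewrite -subset0 -(@pdis n g g'); last by apply: contra_neq gg' => ->.
    exact: setISS.
  + exact: lr.
  + by rewrite setIC lr.
  + rewrite -subset0 => p [/sboxP[h1 _] /sboxP[h2 _]].
    by move: gg'; rewrite (gcell_inj ws h1 h2) eqxx.
set E := [set w | _] in mE PE.
have EE : E = Vd J `&` strip1 f.
  rewrite Vd_void; apply/seteqP; split=> w hw.
    split=> g; last exact: (hw (inr g)).
    by move=> gJ; have := hw (inl g); rewrite /= gJ card_I0.
  case: hw => h1 h2 [] g /=; last exact: h2.
  rewrite card_I0; case: ifPn => gJ; first exact: h1.
  rewrite -subset0 => p [_ [_ /andP[h3 h4]]].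
  by have := lt_le_trans h3 h4; rewrite ltxx.
rewrite -EE; split=> //; rewrite PE big_sumType/= Vd_void.
have [_ ->] := poisson_void HN (@pwf n) (@pdis n) J.
rewrite -EFinM; congr EFin; congr (_ * _).
  rewrite [RHS]big_mkcond/=; apply: eq_bigr => g _.
  rewrite /poisson_prob_at expr0 fact0 divr1 mulr1; case: ifP => // _.
  by rewrite /stvol subrr mulr0 oppr0 expR0.
have volE (g : ixs n) : stvol (slo g) (shi g) r (r + h) = vols n * h.
  rewrite /stvol (eq_bigr (fun=> 2 * L / 2 ^+ n)); last first.
    by move=> i _; rewrite !tnth_mktuple gridptS addrC addKr.
  by rewrite big_const_ord iter_mulr_1 [r + h]addrC addrK.
rewrite (eq_bigr (fun g => expR (- (vols n * h)) * (if g == f then vols n * h else 1))); last first.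
  move=> g _; rewrite /poisson_prob_at volE; case: (g == f).
    by have -> : true`! = 1%N by []; rewrite expr1 divr1.
  by rewrite expr0 fact0 divr1.
rewrite big_split/= -big_mkcond/= big_pred1_eq.
rewrite prodr_const card_ffun !card_ord -expRM_natl /rate1.
have -> : (((2 ^ n) ^ d)%:R * - (vols n * h)) = - (lam * h).
  rewrite /vols /lam expr_div_n !natrX; field.
  by rewrite !expf_neq0.
ring.
Qed.

(** The default lies outside the box, so that a functional vanishing off the box also vanishes
    unless the strip holds exactly one point. *)
Definition Yloc (w : Omega) : pt R d :=
  if `[< Z1 w >] then (xget (diag 0, 0) (N w `&` strip)).1 else diag (L + 1).

Lemma YlocP w : Z1 w -> exists tau, N w `&` strip = [set (Yloc w, tau)].
Proof.
move=> Zw; have /card_I1[p Np] := Zw; rewrite /Yloc asboolT// Np.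
have : [set p] (xget (diag 0, 0) [set p]) by apply: xgetPex; exists p.
by move=> /= ->; exists p.2; case: p Np.
Qed.

Lemma Yloc_out w : ~ Z1 w -> ~ spbox L (Yloc w).
Proof.
move=> Zw; rewrite /Yloc asboolF// => /(_ (Ordinal d0)).
by rewrite tnth_mktuple gerDl ler10 andbF.
Qed.

Lemma strip1P n (f : ixs n) w : strip1 f w <-> scell f (Yloc w).
Proof.
split=> [hf|fY].
  have /card_I1[p Np] : (N w `&` sbox f #= `I_1)%card by have := hf f; rewrite eqxx.
  have Zw : Z1 w.
    apply/card_I1; exists p; apply/seteqP; split=> [p' [Np' /stripP[h1 h2]]|_ ->].
      have [g gp'] := scell_ex n h1.
      have sg : (N w `&` sbox g) p' by split=> //; apply/sboxP.
      have [gf|gf] := eqVneq g f; first by rewrite -Np -gf.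
      have := hf g; rewrite (negbTE gf) card_I0 => E.
      by move: sg; rewrite E.
    have : (N w `&` sbox f) p by rewrite Np.
    move=> [Np' /sboxP[h1 h2]]; split=> //; apply/stripP; split=> //.
    exact: scell_spbox h1.
  have [tau E] := YlocP Zw.
  have : (N w `&` sbox f) p by rewrite Np.
  move=> [Np' /sboxP[h1 h2]].
  have : (N w `&` strip) p.
    by split=> //; apply/stripP; split=> //; exact: scell_spbox h1.
  by rewrite E => pE; move: h1; rewrite pE.
have Zw : Z1 w by apply: contrapT => /Yloc_out; apply; exact: scell_spbox fY.
have [tau E] := YlocP Zw.
have [NY /stripP[_ YT]] : (N w `&` strip) (Yloc w, tau) by rewrite E.
have sub g p : (N w `&` sbox g) p -> p = (Yloc w, tau) :> stpt R d.
  move=> [Np /sboxP[h1 h2]]; have : (N w `&` strip) p.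
    by split=> //; apply/stripP; split=> //; exact: scell_spbox h1.
  by rewrite E.
move=> g; have [->|gf] := eqVneq g f.
  apply/card_I1; exists (Yloc w, tau); apply/seteqP; split=> [p /sub//|_ ->].
  by split=> //; apply/sboxP.
apply/card_I0; rewrite -subset0 => p Np.
have pE := sub _ _ _ Np; case: Np => _ /sboxP[gp _].
by move: gp gf; rewrite pE => /(gcell_inj ws fY) ->; rewrite eqxx.
Qed.

(* Pairs (configuration, location): only the configuration up to time [r],
   through the emptiness of dyadic cells, is recorded. *)
Definition OP := (Omega * pt R d)%type.
HB.instance Definition _ := Choice.copy OP (Omega * pt R d)%type.
HB.instance Definition _ := isPointed.Build OP (point, diag 0).

(** [setT] supplies the total mass, and [set0] accounts for spatial cells that do not meet. *)
Definition psys : set (set OP) := [set C | C = setT \/ C = set0 \/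
  exists n (J : {set ixp n}) (f : ixs n), C = Vd J `*` [set y | scell f y]].

(** The coarser void event is rewritten at the finer level, where void events intersect by union of
    cells; two dyadic spatial cells are nested or disjoint. *)
Lemma psys_setI : setI_closed psys.
Proof.
have H n m (J : {set ixp n}) (f : ixs n) (J' : {set ixp m}) (f' : ixs m) :
    (n <= m)%N ->
    psys ((Vd J `*` [set y | scell f y]) `&` (Vd J' `*` [set y | scell f' y])).
  move=> nm; rewrite -setXI (Vd_refine J nm) Vd_setU.
  have [ff'|ff'] := boolP (subcell f f').
    have -> : [set y | scell f y] `&` [set y | scell f' y] = [set y | scell f' y].
      by apply/setIidr => y /= fy; apply/(subcellP ws f nm fy).
    by right; right; exists m, (refine m J :|: J')%SET, f'.
  right; left; rewrite (_ : [set y | scell f y] `&` _ = set0) ?setX0//.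
  rewrite -subset0 => y [/= fy f'y]; move: ff'.
  by have /(subcellP ws f nm f'y) -> := fy.
move=> A B [->|[->|[n [J [f ->]]]]]; first by rewrite setTI.
  by rewrite set0I; right; left.
move=> [->|[->|[m [J' [f' ->]]]]]; first by rewrite setIT; right; right; exists n, J, f.
  by rewrite setI0; right; left.
by have [nm|/ltnW mn] := leqP n m; [exact: H|rewrite setIC; exact: H].
Qed.

Definition hist := g_sigma_algebraType psys.

Lemma hist_id_measurable :
  measurable_fun [set: (Omega * pt R d)%type] (fun z => z : hist).
Proof.
apply: (@measurability _ _ _ hist _ _ psys) => //.
move=> _ [C hC <-]; rewrite setTI preimage_id.
case: hC => [->|[->|[n [J [f ->]]]]] //.
by apply: measurableX; [exact: Vd_measurable|exact: scell_measurable].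
Qed.

Definition loc (w : Omega) : hist := (w, Yloc w).

Lemma loc_measurable : measurable_fun setT loc.
Proof.
apply: (@measurability _ _ _ hist _ _ psys) => //.
move=> _ [C hC <-]; rewrite setTI.
case: hC => [->|[->|[n [J [f ->]]]]] //; first by rewrite preimage_setT.
  by rewrite preimage_set0.
have -> : loc @^-1` (Vd J `*` [set y | scell f y]) = Vd J `&` strip1 f.
  by apply/seteqP; split=> w [h1 h2]; split=> //; exact/strip1P.
exact: (joint_prob J f).1.
Qed.

Let Z1_lty : (P Z1 < +oo)%E. Proof. by rewrite Z1_prob ltry. Qed.
Let PZ : {finite_measure set Omega -> \bar R} := mfrestr Z1_measurable Z1_lty.
Let PZT : (PZ setT < +oo)%E.
Proof. exact: fin_num_fun_lty. Qed.
Let nu1 : {finite_measure set hist -> \bar R} := pushfin loc_measurable PZT.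

Let PmuE A B : measurable A -> measurable B ->
  ((P \x mu) (A `*` B) = P A * mu B)%E.
Proof. exact: product_measure1E. Qed.

Lemma muT : mu setT = lam%:E. Proof. by case: hmu => _ _ ->. Qed.

Let PmuT : ((P \x mu) setT < +oo)%E.
Proof. by rewrite -setXTT PmuE// muT probability_setT mul1e ltry. Qed.

Let nu2 : {finite_measure set hist -> \bar R} := pushfin hist_id_measurable PmuT.

Lemma rate1_ge0 : 0 <= rate1.
Proof. by rewrite mulr_ge0 ?expR_ge0// ltW. Qed.

Let nu2s : {measure set hist -> \bar R} := mscale (NngNum rate1_ge0) nu2.

(** The two finite measures agree on the generating pi-system: on its rectangles this is
    [joint_prob], on [setT] it is the probability of a single point. *)
Let nu12 (A : set hist) : measurable A -> nu1 A = nu2s A.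
Proof.
have psysm : psys `<=` (measurable : set (set hist)) by exact: sub_sigma_algebra.
have U := @g_sigma_algebra_measure_unique _ R hist psys psysm (fun=> setT).
apply: (U _ _ nu1 nu2s).
- by move=> _; left.
- by apply/seteqP; split=> // z _; exists 0%N.
- exact: psys_setI.
- move=> C hC.
  have E1 : nu1 C = P (loc @^-1` C `&` Z1) by [].
  have E2 : nu2s C = (rate1%:E * (P \x mu) C)%E by [].
  rewrite [LHS]E1 [RHS]E2.
  case: hC => [->|[->|[n [J [f ->]]]]].
  + rewrite preimage_setT setTI Z1_prob -setXTT PmuE// probability_setT mul1e muT.
    by rewrite EFinM.
  + by rewrite preimage_set0 set0I !measure0 mule0.
  + have -> : loc @^-1` (Vd J `*` [set y | scell f y]) `&` Z1 = Vd J `&` strip1 f.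
      apply/seteqP; split=> w.
        by move=> [[h1 /= h2] _]; split=> //; exact/strip1P.
      move=> [h1 /strip1P h2]; split; first by split.
      by apply: contrapT => /Yloc_out; apply; exact: scell_spbox h2.
    rewrite (joint_prob J f).2 PmuE//; [|exact: Vd_measurable|exact: scell_measurable].
    by rewrite scell_vol EFinM muleCA.
- by move=> _; exact: fin_num_fun_lty.
Qed.

(** As F vanishes off the box, P may be restricted to [Z1]; the law of [loc] is then [rate1] times
    the product measure on the sigma-field of [hist]. *)
Lemma strip_mecke (F : hist -> R) (C : R) : measurable_fun setT F ->
  (forall z, `|F z| <= C) -> (forall w y, ~ spbox L y -> F (w, y) = 0) ->
  (\int[P]_w (F (loc w))%:E = rate1%:E * \int[P \x mu]_z (F z)%:E)%E.
Proof.
move=> mF FC F0.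
have mFE : measurable_fun [set: hist] (EFin \o F) by exact/measurable_EFinP.
have F0' w : ~ Z1 w -> (F (loc w))%:E = 0%E.
  by move=> /Yloc_out hw; congr EFin; exact: F0.
transitivity (\int[PZ]_w (F (loc w))%:E)%E.
  have E w : ((fun w => (F (loc w))%:E) \_ Z1) w = (F (loc w))%:E.
    rewrite patchE; case: ifPn => // /negP hw; apply/esym/F0' => hw'.
    by apply: hw; rewrite inE.
  transitivity (\int[P]_(w in Z1) (F (loc w))%:E)%E.
    by rewrite [RHS]integral_mkcond; apply: eq_integral => w _; rewrite E.
  transitivity (\int[PZ]_(w in Z1) (F (loc w))%:E)%E; last first.
    by rewrite [LHS]integral_mkcond; apply: eq_integral => w _; rewrite E.
  apply: eq_measure_integral => A mA AZ.
  by transitivity (P (A `&` Z1)) => //; rewrite setIidl.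
transitivity (\int[nu1]_z (F z)%:E)%E.
  rewrite /nu1 /pushfin integral_pushforward//; first exact: loc_measurable.
  have mFl : measurable_fun setT (F \o loc).
    by apply: measurableT_comp => //; exact: loc_measurable.
  exact: (bounded_integrable PZT mFl (fun w => FC (loc w))).
transitivity (\int[nu2s]_z (F z)%:E)%E.
  by apply: eq_measure_integral => A mA _; exact: nu12.
have int2 : nu2.-integrable setT (EFin \o F).
  by apply: (@bounded_integrable _ _ _ nu2 F C) => //; exact: fin_num_fun_lty.
transitivity (rate1%:E * \int[nu2]_z (F z)%:E)%E.
  rewrite integralE [X in (_ * X)%E]integralE muleBr//; last first.
    by rewrite fin_num_adde_defl// fin_numN; exact: integrable_neg_fin_num.
  congr (_ - _)%E; rewrite ge0_integral_mscale//.
    exact: measurable_funepos.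
  exact: measurable_funeneg.
congr (_ * _)%E; rewrite /nu2 /pushfin integral_pushforward//.
- exact: hist_id_measurable.
- have mFi : measurable_fun setT (F \o (fun z : Omega * pt R d => z : hist)).
    by apply: measurableT_comp => //; exact: hist_id_measurable.
  exact: (bounded_integrable PmuT mFi (fun z => FC z)).
Qed.

End strip.

Definition evtl (Q : nat -> Prop) := exists n0 : nat, forall n, (n0 <= n)%N -> Q n.

Lemma evtl_and (Q Q' : nat -> Prop) : evtl Q -> evtl Q' -> evtl (fun n => Q n /\ Q' n).
Proof.
move=> [n0 h0] [n1 h1]; exists (maxn n0 n1) => n; rewrite geq_max => /andP[a b].
by split; [exact: h0|exact: h1].
Qed.

Lemma evtl_fin (I : finType) (Q : I -> nat -> Prop) :
  (forall i, evtl (Q i)) -> evtl (fun n => forall i, Q i n).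
Proof.
move=> /fin_all_exists[n0 h0]; exists (\max_i n0 i)%N => n hn i.
by apply: h0; apply: leq_trans hn; exact: leq_bigmax.
Qed.

Lemma evtl_seq (I : eqType) (c : seq I) (Q : I -> nat -> Prop) :
  (forall i, i \in c -> evtl (Q i)) -> evtl (fun n => forall i, i \in c -> Q i n).
Proof.
elim: c => [|i c IH] hQ; first by exists 0%N.
have [n0 h0] := evtl_and (hQ i (mem_head _ _))
  (IH (fun j jc => hQ j (mem_behead (s := i :: c) jc))).
exists n0 => n /h0[hi hc] j; rewrite inE => /orP[/eqP -> //|]; exact: hc.
Qed.

(** * Heights as measurable functions of the past *)

Section history.
Context {R : realType} {d : nat} {dO : measure_display} {Omega : measurableType dO}.
Variable N : Omega -> set (stpt R d).
Variables (L r T : R) (s : state R d).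
Hypotheses (L0 : 0 < L) (r0 : 0 < r) (rT : r <= T).
Hypothesis hs : in_Sigma s.
Hypothesis fin : forall w, finite_set (trunc (N w) L T).

Local Notation ixp n := {ffun option 'I_d -> 'I_(2 ^ n)}.
Local Notation ixs n := {ffun 'I_d -> 'I_(2 ^ n)}.
Local Notation hist := (hist N L r).
Local Notation pcell := (pcell L r).
Local Notation scell := (scell L).

Let w2 : 0 < 2 * L. Proof. by rewrite mulr_gt0. Qed.
Let wp (o : option 'I_d) : 0 < widths (2 * L) r o. Proof. by case: o. Qed.
Let ws (o : 'I_d) : 0 < 2 * L. Proof. exact: w2. Qed.
Let rs : regular_state s. Proof. exact: in_Sigma_regular. Qed.

Definition sig (t : R) (w : Omega) : state R d := height (trunc (N w) L T) s t.

Lemma sig_Sigma t w : in_Sigma (sig t w).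
Proof. exact: height_finite_Sigma. Qed.

(** The remainder only makes the index total; it changes nothing for points of the box. *)
Definition pix n (p : stpt R d) : ixp n :=
  [ffun o => Ordinal (ltn_pmod (pidx (- L) (2 * L) r n p o) (expn_gt0 2 n))].
Definition six n (y : pt R d) : ixs n :=
  [ffun i => Ordinal (ltn_pmod (idx1 (- L) (2 * L) n (tnth y i)) (expn_gt0 2 n))].

Local Notation inb := (inbig (- L) (2 * L) r).

Lemma pixE n p o : inb p -> pix n p o = pidx (- L) (2 * L) r n p o :> nat.
Proof. by move=> hp; rewrite ffunE /= modn_small// idx1_lt. Qed.

Lemma pix_cell n p : inb p -> pcell (pix n p) p.
Proof. by move=> hp; apply/gcellP => // o; rewrite pixE. Qed.

Lemma sixE n y i : spbox L y -> six n y i = idx1 (- L) (2 * L) n (tnth y i) :> nat.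
Proof.
move=> /spboxE hy; rewrite ffunE /= modn_small//.
exact: (idx1_lt n w2 (hy i)).
Qed.

Lemma six_cell n y : spbox L y -> scell (six n y) y.
Proof. by move=> hy; apply/gcellP; [|exact/spboxE|move=> i; rewrite sixE]. Qed.

Definition clt n (f g : ixp n) := [forall o, (f o < g o)%N].
Definition slt n (f : ixp n) (g : ixs n) := [forall i, (f (Some i) < g i)%N].
Definition start n (F : seq (ixp n)) (g : ixs n) : pt R d :=
  if F is f :: _ then [tuple gridpt (- L) (2 * L) n (f (Some i)) | i < d]
  else [tuple gridpt (- L) (2 * L) n (g i) | i < d].

Definition nonvoid n (f : ixp n) w := exists p, N w p /\ pcell f p.

(** A certificate for reaching v strictly below any point of the cell [g]: an increasing chain [F]
    of past cells, all spatially before [g], started at the lower corner of its first cell. The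
    configuration enters only through the occupation of [F]. *)
Definition code n (F : seq (ixp n)) (g : ixs n) (v : int) :=
  [/\ sorted (@clt n) F, forall f, f \in F -> slt f g &
      (v%:~R%:E <= s (start F g) + (size F)%:R%:E)%E].

Lemma clt_trans n : transitive (@clt n).
Proof.
move=> f2 f1 f3 /forallP h1 /forallP h2; apply/forallP => o.
exact: ltn_trans (h1 o) (h2 o).
Qed.

(** One point chosen in each occupied cell makes a chain, since the indices increase on every axis;
    its points lie strictly above [start F g] and strictly below y. *)
Lemma code_sound n (F : seq (ixp n)) g v w y : code F g v -> scell g y ->
  (forall f, f \in F -> nonvoid f w) ->
  exists2 z, tlt z y & (v%:~R%:E <= sig r w z)%E.
Proof.
move=> [so sg hv] gy hF; have hy := scell_spbox L0 gy.
have [pp hpp] : exists pp : ixp n -> stpt R d, forall f, f \in F ->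
    N w (pp f) /\ pcell f (pp f).
  have H f : exists p, f \in F -> N w p /\ pcell f p.
    have [fF|fF] := boolP (f \in F); last by exists (diag 0, 0).
    by have [p hp] := hF _ fF; exists p.
  by have [pp hpp] := fin_all_exists H; exists pp.
have ppI f : f \in F -> inb (pp f).
  by move=> /hpp[_ /(gcell_inside wp)].
have ppE f o : f \in F -> pidx (- L) (2 * L) r n (pp f) o = f o.
  by move=> fF; apply: (gcellP wp f (ppI f fF)).1; case: (hpp f fF).
pose c := [seq pp f | f <- F].
have lty f : f \in F -> tlt (pp f).1 y.
  move=> fF i; have /forallP/(_ i) := sg _ fF.
  rewrite -(ppE f (Some i) fF).
  have /spboxE/(_ i)/andP[yi _] := hy.
  have <- : idx1 (- L) (2 * L) n (tnth y i) = g i.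
    by apply: (gcellP ws g _).1 => //; exact/spboxE.
  by move=> /(idx1_lt_lt w2 yi).
have startp f : f \in F -> tlt (start F g) (pp f).1.
  case: F so {sg hv hF hpp ppI c lty} ppE (ppI) (hpp) => [//|f1 F] so ppE ppI' hpp' fF i /=.
  rewrite tnth_mktuple.
  have ffo : (f1 (Some i) <= f (Some i))%N.
    move: fF; rewrite inE => /orP[/eqP->//|fF].
    move: so; rewrite sorted_pairwise; last exact: clt_trans.
    by move=> /= /andP[/allP/(_ f fF)/forallP/(_ (Some i))/ltnW].
  have /andP[pi _] := ppI' f fF (Some i).
  by rewrite gridpt_idx1//; have := ppE f (Some i) fF; rewrite /pidx/= => ->.
have chc x : (forall f, f \in F -> tle (pp f).1 x) ->
    chain (trunc (N w) L T) r (start F g) x c.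
  move=> hx; split.
    move=> _ /mapP[f fF ->]; have [Np _] := hpp f fF.
    have pI := ppI f fF.
    have /andP[p0 pr] : 0 < (pp f).2 <= r by have := pI None; rewrite /= add0r.
    split; last by split; [exact: startp|split; [exact: hx|rewrite p0]].
    split=> //; split; last by rewrite p0 (le_trans pr).
    by apply/spboxE => i; exact: (pI (Some i)).
  rewrite sorted_map.
  have H : {in [pred f | f \in F] &, subrel (@clt n) (relpre pp stltb)}.
    move=> f f' fF f'F /forallP ff'; apply: (@sepb_stltb _ _ (- L) (2 * L) r w2 r0 n).
    - exact: ppI.
    - exact: ppI.
    - by apply/forallP => o; rewrite !ppE.
  by apply: (sub_in_sorted H) => //; apply/allP.
case: (altP (F =P [::])) => [F0|F0].
  exists (start F g).
    move=> i; rewrite F0 /= tnth_mktuple.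
    by have /andP[] := gy i.
  apply/(height_geP _ _ _ _ rs); exists (start F g), [::].
  by split; [exact: tle_refl|exact: chain_nil|move: hv; rewrite F0].
have : chain (trunc (N w) L T) r (start F g) y c.
  by apply: chc => f fF; exact: tltW (lty f fF).
move=> /chain_top[z [sz cz zE]]; exists z.
  case: zE => [->|[_ /mapP[f fF ->] ->]]; last exact: lty.
  case: (F) F0 startp lty => [//|f1 F'] _ startp lty.
  apply: tlt_tle_trans (tltW (lty f1 (mem_head _ _))).
  exact: startp (mem_head _ _).
apply/(height_geP _ _ _ _ rs); exists (start F g), c; split=> //.
  by apply: chc => f fF; apply: cz; apply: map_f.
by rewrite size_map.
Qed.

(** At a fine level the points of the chain fall into strictly increasing cells before that of y,
    which is possible because z < y is strict. *)
Lemma code_complete v w y : spbox L y ->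
  (exists2 z, tlt z y & (v%:~R%:E <= sig r w z)%E) ->
  exists n (F : seq (ixp n)) (g : ixs n),
  [/\ code F g v, scell g y & forall f, f \in F -> nonvoid f w].
Proof.
move=> hy [z zy /(height_geP _ _ _ _ rs)[y0 [c [y0z ch hv]]]].
have cI p : p \in c -> inb p.
  move=> /(proj1 ch)[[_ [/spboxE pb _]] [_ [_ pr]]] [i|]; first exact: pb.
  by rewrite /= add0r.
have pb p : p \in c -> spbox L p.1 by move=> /(proj1 ch)[[_ []]].
have py p : p \in c -> tlt p.1 y.
  by move=> /(proj1 ch)[_ [_ [pz _]]]; exact: tle_tlt_trans pz zy.
have [n0 hn0] := sorted_sepb_ex w2 r0 cI (proj2 ch).
have e1 : evtl (fun n => sorted (sepb (- L) (2 * L) r n) c).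
  by exists n0 => n nn; exact: (sorted_sepb_mono w2 r0 nn cI hn0).
have e2 : evtl (fun n => forall p, p \in c -> forall i,
    (idx1 (- L) (2 * L) n (tnth p.1 i) < idx1 (- L) (2 * L) n (tnth y i))%N).
  apply: evtl_seq => p pc; apply: evtl_fin => i.
  have /andP[pi _] := pb p pc i.
  by have [n1 h1] := idx1_sep w2 pi (py p pc i); exists n1.
have y0y : tlt y0 y by exact: tle_tlt_trans y0z zy.
have e3 : evtl (fun n => forall i,
    tnth y0 i <= gridpt (- L) (2 * L) n (idx1 (- L) (2 * L) n (tnth y i))).
  apply: evtl_fin => i; have /andP[yi _] := hy i.
  by have [n1 h1] := idx1_low w2 yi (y0y i); exists n1.
(* The true start lies below the corner used by [start], so moving there can only raise the initial
   value; [e3] serves the empty chain, [e4] the others. *)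
have e4 : evtl (fun n => forall p, p \in c -> forall i,
    tnth y0 i <= gridpt (- L) (2 * L) n (idx1 (- L) (2 * L) n (tnth p.1 i))).
  apply: evtl_seq => p pc; apply: evtl_fin => i.
  have /andP[pi _] := pb p pc i.
  have [_ [y0p _]] := proj1 ch _ pc.
  by have [n1 h1] := idx1_low w2 pi (y0p i); exists n1.
have [n /(_ n (leqnn n))[[h1 h2] [h3 h4]]] := evtl_and (evtl_and e1 e2) (evtl_and e3 e4).
exists n, [seq pix n p | p <- c], (six n y); split.
- split.
  + rewrite sorted_map.
    have H : {in [pred p | p \in c] &, subrel (sepb (- L) (2 * L) r n) (relpre (pix n) (@clt n))}.
      move=> p p' pc p'c /forallP pp'; apply/forallP => o.
      by rewrite !pixE; [exact: pp'|exact: cI|exact: cI].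
    by apply: (sub_in_sorted H) => //; apply/allP.
  + move=> _ /mapP[p pc ->]; apply/forallP => i.
    by rewrite pixE ?sixE//; [exact: h2|exact: cI].
  + rewrite size_map; apply: (le_trans hv); rewrite leeD2r//.
    case: rs => _; apply => i; rewrite /start.
    case: (c) h4 cI => [|p c'] h4 cI' /=; rewrite tnth_mktuple.
      by rewrite sixE.
    by rewrite pixE; [exact: h4 (mem_head _ _) i|exact: cI' (mem_head _ _)].
- exact: six_cell.
- move=> _ /mapP[p pc ->]; exists p; split; last exact/pix_cell/cI.
  by have [[]] := proj1 ch _ pc.
Qed.

(** The location is confined to the box because the generating rectangles resolve nothing outside
    it. *)
Definition Hset (Q : Omega -> pt R d -> Prop) : set hist :=
  [set z | spbox L z.2 /\ Q z.1 z.2].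

Lemma measurable_base n (J : {set ixp n}) (g : ixs n) :
  measurable (Vd N L r J `*` [set y | scell g y] : set hist).
Proof. by apply: sub_sigma_algebra; right; right; exists n, J, g. Qed.

Lemma Vd0 n : Vd N L r (finset.set0 : {set ixp n}) = setT.
Proof. by apply/seteqP; split=> // w _ p _ [f]; rewrite inE. Qed.

(** Occupation of f over the cell g is the rectangle with no void constraint minus the one with f
    void. *)
Lemma measurable_code n (F : seq (ixp n)) (g : ixs n) :
  measurable [set z : hist | scell g z.2 /\ forall f, f \in F -> nonvoid f z.1].
Proof.
elim: F => [|f F IH].
  have := measurable_base finset.set0 g; rewrite Vd0; congr measurable.
  by apply/seteqP; split=> z; [move=> [_ h]; split|move=> [h _]; split].
rewrite (_ : [set z : hist | _] = ((Vd N L r (finset.set0 : {set ixp n}) `*` [set y | scell g y])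
  `\` (Vd N L r [set f]%SET `*` [set y | scell g y])) `&`
  [set z : hist | scell g z.2 /\ forall f, f \in F -> nonvoid f z.1]).
  by apply: measurableI => //; apply: measurableD; exact: measurable_base.
rewrite Vd0; apply/seteqP; split=> z.
  move=> [gz hF]; split; last by split=> // f' f'F; apply: hF; rewrite inE f'F orbT.
  split; first by split.
  move=> [hV _]; have [p [Np fp]] := hF f (mem_head _ _).
  by apply: (hV p Np); exists f => //; rewrite inE.
move=> [[_ hn] [gz hF]]; split=> // f'; rewrite inE => /orP[/eqP->|]; last exact: hF.
apply: contrapT => hf; apply: hn; split=> // p Np [f0]; rewrite inE => /eqP -> fp.
by apply: hf; exists p.
Qed.

Lemma measurable_spbox_code n (F : seq (ixp n)) :
  measurable (Hset (fun w _ => forall f, f \in F -> nonvoid f w)).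
Proof.
rewrite (_ : Hset _ = \bigcup_(g in [set: ixs n])
    [set z : hist | scell g z.2 /\ forall f, f \in F -> nonvoid f z.1]).
  apply: countable_bigcupT_measurable; first exact: countableP.
  by move=> g; exact: measurable_code.
apply/seteqP; split=> z.
  by move=> [hz hF]; exists (six n z.2) => //; split=> //; exact: six_cell.
by move=> [g _ [gz hF]]; split=> //; exact: scell_spbox gz.
Qed.

(** A union over the countably many codes, each of which concerns finitely many occupied cells. *)
Lemma measurable_left v :
  measurable (Hset (fun w y => exists2 z, tlt z y & (v%:~R%:E <= sig r w z)%E)).
Proof.
rewrite (_ : Hset _ = \bigcup_n \bigcup_(u in [set: seq (ixp n) * ixs n])
    (if `[< code u.1 u.2 v >] then
       [set z : hist | scell u.2 z.2 /\ forall f, f \in u.1 -> nonvoid f z.1]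
     else set0)).
  apply: bigcup_measurable => n _.
  apply: countable_bigcupT_measurable; first exact: countableP.
  by move=> u; case: ifP => // _; exact: measurable_code.
apply/seteqP; split=> z.
  move=> [hz /(code_complete hz)[n [F [g [hc gz hF]]]]].
  by exists n => //; exists (F, g) => //; rewrite asboolT.
move=> [n _ [[F g] _ /=]]; case: asboolP => // hc [gz hF].
by split; [exact: scell_spbox gz|exact: code_sound hc gz hF].
Qed.

Lemma measurable_left_at v (x : pt R d) : spbox L x ->
  measurable (Hset (fun w _ => exists2 z, tlt z x & (v%:~R%:E <= sig r w z)%E)).
Proof.
move=> hx.
rewrite (_ : Hset _ = \bigcup_n \bigcup_(u in [set: seq (ixp n) * ixs n])
    (if `[< code u.1 u.2 v /\ scell u.2 x >] then
       Hset (fun w _ => forall f, f \in u.1 -> nonvoid f w)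
     else set0)).
  apply: bigcup_measurable => n _.
  apply: countable_bigcupT_measurable; first exact: countableP.
  by move=> u; case: ifP => // _; exact: measurable_spbox_code.
apply/seteqP; split=> z.
  move=> [hz /(code_complete hx)[n [F [g [hc gz hF]]]]].
  by exists n => //; exists (F, g) => //; rewrite asboolT.
move=> [n _ [[F g] _ /=]]; case: asboolP => // -[hc gx] [hz hF].
by split=> //; exact: code_sound hc gx hF.
Qed.

Variable q : R.
Hypothesis qL : q + 1 <= L.

(* The height is right-continuous, hence determined by its left limits at the
   points x + 1/(j+1). *)
Lemma measurable_at v (x : pt R d) : cube q x ->
  measurable (Hset (fun w _ => (v%:~R%:E <= sig r w x)%E)).
Proof.
move=> qx; pose xi (j : nat) : pt R d := [tuple tnth x i + (j.+1%:R)^-1 | i < d].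
have j1 (j : nat) : 0 < (j.+1%:R^-1 : R) <= 1.
  by rewrite invr_gt0 ltr0n/= invf_le1 ?ler1n ?ltr0n.
have xib j : spbox L (xi j).
  move=> i; rewrite tnth_mktuple; have := qx i; have := j1 j.
  have := qL; move: (j.+1%:R^-1 : R) (tnth x i) => a b h1 /andP[h2 h3] /andP[h4 h5].
  by apply/andP; split; lra.
rewrite (_ : Hset _ = \bigcap_j Hset (fun w _ =>
    exists2 z, tlt z (xi j) & (v%:~R%:E <= sig r w z)%E)).
  by apply: bigcapT_measurable => j; exact: measurable_left_at.
apply/seteqP; split=> z.
  move=> [hz hv] j _; split=> //; exists x => // i.
  by rewrite tnth_mktuple ltrDl; case/andP: (j1 j).
move=> hz; have [sz _] := hz 0%N I; split=> //.
have [e e0 he] := Sigma_right_const x (sig_Sigma r z.1).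
pose j := Num.trunc (e^-1).
have je : (j.+1%:R)^-1 < e.
  rewrite invf_plt ?posrE//; exact: truncnS_gt.
rewrite -(he (xi j)).
- have [_ [z0 zx hv]] := hz j I; apply: (le_trans hv).
  by apply: height_mono => //; exact: tltW.
- by move=> i; rewrite tnth_mktuple lerDl ltW//; case/andP: (j1 j).
- by move=> i; rewrite tnth_mktuple ltrD2l.
Qed.

Lemma measurable_below (x : pt R d) : cube q x -> measurable (Hset (fun _ y => tle y x)).
Proof.
move=> qx.
rewrite (_ : Hset _ = \bigcap_n \bigcup_(g in [set: ixs n])
   (if [forall i, (g i <= idx1 (- L) (2 * L) n (tnth x i))%N] then
     [set z : hist | scell g z.2 /\ forall f : ixp n, f \in [::] -> nonvoid f z.1]
    else set0)).
  apply: bigcapT_measurable => n; apply: countable_bigcupT_measurable; first exact: countableP.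
  by move=> g; case: ifP => // _; exact: measurable_code.
have xi i : - L < tnth x i by have /andP[? _] := qx i; have := qL; lra.
apply/seteqP; split=> z.
  move=> [hz zx] n _; exists (six n z.2) => //.
  rewrite ifT; first by split=> //; exact: six_cell.
  apply/forallP => i; rewrite sixE//; have /andP[zi _] := hz i.
  exact: idx1_le.
move=> hz; have hz' n : exists2 g : ixs n, scell g z.2 &
    forall i, (g i <= idx1 (- L) (2 * L) n (tnth x i))%N.
  by have [g _] := hz n I; case: ifPn => // /forallP hg [gz _]; exists g.
have sz : spbox L z.2 by have [g gz _] := hz' 0%N; exact: scell_spbox gz.
split=> // i; have /andP[zi _] := sz i.
apply/(idx1_approx_le w2 zi (xi i)) => n; have [g gz hg] := hz' n.
have -> : idx1 (- L) (2 * L) n (tnth z.2 i) = g i; last exact: hg.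
by apply: (gcellP ws g _).1 => //; exact/spboxE.
Qed.

Lemma measurable_spboxH : measurable (Hset (fun _ _ => True)).
Proof.
have := @measurable_spbox_code 0 [::]; congr measurable.
by apply/seteqP; split=> z -[h _].
Qed.

(** The past up to r with one more point at y; r + 1 is a conventional later time, chosen because
    only the location matters. *)
Definition conf w (y : pt R d) : set (stpt R d) :=
  [set p | trunc (N w) L r p \/ p = (y, r + 1)].

(** Off the box both [stnew] and [stold] default to s, which keeps them in Sigma and makes their
    difference vanish there. *)
Definition stnew (z : hist) : state R d :=
  if `[< spbox L z.2 >] then height (conf z.1 z.2) s (r + 1) else s.
Definition stold (z : hist) : state R d :=
  if `[< spbox L z.2 >] then sig r z.1 else s.

Lemma conf_finite w y : finite_set (conf w y).
Proof.
apply: (@sub_finite_set _ _ (trunc (N w) L T `|` [set (y, r + 1)])).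
  move=> p [[Np [pb /andP[p1 p2]]]|->]; [left|by right].
  by do 2 split=> //; rewrite p1 (le_trans p2).
by rewrite finite_setU; split.
Qed.

Lemma stnew_Sigma z : in_Sigma (stnew z).
Proof.
rewrite /stnew; case: ifP => // _; apply: height_finite_Sigma => //.
exact: conf_finite.
Qed.

Lemma stold_Sigma z : in_Sigma (stold z).
Proof. by rewrite /stold; case: ifP => // _; exact: sig_Sigma. Qed.

Lemma conf_geP w y x (v : int) :
  (v%:~R%:E <= height (conf w y) s (r + 1) x)%E <->
  (v%:~R%:E <= sig r w x)%E \/
  (tle y x /\ exists2 z, tlt z y & ((v - 1)%:~R%:E <= sig r w z)%E).
Proof.
apply: height_add_point => //; first by rewrite lerDl.
  exact: ltW.
split.
  move=> p pr; split.
    by move=> [Np [pb /andP[p1 p2]]]; left; do 2 split=> //; rewrite p1.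
  case=> [[Np [pb /andP[p1 p2]]]|pE]; first by do 2 split=> //; rewrite p1 (le_trans p2).
  by move: pr; rewrite pE /= gerDl ler10.
exists (r + 1); split; first by rewrite ltrDl ltr01 lexx.
move=> p /andP[pr _]; split; last by right.
by case=> // -[_ [_ /andP[_ p2]]]; have := lt_le_trans pr p2; rewrite ltxx.
Qed.

Lemma stnew_measurable x (v : int) : cube q x ->
  measurable [set z : hist | (v%:~R%:E <= stnew z x)%E].
Proof.
move=> qx.
rewrite (_ : [set z | _] = (Hset (fun w _ => (v%:~R%:E <= sig r w x)%E) `|`
   (Hset (fun _ y => tle y x) `&`
    Hset (fun w y => exists2 z, tlt z y & ((v - 1)%:~R%:E <= sig r w z)%E))) `|`
   (~` Hset (fun _ _ => True) `&` [set _ | (v%:~R%:E <= s x)%E])).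
  apply: measurableU.
    apply: measurableU; first exact: measurable_at.
    by apply: measurableI; [exact: measurable_below|exact: measurable_left].
  apply: measurableI; first by apply: measurableC; exact: measurable_spboxH.
  by case: (v%:~R%:E <= s x)%E; [rewrite (_ : [set _ | _] = setT)|
    rewrite (_ : [set _ | _] = set0)] => //; apply/seteqP; split.
apply/seteqP; split=> z.
  rewrite /= /stnew; case: asboolP => hz.
    by move=> /conf_geP[h|[h1 h2]]; left; [left|right].
  by move=> h; right; split=> // -[].
rewrite /= /stnew; case=> [[[hz h]|[[hz h] [_ h']]]|[hz h]].
- by rewrite asboolT//; apply/conf_geP; left.
- by rewrite asboolT//; apply/conf_geP; right.
- by rewrite asboolF// => hz'; apply: hz; split.
Qed.

Lemma stold_measurable x (v : int) : cube q x ->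
  measurable [set z : hist | (v%:~R%:E <= stold z x)%E].
Proof.
move=> qx.
rewrite (_ : [set z | _] = Hset (fun w _ => (v%:~R%:E <= sig r w x)%E) `|`
   (~` Hset (fun _ _ => True) `&` [set _ | (v%:~R%:E <= s x)%E])).
  apply: measurableU; first exact: measurable_at.
  apply: measurableI; first by apply: measurableC; exact: measurable_spboxH.
  by case: (v%:~R%:E <= s x)%E; [rewrite (_ : [set _ | _] = setT)|
    rewrite (_ : [set _ | _] = set0)] => //; apply/seteqP; split.
apply/seteqP; split=> z; rewrite /= /stold.
  case: asboolP => hz h; first by left.
  by right; split=> // -[].
case=> [[hz h]|[hz h]]; first by rewrite asboolT.
by rewrite asboolF// => hz'; apply: hz; split.
Qed.

End history.

(** * The truncated process *)


Section increments.
Context {R : realType}.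
Local Notation mu := (@lebesgue_measure R).

Lemma lipschitz_continuous (K : R) (f : R -> R) :
  (forall x y, `|f x - f y| <= K * `|x - y|) -> continuous f.
Proof.
move=> fK x; apply/cvgrPdist_lt => e e0.
have K0 : 0 < `|K| + 1 by rewrite ltr_wpDl.
near=> y.
apply: (le_lt_trans (fK x y)); apply: (@le_lt_trans _ _ ((`|K| + 1) * `|x - y|)).
  by apply: ler_wpM2r => //; apply: (le_trans (ler_norm K)); rewrite lerDl.
rewrite mulrC -ltr_pdivlMr//; near: y.
by apply: (@cvgr_dist_lt _ _ _ (nbhs x) _ id) => //; rewrite divr_gt0.
Unshelve. all: by end_near. Qed.

(** Composing with the clamp [c] onto [0, t] extends G to a Lipschitz, hence continuous, function on
    the line. *)
Lemma lipschitz_itv_measurable (K t : R) (G : R -> R) : 0 < t ->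
  (forall a b : R, 0 <= a -> a <= b -> b <= t -> `|G b - G a| <= K * (b - a)) ->
  measurable_fun (`[0, t]%classic : set (measurableTypeR R)) G.
Proof.
move=> t0 GK.
have K0 : 0 <= K.
  have := GK 0 t (lexx _) (ltW t0) (lexx _); rewrite subr0 => h.
  by rewrite -(pmulr_lge0 _ t0) (le_trans _ h).
pose c (x : R) : R := if x <= 0 then 0 else if t <= x then t else x.
have c0 x : 0 <= c x.
  by rewrite /c; case: (leP x 0) => // x0; case: (leP t x) => _; exact: ltW.
have ct x : c x <= t.
  by rewrite /c; case: (leP x 0) => _; [exact: ltW|case: (leP t x) => // /ltW].
have cc x y : x <= y -> c x <= c y /\ c y - c x <= y - x.
  move=> xy; rewrite /c; case: (leP x 0) => x0; case: (leP y 0) => y0;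
   do ?[case: (leP t x) => tx]; do ?[case: (leP t y) => ty]; by split; lra.
have GcK x y : `|G (c x) - G (c y)| <= K * `|x - y|.
  have [xy|/ltW xy] := leP x y.
    have [h1 h2] := cc _ _ xy.
    rewrite distrC [X in K * X]distrC (ger0_norm (_ : 0 <= y - x)) ?subr_ge0//.
    by apply: (le_trans (GK _ _ _ _ _)) => //; exact: ler_wpM2l.
  have [h1 h2] := cc _ _ xy.
  rewrite (ger0_norm (_ : 0 <= x - y)) ?subr_ge0//.
  by apply: (le_trans (GK _ _ _ _ _)) => //; exact: ler_wpM2l.
have mc : measurable_fun setT (G \o c : measurableTypeR R -> R).
  by apply: continuous_measurable_fun; exact: (lipschitz_continuous GcK).
apply: (@eq_measurable_fun _ _ (measurableTypeR R) _ _ (G \o c)).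
  move=> x; rewrite inE/= in_itv/= => /andP[x0 xt].
  rewrite /= /c; case: (leP x 0) => x1.
    by congr G; apply/eqP; rewrite eq_le x0 x1.
  by case: (leP t x) => // tx; congr G; apply/eqP; rewrite eq_le xt tx.
exact: measurable_funS mc.
Qed.

(** The difference D of u and the integral of G has increments of second order, so cutting [0, t]
    into n+1 pieces bounds D t - D 0 by a constant over n+1. *)
Lemma integral_from_increments (K t : R) (u G : R -> R) : 0 < t -> 0 <= K ->
  (forall a b : R, 0 <= a -> a <= b -> b <= t -> `|G b - G a| <= K * (b - a)) ->
  (forall a : R, 0 <= a -> a <= t -> `|G a| <= K) ->
  (forall a b : R, 0 < a -> a <= b -> b <= t ->
     `|u b - u a - (b - a) * G a| <= K * (b - a) ^+ 2) ->
  (forall b : R, 0 <= b -> b <= t -> `|u b - u 0| <= K * b) ->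
  ((u t - u 0)%:E = \int[mu]_(x in `[0%R, t]) (G x)%:E)%E.
Proof.
move=> t0 K0 GL GK uG u0K.
have mG := lipschitz_itv_measurable t0 GL.
have fin (i : interval R) : (exists a b : R, i = `]a, b] \/ i = `[a, b]) -> (mu [set` i] < +oo)%E.
  move=> [a [b iE]]; rewrite lebesgue_measure_itv; case: iE => -> /=;
    by case: ifP => _; rewrite ?ltry// EFinN -EFinB ltry.
have bd (a b : R) : 0 <= a -> a <= b -> b <= t ->
    mu.-integrable `]a, b]%classic (EFin \o (G : measurableTypeR R -> R)).
  move=> a0 ab bt; apply: measurable_bounded_integrable => //.
  - by apply: fin; exists a, b; left.
  - apply: measurable_funS mG => // x; rewrite /= !in_itv/= => /andP[ax xb].
    by rewrite (le_trans a0 (ltW ax)) (le_trans xb bt).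
  - exists K; split; first exact: num_real.
    move=> x Kx y; rewrite /= in_itv/= => /andP[ay yb].
    by rewrite (le_trans (GK _ _ _))// ?(ltW Kx)// ?(le_trans a0 (ltW ay))// (le_trans yb bt).
have bd0 (b : R) : 0 <= b -> b <= t ->
    mu.-integrable `[0, b]%classic (EFin \o (G : measurableTypeR R -> R)).
  move=> b0 bt; apply: measurable_bounded_integrable => //.
  - by apply: fin; exists 0, b; right.
  - apply: measurable_funS mG => // x; rewrite /= !in_itv/= => /andP[ax xb].
    by rewrite ax (le_trans xb bt).
  - exists K; split; first exact: num_real.
    move=> x Kx y; rewrite /= in_itv/= => /andP[ay yb].
    by rewrite (le_trans (GK _ _ _))// ?(ltW Kx)// (le_trans yb bt).
have cst (a b c : R) : 0 <= a -> a <= b -> 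
    mu.-integrable `]a, b]%classic (EFin \o (cst c : measurableTypeR R -> R)) /\
    (\int[mu]_(x in `]a, b]) c = c * (b - a))%R.
  move=> a0 ab; have mi : (mu `]a, b]%classic = (b - a)%:E)%E.
    rewrite lebesgue_measure_itv /= lte_fin; case: ltP => // ba.
    by rewrite (_ : a = b) ?subrr//; apply/eqP; rewrite eq_le ab ba.
  split; last by rewrite Rintegral_cst//; congr (_ * _); have /(congr1 fine) := mi.
  apply: measurable_bounded_integrable => //; first by apply: fin; exists a, b; left.
  exists `|c|; split; first exact: num_real.
  by move=> x cx y _; exact: ltW.
pose J (x : R) : R := (\int[mu]_(y in `[0%R, x]) G y)%R.
have JB (a b : R) : 0 <= a -> a <= b -> b <= t ->
    J b - J a = (\int[mu]_(x in `]a, b]) G x)%R.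
  move=> a0 ab bt; rewrite /J Rintegral_itvB//.
  by apply: bd0 => //; exact: le_trans ab.
have J1 (a b : R) : 0 <= a -> a <= b -> b <= t -> `|J b - J a - (b - a) * G a| <= K * (b - a) ^+ 2.
  move=> a0 ab bt; rewrite JB//.
  have [ia iE] := cst a b (K * (b - a)) a0 ab.
  have [ic ica] := cst a b (G a) a0 ab.
  rewrite expr2 mulrA -iE [(b - a) * _]mulrC -ica -RintegralB//; last exact: bd.
  have iB : mu.-integrable `]a, b]%classic (EFin \o (fun x : measurableTypeR R => G x - G a)).
    have -> : EFin \o (fun x : measurableTypeR R => G x - G a) =
        ((EFin \o (G : measurableTypeR R -> R)) \- (EFin \o (functions.cst (G a) : measurableTypeR R -> R)))%E.
      by [].
    by apply: integrableB => //; exact: bd.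
  apply: (le_trans (le_normr_Rintegral _ _)) => //.
  apply: le_Rintegral => //; first exact: (integrable_norm iB).
  move=> x; rewrite /= in_itv/= => /andP[ax xb].
  apply: (le_trans (GL _ _ _ (ltW ax) _)) => //; first exact: le_trans bt.
  by apply: ler_wpM2l => //; rewrite lerB.
pose D x := u x - J x.
have D1 (a b : R) : 0 < a -> a <= b -> b <= t -> `|D b - D a| <= 2 * K * (b - a) ^+ 2.
  move=> a0 ab bt.
  have -> : D b - D a = (u b - u a - (b - a) * G a) - (J b - J a - (b - a) * G a).
    by rewrite /D; ring.
  have h1 := uG _ _ a0 ab bt; have h2 := J1 _ _ (ltW a0) ab bt.
  by apply: (le_trans (ler_normB _ _)); lra.
have J0 : J 0 = 0.
  by rewrite /J set_itv1 Rintegral_set1.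
(* The quadratic estimate is available only away from time 0, so the first piece gets a linear one:
   K b from u, K b from b * G 0, and K b^2 <= K t b from J. *)
have D0 (b : R) : 0 <= b -> b <= t -> `|D b - D 0| <= K * (2 + t) * b.
  move=> b0 bt.
  have -> : D b - D 0 = (u b - u 0) - (J b - J 0 - (b - 0) * G 0) - b * G 0.
    by rewrite /D; ring.
  have h1 := u0K _ b0 bt; have h2 := J1 0 b (lexx _) b0 bt.
  have h3 : `|b * G 0| <= K * b.
    by rewrite normrM (ger0_norm b0) mulrC; apply: ler_wpM2r => //; exact: GK (ltW t0).
  have h4 : K * (b - 0) ^+ 2 <= K * t * b.
    by rewrite subr0 expr2 mulrA ler_wpM2r// ler_wpM2l.
  apply: (le_trans (ler_normB _ _)); apply: (le_trans (lerD (ler_normB _ _) (lexx _))).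
  lra.
have Dn (n k : nat) : (k <= n)%N ->
    `|D (k.+1%:R * (t / n.+1%:R)) - D 0| <=
      K * (2 + t) * (t / n.+1%:R) + k%:R * (2 * K * (t / n.+1%:R) ^+ 2).
  have n0 : 0 < t / n.+1%:R :> R by rewrite divr_gt0// ltr0n.
  have kt (j : nat) : (j <= n.+1)%N -> j%:R * (t / n.+1%:R) <= t.
    move=> jn; rewrite mulrCA ger_pMr// ler_pdivrMr ?ltr0n// mul1r ler_nat//.
  elim: k => [_|k IH kn].
    rewrite mul0r addr0 mul1r; apply: D0; first exact: ltW.
    by have := kt 1%N isT; rewrite mul1r.
  have -> : D (k.+2%:R * (t / n.+1%:R)) - D 0 = (D (k.+1%:R * (t / n.+1%:R)) - D 0) +
     (D (k.+2%:R * (t / n.+1%:R)) - D (k.+1%:R * (t / n.+1%:R))) by ring.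
  apply: (le_trans (ler_normD _ _)).
  rewrite -[leRHS](_ : K * (2 + t) * (t / n.+1%:R) + k%:R * (2 * K * (t / n.+1%:R) ^+ 2) +
    2 * K * (t / n.+1%:R) ^+ 2 = _); last by rewrite -natr1; ring.
  apply: lerD; first exact/IH/ltnW.
  have E : k.+2%:R * (t / n.+1%:R) - k.+1%:R * (t / n.+1%:R) = t / n.+1%:R :> R.
    by rewrite -mulrBl -natrB// subSnn mul1r.
  rewrite -[X in X ^+ 2]E; apply: D1.
  - by rewrite mulr_gt0// ltr0n.
  - by rewrite ler_pM2r// ler_nat.
  - exact: kt.
have Dt (n : nat) : `|D t - D 0| <= (K * (2 + t) * t + 2 * K * t ^+ 2) / n.+1%:R.
  have := Dn n n (leqnn _).
  have nz : n.+1%:R != 0 :> R by rewrite pnatr_eq0.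
  have -> : n.+1%:R * (t / n.+1%:R) = t :> R by rewrite mulrCA divff ?mulr1.
  move/le_trans; apply.
  rewrite [leRHS]mulrDl [X in X + _ <= _]mulrA lerD2l expr_div_n.
  have -> : n%:R * (2 * K * (t ^+ 2 / n.+1%:R ^+ 2)) = (n%:R / n.+1%:R) * (2 * K * t ^+ 2 / n.+1%:R) :> R.
    by move: (n.+1%:R : R) nz => m m0; field.
  rewrite ler_piMl//; last by rewrite ler_pdivrMr ?ltr0n// mul1r ler_nat.
  by rewrite divr_ge0// !mulr_ge0// ltW.
have DD : D t = D 0.
  apply/eqP; rewrite -subr_eq0 -normr_le0; apply/ler_addgt0Pl => e e0; rewrite addr0.
  set c := (K * _ * _ + _) in Dt.
  have [n hn] : exists n : nat, c / e < n.+1%:R.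
    by exists (Num.trunc (c / e)); exact: truncnS_gt.
  apply: (le_trans (Dt n)); rewrite ler_pdivrMr ?ltr0n// mulrC -ler_pdivrMr//; exact: ltW.
have -> : u t - u 0 = J t.
  by have := DD; rewrite /D J0 => h; lra.
rewrite /J /Rintegral fineK//.
exact: integrable_fin_num (bd0 t (ltW t0) (lexx _)).
Qed.

End increments.

Lemma prob_Rintegral_le {dO : measure_display} {Omega : measurableType dO}
    {R : realType} (P : probability Omega R) (f : Omega -> R) (C p : R) (A : set Omega) :
  measurable_fun setT f -> measurable A -> (forall w, `|f w| <= C) ->
  (forall w, A w -> f w = 0) -> ((1 - p)%:E <= P A)%E ->
  `|(\int[P]_w f w)%R| <= C * p.
Proof.
move=> mf mA fC fA pA.
have PT : (P setT < +oo)%E by rewrite probability_setT ltry.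
have C0 : 0 <= C by apply: le_trans (fC point).
have int_f := bounded_integrable PT mf fC.
have mg : measurable_fun setT (fun w => C * \1_(~` A) w).
  by apply: measurable_funM => //; apply: measurable_indic; exact: measurableC.
have int_g : P.-integrable setT (EFin \o (fun w => C * \1_(~` A) w)).
  apply: (bounded_integrable (C := C) PT mg) => w.
  by rewrite normrM (ger0_norm C0) indicE ler_piMr// ger0_norm// lern1 leq_b1.
apply: (le_trans (le_normr_Rintegral _ _)) => //.
apply: (@le_trans _ _ (\int[P]_w (C * \1_(~` A) w))%R).
  apply: le_Rintegral => //; first exact: (integrable_norm int_f).
  move=> w _; rewrite indicE; have [Aw|Aw] := pselect (A w).
    by rewrite fA// normr0 mulr_ge0.
  by rewrite mem_set// mulr1.
have mAc : measurable (~` A) by exact: measurableC.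
have -> : (\int[P]_w (C * \1_(~` A) w))%R = C * fine (P (~` A)).
  rewrite RintegralZl//; last first.
    apply: (bounded_integrable (C := 1) PT); first exact: measurable_indic.
    by move=> w; rewrite indicE ger0_norm// lern1 leq_b1.
  by congr (_ * _); rewrite /Rintegral integral_indic// setIT.
apply: ler_wpM2l => //; rewrite probability_setC//.
have PA : P A \is a fin_num by rewrite fin_num_measure.
move: pA; rewrite -(fineK PA) lee_fin => pA.
by rewrite /= lerBlDr -lerBlDl.
Qed.

(** * Measurability of the shift in its location *)

Section shift_measurable.
Context {R : realType} {d : nat}.

Lemma rat_tuple_between (y : pt R d) (e : R) : 0 < e ->
  exists u : d.-tuple rat, forall i, tnth y i < ratr (tnth u i) < tnth y i + e.
Proof.
move=> e0.
have H i : exists u : rat, tnth y i < ratr u < tnth y i + e.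
  have [u] := @rat_in_itvoo R (tnth y i) (tnth y i + e) (ltr_pwDr e0 (lexx _)).
  by rewrite in_itv; exists u.
have [u hu] := fin_all_exists H.
by exists [tuple u i | i < d] => i; rewrite tnth_mktuple.
Qed.

Lemma measurable_tle (x : pt R d) : measurable [set y : pt R d | tle y x].
Proof.
rewrite (_ : [set y | _] = \bigcap_(i in [set: 'I_d]) [set y : pt R d | tnth y i <= tnth x i]).
  apply: fin_bigcap_measurable => // i _.
  rewrite (_ : [set y | _] = setT `&` (fun y : pt R d => tnth y i) @^-1` `]-oo, tnth x i]%classic).
    by apply: measurable_tnth => //; exact: measurable_itv.
  by apply/seteqP; split=> y /=; rewrite in_itv/=; [split|case].
by apply/seteqP; split=> y /= h => [i _|i]; [exact: h|exact: h].
Qed.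

(* Right continuity makes a sublevel set a countable union of lower orthants. *)
Lemma measurable_state_ge (s : state R d) (v : int) : in_Sigma s ->
  measurable [set y : pt R d | (v%:~R%:E <= s y)%E].
Proof.
move=> hs; rewrite -[X in measurable X]setCK; apply: measurableC.
pose U (u : d.-tuple rat) : pt R d := [tuple ratr (tnth u i) | i < d].
rewrite (_ : ~` _ = \bigcup_(u in [set: d.-tuple rat])
   (if (v%:~R%:E <= s (U u))%E then set0 else [set y : pt R d | tle y (U u)])).
  apply: countable_bigcupT_measurable; first exact: countableP.
  by move=> u; case: ifP => // _; exact: measurable_tle.
have [_ mono] := in_Sigma_regular hs.
apply/seteqP; split=> y.
  move=> /= nv; have [e e0 he] := Sigma_right_const y hs.
  have [u hu] := rat_tuple_between y e0; exists u => //.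
  have -> : s (U u) = s y.
    by apply: he => i; rewrite tnth_mktuple; have /andP[/ltW] := hu i.
  case: ifP => [/nv//|_] i; rewrite tnth_mktuple.
  by have /andP[/ltW] := hu i.
move=> [u _]; case: ifPn => // nv yu /= vy; move/negP : nv; apply.
exact: le_trans vy (mono _ _ yu).
Qed.

Variables (q : R) (phi : state R d -> R).
Hypothesis phi_meas : supported_measurable q phi.

Lemma shift_measurable (s : state R d) : in_Sigma s ->
  measurable_fun setT (fun y : pt R d => phi (Defs.shift s y)).
Proof.
move=> hs; apply: (supported_measurable_comp phi_meas (X := Defs.shift s)).
  by move=> y; exact: shift_Sigma.
move=> x v _; have rs := in_Sigma_regular hs.
rewrite (_ : [set y | _] = [set _ | (v%:~R%:E <= s x)%E] `|`
   ([set y : pt R d | tle y x] `&` [set y | ((v - 1)%:~R%:E <= s y)%E])).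
  apply: measurableU.
    by case: (v%:~R%:E <= s x)%E; [rewrite (_ : [set _ | _] = setT)|
      rewrite (_ : [set _ | _] = set0)] => //; apply/seteqP; split.
  by apply: measurableI; [exact: measurable_tle|exact: measurable_state_ge].
by apply/seteqP; split=> y /=; move/(shift_geP _ _ _ rs).
Qed.

End shift_measurable.

(** * Mean evolution over a short time *)

Section one_step.
Context {R : realType} {d : nat} {dO : measure_display} {Omega : measurableType dO}.
Variables (P : probability Omega R) (N : Omega -> set (stpt R d)).
Hypothesis HN : is_rate1_PPP P N.
Hypothesis d0 : (0 < d)%N.
Variables (L T : R) (s : state R d) (q C : R) (phi : state R d -> R).
Hypotheses (L0 : 0 < L) (hs : in_Sigma s).
Hypothesis fin : forall w, finite_set (trunc (N w) L T).
Hypothesis qL : q + 1 <= L.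
Hypothesis phi_bdd : forall s, in_Sigma s -> `|phi s| <= C.
Hypothesis phi_meas : supported_measurable q phi.
Variable mu : {finite_measure set (pt R d) -> \bar R}.
Hypothesis hmu : cube_measure L mu.

Local Notation S := (sig N L T s).
Local Notation lamL := (@lam R d L).

Let SS t w : in_Sigma (S t w). Proof. exact: sig_Sigma. Qed.
Let PT : (P setT < +oo)%E. Proof. by rewrite probability_setT ltry. Qed.
Let muT' : (mu setT < +oo)%E. Proof. by rewrite (muT hmu) ltry. Qed.
Let C0 : 0 <= C. Proof. exact: le_trans (normr_ge0 _) (phi_bdd hs). Qed.
Let lam0 : 0 <= lamL. Proof. by rewrite exprn_ge0// mulr_ge0// ltW. Qed.

Lemma sig0 w : S 0 w = s.
Proof. by apply/funext => x; rewrite /sig /height lexx. Qed.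

(** The height at time t is read off [stold] along the section at the origin, a point of the box.
    The cells of [hist] need t > 0; at t = 0 the state is s. *)
Lemma phi_sig_measurable (t : R) : 0 <= t -> t <= T ->
  measurable_fun setT (fun w => phi (S t w)).
Proof.
rewrite le_eqVlt => /predU1P[<- _|t0 tT].
  rewrite (_ : (fun w => _) = cst (phi s)); first exact: measurable_cst.
  by apply/funext => w; rewrite sig0.
apply: (supported_measurable_comp phi_meas (X := S t)) => // x v qx.
have m0 : measurable_fun setT (fun w : Omega => (w, diag 0) : hist N L t).
  apply: (measurableT_comp (hist_id_measurable HN L0 t0)).
  by apply: measurable_fun_pair; [exact: measurable_id|exact: measurable_cst].
rewrite (_ : [set w | _] = setT `&` (fun w : Omega => (w, diag 0) : hist N L t) @^-1`
    [set z | (v%:~R%:E <= stold T s z x)%E]).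
  by apply: m0 => //; exact: (stold_measurable _ _ _ _ fin qL).
have sp0 : spbox L (diag 0 : pt R d).
  by move=> i; rewrite tnth_mktuple oppr_lt0 L0 ltW.
by apply/seteqP; split=> w /=; rewrite /stold asboolT// => -[].
Qed.

Definition incr (st : state R d) (y : pt R d) : R := phi (Defs.shift st y) - phi st.
Definition inner t w : R := (\int[mu]_y incr (S t w) y)%R.
Definition meanphi t : R := (\int[P]_w phi (S t w))%R.
Definition meangen t : R := (\int[P]_w inner t w)%R.

Lemma incr_le st y : in_Sigma st -> `|incr st y| <= 2 * C.
Proof.
move=> hst; apply: (le_trans (ler_normB _ _)); rewrite mulr2n mulrDl mul1r.
by apply: lerD; apply: phi_bdd => //; exact: shift_Sigma.
Qed.

Lemma incr_measurable st : in_Sigma st -> measurable_fun setT (incr st).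
Proof.
move=> hst; apply: measurable_funB; last exact: measurable_cst.
exact: (shift_measurable phi_meas hst).
Qed.

Lemma incr_integrable st : in_Sigma st -> mu.-integrable setT (EFin \o incr st).
Proof.
move=> hst; apply: (bounded_integrable muT' (incr_measurable hst)) => y.
exact: incr_le.
Qed.

Lemma inner_le t w : `|inner t w| <= 2 * C * lamL.
Proof.
have i1 := incr_integrable (SS t w).
apply: (le_trans (le_normr_Rintegral _ i1)) => //.
have E : (\int[mu]_y (2 * C))%R = 2 * C * lamL.
  by rewrite Rintegral_cst//; congr (_ * _); have /(congr1 fine) := muT hmu.
rewrite -E; apply: le_Rintegral => //; first exact: (integrable_norm i1).
  apply: (bounded_integrable (C := 2 * C) muT'); first exact: measurable_cst.
  by move=> _; rewrite ger0_norm// mulr_ge0.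
by move=> y _; exact: incr_le.
Qed.

Lemma inner0 w : inner 0 w = (\int[mu]_y incr s y)%R.
Proof. by rewrite /inner sig0. Qed.

Section positive_time.
Variable r : R.
Hypotheses (r0 : 0 < r) (rT : r <= T).

(** Equal to [incr] for almost every location, but measurable for [hist], which is the form that
    [strip_mecke] accepts. *)
Definition jump (z : hist N L r) : R := phi (stnew s z) - phi (stold T s z).

Lemma jump_measurable : measurable_fun setT jump.
Proof.
apply: measurable_funB.
  apply: (supported_measurable_comp phi_meas (X := @stnew _ _ _ _ N L r s)).
    by move=> z; exact: (stnew_Sigma rT hs fin).
  by move=> x v qx; exact: (stnew_measurable L0 r0 rT hs fin qL).
apply: (supported_measurable_comp phi_meas (X := @stold _ _ _ _ N L r T s)).
  by move=> z; exact: (stold_Sigma hs fin).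
by move=> x v qx; exact: (stold_measurable L0 r0 rT hs fin qL).
Qed.

Lemma jump_le z : `|jump z| <= 2 * C.
Proof.
apply: (le_trans (ler_normB _ _)); rewrite mulr2n mulrDl mul1r.
by apply: lerD; apply: phi_bdd; [exact: (stnew_Sigma rT hs fin)|exact: (stold_Sigma hs fin)].
Qed.

Lemma jump_out w y : ~ spbox L y -> jump (w, y) = 0.
Proof. by move=> hy; rewrite /jump /stnew /stold !asboolF//= subrr. Qed.

Lemma jump_prod_measurable :
  measurable_fun [set: (Omega * pt R d)%type] (fun z => jump z).
Proof. exact: (measurableT_comp jump_measurable (hist_id_measurable HN L0 r0)). Qed.

Lemma jump_section_measurable w : measurable_fun [set: pt R d] (fun y => jump (w, y)).
Proof. exact: (measurableT_comp jump_prod_measurable (pair1_measurable w)). Qed.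

Lemma spbox_box : [set y : pt R d | spbox L y] = box (diag (- L)) (diag L).
Proof. by apply/seteqP; split=> y hy i; have := hy i; rewrite !tnth_mktuple. Qed.

Lemma spbox_ae : mu (~` [set y | spbox L y]) = 0%E.
Proof.
have [_ hb hT _] := hmu.
have mb : measurable [set y : pt R d | spbox L y] by rewrite spbox_box; exact: measurable_box.
have muE : mu [set y : pt R d | spbox L y] = lamL%:E.
  rewrite spbox_box hb.
  - congr EFin; rewrite (eq_bigr (fun=> 2 * L)); last by move=> i _; rewrite !tnth_mktuple; ring.
    by rewrite big_const_ord iter_mulr_1.
  - by move=> i; rewrite !tnth_mktuple; have := L0; lra.
  - by move=> i; rewrite !tnth_mktuple.
have := measureD (mu := mu) measurableT mb muT'.
rewrite setTD setTI => ->.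
transitivity (lamL%:E - lamL%:E)%E; last by rewrite subee.
by rewrite -{2}muE; congr (_ - _)%E; exact: hT.
Qed.

(* Almost surely a fresh point avoids the discontinuity hyperplanes of the
   current state, and then adding it acts as the shift. *)
Lemma jump_incr w : ae_eq mu setT (fun y => (jump (w, y))%:E) (fun y => (incr (S r w) y)%:E).
Proof.
have [D hD] := Sigma_left_const (SS r w) (ltr_wpDl (ltW L0) ltr01 : 0 < L + 1).
have [_ _ _ h0] := hmu.
have H1 : {ae mu, forall y, spbox L y}.
  exists (~` [set y | spbox L y]); split=> //; last exact: spbox_ae.
  by rewrite spbox_box; apply: measurableC; exact: measurable_box.
have H2 : {ae mu, forall y, forall u : 'I_d * 'I_(size D), tnth y u.1 <> D`_(u.2)}.
  apply: filter_forall => u; exists [set y : pt R d | tnth y u.1 = D`_(u.2)].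
  split; [exact: measurable_hyperplane|exact: h0|].
  by move=> y /= /contrapT.
apply: filterS2 H1 H2 => y yb yD _; congr EFin.
rewrite /jump /incr /stnew /stold !asboolT//=; congr (phi _ - _).
apply/funext => x.
have [z zy zE] : exists2 z, tlt z y & S r w z = S r w y.
  apply: hD => i; first by have := yb i; have := L0; move=> ? /andP[? ?]; apply/andP; split; lra.
  by apply/negP => /(nthP 0)[k kD yk]; apply: (yD (i, Ordinal kD)).
have rS := in_Sigma_regular (SS r w).
apply: Zstar_ext.
- by apply: Zstar_height; exact: in_Sigma_regular.
- exact: Zstar_shift.
have H v := @conf_geP _ _ _ _ N L r T s r0 rT hs w y x v.
move=> v; split.
  move=> /H[h|[yx [z' z'y h]]]; apply/(shift_geP _ _ _ rS); first by left.
  right; split=> //; apply: (le_trans h); case: rS => _; apply; exact: tltW.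
move=> /(shift_geP _ _ _ rS)[h|[yx h]]; apply/H; first by left.
by right; split=> //; exists z => //; rewrite zE.
Qed.

Lemma jump_integrable :
  (P \x mu)%E.-integrable [set: (Omega * pt R d)%type] (fun z => (jump z)%:E).
Proof.
apply: (bounded_integrable _ jump_prod_measurable); last exact: jump_le.
have E A B : measurable A -> measurable B -> ((P \x mu) (A `*` B) = P A * mu B)%E.
  exact: product_measure1E.
have : ((P \x mu) setT < +oo)%E; last by [].
by rewrite -setXTT E// (muT hmu) probability_setT mul1e ltry.
Qed.

Lemma inner_jump w : ((inner r w)%:E = \int[mu]_y (jump (w, y))%:E)%E.
Proof.
rewrite /inner /Rintegral fineK; last exact: integrable_fin_num (incr_integrable (SS r w)).
apply/esym; apply: ae_eq_integral => //.
- by apply/measurable_EFinP; exact: jump_section_measurable.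
- by apply/measurable_EFinP; exact: incr_measurable.
- exact: jump_incr.
Qed.

Lemma inner_measurable_pos : measurable_fun setT (inner r).
Proof.
apply/measurable_EFinP.
rewrite (_ : EFin \o inner r = fubini_F mu (fun z : Omega * pt R d => (jump z)%:E)).
  exact: measurable_fubini_F jump_integrable.
by apply/funext => w; rewrite /= inner_jump.
Qed.

Lemma meangen_jump : ((meangen r)%:E = \int[P \x mu]_z (jump z)%:E)%E.
Proof.
rewrite -(integral12_prod_meas1 jump_integrable) /meangen /Rintegral fineK.
  by apply: eq_integral => w _; rewrite inner_jump.
have i : P.-integrable setT (EFin \o inner r).
  by apply: (bounded_integrable PT inner_measurable_pos) => w; exact: inner_le.
exact: integrable_fin_num i.
Qed.

End positive_time.

Lemma inner_measurable (t : R) : 0 <= t -> t <= T -> measurable_fun setT (inner t).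
Proof.
rewrite le_eqVlt => /predU1P[<- _|]; last exact: inner_measurable_pos.
rewrite (_ : inner 0 = cst (\int[mu]_y incr s y)%R); first exact: measurable_cst.
by apply/funext => w; rewrite inner0.
Qed.

Lemma sig_void (r h : R) w : 0 <= r -> 0 < h -> r + h <= T ->
  N w `&` strip L r h = set0 -> S (r + h) w = S r w.
Proof.
move=> r0 h0 rhT hN; apply/funext => x; have rs := in_Sigma_regular hs.
apply: height_ext => // v; split=> /(height_geP _ _ _ _ rs)[y [c [yx [ch1 ch2] hv]]];
  apply/(height_geP _ _ _ _ rs); exists y, c; split=> //; split=> // p pc;
  have [Np [? [? /andP[p0 pt]]]] := ch1 _ pc; (do 3 split=> //); rewrite p0/=.
- rewrite leNgt; apply/negP => rp.
  have : (N w `&` strip L r h) p.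
    by case: Np => ? [? _]; split=> //; apply/stripP; rewrite rp.
  by rewrite hN.
- by apply: (le_trans pt); rewrite lerDl ltW.
Qed.

(** The true arrival time and the conventional one in [conf] lead to the same thresholds, by
    [height_add_point] on both sides. *)
Lemma jump_loc (r h : R) w : 0 < r -> 0 < h -> r + h <= T ->
  Z1 N L r h w -> jump (loc N L r h w) = phi (S (r + h) w) - phi (S r w).
Proof.
move=> r0 h0 rhT Zw; have rs := in_Sigma_regular hs.
have rT : r <= T by apply: le_trans rhT; rewrite lerDl ltW.
have [tau E] := YlocP Zw.
have [NY /stripP[/= Yb Yt]] : (N w `&` strip L r h) (Yloc N L r h w, tau) by rewrite E.
rewrite /jump /stnew /stold !asboolT//=; congr (phi _ - _).
apply/funext => x; apply: Zstar_ext; [exact: Zstar_height|exact: Zstar_height|].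
move=> v.
have rrh : r <= r + h by rewrite lerDl ltW.
have ap : add_points (trunc (N w) L T) (trunc (N w) L T) r (r + h) (Yloc N L r h w).
  split=> //; exists tau; split=> // p /andP[rp prh]; split.
    move=> [Np [pb _]]; have : (N w `&` strip L r h) p.
      by split=> //; apply/stripP; rewrite rp.
    by rewrite E.
  move=> ->; split=> //; split=> //=.
  by case/andP: Yt => ? ?; rewrite (lt_trans r0)//= (le_trans _ rhT).
have H1 := @conf_geP _ _ _ _ N L r T s r0 rT hs w (Yloc N L r h w) x v.
have H2 := @height_add_point _ _ _ _ s r (r + h) _ x v rs rrh (ltW r0) ap.
by split=> [/H1/H2|/H2/H1].
Qed.

Lemma void_prob (r h : R) : 0 <= r -> 0 < h ->
  let A := [set w | N w `&` strip L r h = set0] in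
  measurable A /\ ((1 - lamL * h)%:E <= P A)%E.
Proof.
move=> r0 h0 A; have [mA PA] := strip_count HN L0 r0 h0 0.
have E : [set w | (N w `&` strip L r h #= `I_0)%card] = A.
  by apply/seteqP; split=> w; rewrite /A/= card_I0.
rewrite E in mA PA; split=> //; rewrite PA lee_fin /poisson_prob_at expr0 fact0 divr1 mulr1.
exact: expR_ge1Dx.
Qed.

Lemma void_one_prob (r h : R) : 0 < r -> 0 < h ->
  let A := [set w | N w `&` strip L r h = set0] `|` Z1 N L r h in
  measurable A /\ ((1 - (lamL * h) ^+ 2)%:E <= P A)%E.
Proof.
move=> r0 h0 A; have [m0 P0] := strip_count HN L0 (ltW r0) h0 0.
have [m1 P1] := strip_count HN L0 (ltW r0) h0 1.
have E : [set w | (N w `&` strip L r h #= `I_0)%card] = [set w | N w `&` strip L r h = set0].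
  by apply/seteqP; split=> w; rewrite /= card_I0.
rewrite E in m0 P0; split; first exact: measurableU.
have -> : P A = (P [set w | N w `&` strip L r h = set0] + P (Z1 N L r h))%E.
  apply: measureU => //; rewrite -subset0 => w [/= h1 /card_I1[p h2]].
  by have : set0 p by rewrite -h1 h2.
rewrite P0 [P (Z1 _ _ _ _)]P1 -EFinD lee_fin /poisson_prob_at expr0 fact0 expr1.
have -> : 1`!%:R = 1 :> R by [].
have := @expR_ge1Dx R (- (lamL * h)).
have : 0 <= lamL * h by rewrite mulr_ge0// ltW.
move: (lamL * h) (expR _) => x e x0 xe; rewrite !divr1 mulr1 expr2.
(* The probability of at most one point is e^(-x) (1 + x), and e^(-x) >= 1 - x turns it into at
   least 1 - x^2. *)
have : (1 - x) * (1 + x) <= e * (1 + x) by apply: ler_wpM2r => //; lra.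
lra.
Qed.

Lemma phi_sig_integrable (t : R) : 0 <= t -> t <= T ->
  P.-integrable setT (EFin \o (fun w => phi (S t w))).
Proof.
move=> t0 tT; apply: (bounded_integrable PT (phi_sig_measurable t0 tT)) => w.
exact: phi_bdd.
Qed.

Lemma inner_integrable (t : R) : 0 <= t -> t <= T ->
  P.-integrable setT (EFin \o inner t).
Proof.
move=> t0 tT; apply: (bounded_integrable PT (inner_measurable t0 tT)) => w.
exact: inner_le.
Qed.

Lemma meanphi_lip (r h : R) : 0 <= r -> 0 < h -> r + h <= T ->
  `|meanphi (r + h) - meanphi r| <= 2 * C * (lamL * h).
Proof.
move=> r0 h0 rhT; have [mA PA] := void_prob r0 h0.
have rT : r <= T by apply: le_trans rhT; rewrite lerDl ltW.
have rh0 : 0 <= r + h by rewrite addr_ge0// ltW.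
rewrite /meanphi -RintegralB//; [|exact: phi_sig_integrable|exact: phi_sig_integrable].
apply: (prob_Rintegral_le _ mA _ _ PA).
- by apply: measurable_funB; exact: phi_sig_measurable.
- move=> w; apply: (le_trans (ler_normB _ _)); rewrite mulr2n mulrDl mul1r.
  by apply: lerD; exact: phi_bdd.
- by move=> w /= hw; rewrite sig_void// subrr.
Qed.

Lemma meangen_lip (r h : R) : 0 <= r -> 0 < h -> r + h <= T ->
  `|meangen (r + h) - meangen r| <= 4 * C * lamL * (lamL * h).
Proof.
move=> r0 h0 rhT; have [mA PA] := void_prob r0 h0.
have rT : r <= T by apply: le_trans rhT; rewrite lerDl ltW.
have rh0 : 0 <= r + h by rewrite addr_ge0// ltW.
rewrite /meangen -RintegralB//; [|exact: inner_integrable|exact: inner_integrable].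
apply: (prob_Rintegral_le _ mA _ _ PA).
- by apply: measurable_funB; exact: inner_measurable.
- move=> w; apply: (le_trans (ler_normB _ _)).
  rewrite (_ : 4 * C * lamL = 2 * C * lamL + 2 * C * lamL); last by ring.
  by apply: lerD; exact: inner_le.
- by move=> w /= hw; rewrite /inner sig_void// subrr.
Qed.

Lemma meangen_le (r : R) : 0 <= r -> r <= T -> `|meangen r| <= 2 * C * lamL.
Proof.
move=> r0 rT.
have := @prob_Rintegral_le _ _ _ P (inner r) (2 * C * lamL) 1 set0.
rewrite mulr1; apply=> //; first exact: inner_measurable.
  exact: inner_le.
by rewrite subrr.
Qed.

(* The chance of two points in the strip is of order [h ^ 2]; with exactly one
   point the Mecke formula gives the generator. *)
Lemma meanphi_step (r h : R) : 0 < r -> 0 < h -> r + h <= T ->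
  `|meanphi (r + h) - meanphi r - h * meangen r| <= 6 * C * lamL ^+ 2 * h ^+ 2.
Proof.
move=> r0 h0 rhT; have [mA PA] := void_one_prob r0 h0.
have rT : r <= T by apply: le_trans rhT; rewrite lerDl ltW.
have rh0 : 0 <= r + h by rewrite addr_ge0// ltW.
have mj : measurable_fun setT (fun w => jump (loc N L r h w)).
  exact: (measurableT_comp (jump_measurable r0 rT) (loc_measurable HN d0 L0 r0 h0)).
have ij : P.-integrable setT (EFin \o (fun w => jump (loc N L r h w))).
  by apply: (bounded_integrable PT mj) => w; exact: jump_le.
have iphi : P.-integrable setT (EFin \o (fun w => phi (S (r + h) w) - phi (S r w))).
  apply: (bounded_integrable (C := C + C) PT).
    by apply: measurable_funB; apply: phi_sig_measurable => //; exact: ltW.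
  by move=> w; apply: (le_trans (ler_normB _ _)); apply: lerD; exact: phi_bdd.
have Ej : (\int[P]_w jump (loc N L r h w))%R = @rate1 R d L h * meangen r.
  apply: EFin_inj; rewrite /Rintegral fineK; last exact: integrable_fin_num ij.
  rewrite (strip_mecke HN d0 L0 r0 h0 hmu (jump_measurable r0 rT) (jump_le rT)).
    by rewrite -(meangen_jump r0 rT) -EFinM.
  by move=> w y; exact: jump_out.
have H : `|meanphi (r + h) - meanphi r - @rate1 R d L h * meangen r| <= 4 * C * (lamL * h) ^+ 2.
  rewrite -Ej /meanphi -RintegralB//; [|exact: phi_sig_integrable|
    by apply: phi_sig_integrable => //; exact: ltW].
  rewrite -RintegralB//.
  apply: (prob_Rintegral_le _ mA _ _ PA).
  - apply: measurable_funB => //.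
    by apply: measurable_funB; apply: phi_sig_measurable => //; exact: ltW.
  - move=> w; apply: (le_trans (ler_normB _ _)).
    rewrite (_ : 4 * C = (C + C) + 2 * C); last by ring.
    apply: lerD; last exact: jump_le.
    by apply: (le_trans (ler_normB _ _)); apply: lerD; exact: phi_bdd.
  - move=> w [/= hw|Zw]; last by rewrite jump_loc// subrr.
    rewrite sig_void//; last exact: ltW.
    rewrite subrr sub0r jump_out ?oppr0//; apply: Yloc_out => // /card_I1[p hp].
    by have : set0 p by rewrite -hw hp.
(* Replacing [rate1] by h costs at most lam h^2, because 1 - e^(-x) <= x; the constants 4 and 2 add
   up to 6. *)
have H2 : `|(@rate1 R d L h - h) * meangen r| <= 2 * C * lamL ^+ 2 * h ^+ 2.
  rewrite normrM.
  have -> : 2 * C * lamL ^+ 2 * h ^+ 2 = (h * (lamL * h)) * (2 * C * lamL) by ring.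
  apply: ler_pM => //; last by apply: meangen_le => //; exact: ltW.
  have e1 : expR (- (lamL * h)) <= 1 by rewrite expR_le1 oppr_le0 mulr_ge0// ltW.
  have -> : @rate1 R d L h - h = - (h * (1 - expR (- (lamL * h)))) by rewrite /rate1; ring.
  rewrite normrN normrM (ger0_norm (ltW h0)); apply: ler_wpM2l; first exact: ltW.
  by rewrite ger0_norm ?subr_ge0//; have := @expR_ge1Dx R (- (lamL * h)); lra.
have -> : meanphi (r + h) - meanphi r - h * meangen r =
  (meanphi (r + h) - meanphi r - @rate1 R d L h * meangen r) + (@rate1 R d L h - h) * meangen r.
  by ring.
apply: (le_trans (ler_normD _ _)); apply: (le_trans (lerD H H2)).
by rewrite le_eqVlt; apply/orP; left; apply/eqP; ring.
Qed.

Lemma meangen_measurable (t : R) : 0 < t -> t <= T ->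
  measurable_fun (`[0, t]%classic : set (measurableTypeR R)) meangen.
Proof.
move=> t0 tT; apply: (@lipschitz_itv_measurable _ (4 * C * lamL * lamL)) => // a b a0.
rewrite le_eqVlt => /predU1P[->|ab] bt; first by rewrite !subrr normr0 mulr0.
have h0 : 0 < b - a by rewrite subr_gt0.
have := @meangen_lip a (b - a) a0 h0; rewrite addrC subrK => /(_ (le_trans bt tT)).
by rewrite mulrA.
Qed.

Lemma truncated_dynkin (t : R) : 0 < t -> t <= T ->
  ((meanphi t - phi s)%:E = \int[@lebesgue_measure R]_(x in `[0%R, t]) (meangen x)%:E)%E.
Proof.
move=> t0 tT.
have u0 : meanphi 0 = phi s.
  rewrite /meanphi (_ : (fun w => phi (S 0 w)) = fun=> phi s).
    by rewrite Rintegral_cst//= probability_setT mulr1.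
  by apply/funext => w; rewrite sig0.
(* One constant for all four estimates: the Lipschitz and sup bounds of [meangen], the one-step
   error and the Lipschitz bound of [meanphi]. *)
pose K := 6 * C * lamL ^+ 2 + 2 * C * lamL.
have A1 : 0 <= C * lamL by rewrite mulr_ge0.
have A2 : 0 <= C * lamL ^+ 2 by rewrite mulr_ge0// exprn_ge0.
rewrite -u0; apply: (@integral_from_increments _ K) => //.
- by rewrite /K; lra.
- move=> a b a0; rewrite le_eqVlt => /predU1P[->|ab] bt; first by rewrite !subrr normr0 mulr0.
  have h0 : 0 < b - a by rewrite subr_gt0.
  have := @meangen_lip a (b - a) a0 h0; rewrite addrC subrK => /(_ (le_trans bt tT)).
  move/le_trans; apply; rewrite mulrA ler_pM2r// /K.
  by move: A1 A2; rewrite expr2; lra.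
- move=> a a0 at_; apply: (le_trans (meangen_le a0 (le_trans at_ tT))).
  by rewrite /K; lra.
- move=> a b a0; rewrite le_eqVlt => /predU1P[->|ab] bt.
    by rewrite !subrr mul0r subr0 normr0 expr0n mulr0.
  have h0 : 0 < b - a by rewrite subr_gt0.
  have := @meanphi_step a (b - a) a0 h0; rewrite [a + _]addrC subrK => /(_ (le_trans bt tT)).
  move/le_trans; apply; rewrite ler_pM2r ?exprn_gt0// /K; lra.
- move=> b; rewrite le_eqVlt => /predU1P[<-|b0] bt; first by rewrite subrr normr0 mulr0.
  have := @meanphi_lip 0 b (lexx _) b0; rewrite add0r => /(_ (le_trans bt tT)).
  move/le_trans; apply; rewrite mulrA ler_pM2r// /K; lra.
Qed.

End one_step.

(** * Removing the truncation *)

Section limit.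
Context {R : realType} {d : nat} {dO : measure_display} {Omega : measurableType dO}.
Variables (P : probability Omega R) (N : Omega -> set (stpt R d)).
Hypothesis HN : is_rate1_PPP P N.
Hypothesis d0 : (0 < d)%N.
Hypothesis N_nice : forall w, nice (N w).
Variables (s : state R d) (q C : R) (phi : state R d -> R).
Hypothesis hs : in_Sigma s.
Hypothesis phi_bdd : forall s, in_Sigma s -> `|phi s| <= C.
Hypothesis phi_meas : supported_measurable q phi.
Variables (b M : nat).
Hypotheses (b0 : (0 < b)%N) (bM : (b <= M)%N) (qM : q + 1 <= M%:R).
Hypothesis hM : forall Nw (ms L : nat), (M <= ms)%N -> short_chains Nw b ms ->
  (ms <= L)%N -> (b <= L)%N -> forall t : R, t <= b%:R ->
  [/\ forall x, cube q x -> height Nw s t x = height (trunc Nw L%:R b%:R) s t x,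
      forall x y : pt R d, cube q x -> Defs.shift (height Nw s t) y x =
         Defs.shift (height (trunc Nw L%:R b%:R) s t) y x &
      forall (x y : pt R d) i, cube q x -> tnth y i <= - ms%:R \/ q < tnth y i ->
         Defs.shift (height Nw s t) y x = height Nw s t x].

Local Notation bad := (bad N b M).

Let C0 : 0 <= C. Proof. exact: le_trans (normr_ge0 _) (phi_bdd hs). Qed.
Let PT : (P setT < +oo)%E. Proof. by rewrite probability_setT ltry. Qed.
Let Lpos n : 0 < (M + n)%:R :> R.
Proof. by rewrite ltr0n addn_gt0 (leq_trans b0 bM). Qed.
Let qLn n : q + 1 <= (M + n)%:R :> R.
Proof. by apply: (le_trans qM); rewrite ler_nat leq_addr. Qed.
Let fin n w : finite_set (trunc (N w) (M + n)%:R b%:R).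
Proof. exact: trunc_finite. Qed.

Definition good w n := forall m, (n <= m)%N -> ~ bad m w.

(** The least good level; by minimality its predecessor is bad, which makes [weight n.-1] one of the
    terms of [dom]. *)
Lemma good_ex w : exists n, [/\ good w n, (M <= n)%N & bad n.-1 w].
Proof.
have ex : exists n, `[< good w n >].
  have [_ /(_ b)[ms /short_chains_longb hms]] := N_nice w.
  exists (maxn M ms); apply/asboolP => m; rewrite geq_max => /andP[Mm msm].
  by rewrite /bad ltnNge Mm/=; exact: hms.
case: (ex_minnP ex) => n /asboolP gn hn; exists n.
have Mn : (M <= n)%N.
  by rewrite leqNgt; apply/negP => nM; apply: (gn n (leqnn _)); rewrite /bad nM.
split=> //; apply: contrapT => nb.
have n0 : (0 < n)%N by apply: leq_trans Mn; exact: leq_trans bM.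
suff : (n <= n.-1)%N by rewrite -ltnS prednK// ltnn.
apply: hn; apply/asboolP => m; rewrite leq_eqVlt => /predU1P[<- //|].
by rewrite prednK//; exact: gn.
Qed.

(** Beyond a good level the integrand of the generator vanishes outside (-L, L]^d, so the iterated
    integral over all of space is the integral against [mu]. *)
Lemma good_local w n L (r : R) (mu : {finite_measure set (pt R d) -> \bar R}) :
  good w n -> (M <= n)%N -> (n <= L)%N -> r <= b%:R -> cube_measure L%:R mu ->
  phi (height (N w) s r) = phi (sig N L%:R b%:R s r w) /\
  gen phi (height (N w) s r) = (inner N L%:R b%:R s phi mu r w)%:E.
Proof.
move=> gn Mn nL rb hmu; pose H := height (N w) s r.
have sc : short_chains (N w) b n.
  apply/short_chains_longb => m nm; have := gn m nm.
  by rewrite /bad ltnNge (leq_trans Mn nm).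
have [h1 h2 h3] := hM Mn sc nL (leq_trans bM (leq_trans Mn nL)) rb.
have finL : finite_set (trunc (N w) L%:R b%:R) by exact: trunc_finite.
have HS : in_Sigma H by exact: nice_height_Sigma.
have SS : in_Sigma (sig N L%:R b%:R s r w) by exact: height_finite_Sigma.
have E1 : phi H = phi (sig N L%:R b%:R s r w) by exact: (supported_ext phi_meas).
split=> //.
have E2 y : incr phi H y = incr phi (sig N L%:R b%:R s r w) y.
  rewrite /incr E1; congr (_ - _); apply: (supported_ext phi_meas); [exact: shift_Sigma..|].
  by move=> x qx; exact: h2.
have [hit _ _ _] := hmu.
rewrite /gen -/H (_ : (fun y => _) = fun y => (incr phi (sig N L%:R b%:R s r w) y)%:E); last first.
  by apply/funext => y; rewrite -E2.
have muT' : (mu setT < +oo)%E by rewrite (muT hmu) ltry.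
rewrite hit.
- rewrite /inner /Rintegral fineK//.
  exact: integrable_fin_num (incr_integrable phi_bdd phi_meas hmu SS).
- exact: (incr_measurable phi_meas).
- by exists (2 * C) => y; exact: incr_le.
- move=> y ny; rewrite -E2 /incr; apply/eqP; rewrite subr_eq0; apply/eqP.
  apply: (supported_ext phi_meas) => //; first exact: shift_Sigma.
  move=> x qx; have [i hi] : exists i, ~ (- L%:R < tnth y i <= L%:R).
    by apply: contrapT => hn; apply: ny => i; apply: contrapT => hi; apply: hn; exists i.
  apply: (h3 x y i qx); have [yi|yi] := leP (tnth y i) (- n%:R); first by left.
  right; rewrite ltNge; apply/negP => yq; apply: hi; apply/andP; split.
    by apply: le_lt_trans yi; rewrite lerN2 ler_nat.
  apply: (le_trans yq); apply: (@le_trans _ _ M%:R); first by have := qM; lra.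
  by rewrite ler_nat (leq_trans Mn).
Qed.

Definition muL n : {finite_measure set (pt R d) -> \bar R} :=
  projT1 (cid (cube_measure_ex (Lpos n) d)).

Lemma muLP n : cube_measure (M + n)%:R (muL n).
Proof. exact: projT2 (cid (cube_measure_ex (Lpos n) d)). Qed.

Definition innerL n r w : R := inner N (M + n)%:R b%:R s phi (muL n) r w.

Lemma innerL_eventually w : exists n0 : nat, forall (n : nat) (r : R), (n0 <= n)%N -> r <= b%:R ->
  phi (height (N w) s r) = phi (sig N (M + n)%:R b%:R s r w) /\
  gen phi (height (N w) s r) = (innerL n r w)%:E.
Proof.
have [n0 [gn Mn _]] := good_ex w; exists n0 => n r n0n rb.
apply: (good_local gn Mn _ rb (muLP n)).
by apply: leq_trans n0n _; exact: leq_addl.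
Qed.

(** It dominates the volume belonging to the least good level by a single term of the series, and
    its mean is finite by [bad_summable]. *)
Definition dom (w : Omega) : \bar R :=
  (\sum_(0 <= m <oo) ((@weight R d m)%:E * (\1_(bad m) w)%:E))%E.

Let term_ge0 m w : (0 <= (@weight R d m)%:E * (\1_(bad m) w)%:E)%E.
Proof. by rewrite mule_ge0// lee_fin ?weight_ge0. Qed.

Let bad_meas m : measurable (bad m). Proof. exact: (bad_measurable d0 HN). Qed.

Let term_measurable m :
  measurable_fun setT (fun w => ((@weight R d m)%:E * (\1_(bad m) w)%:E)%E).
Proof.
apply: emeasurable_funM; first exact: measurable_cst.
by apply/measurable_EFinP; exact: measurable_indic.
Qed.

Lemma dom_measurable : measurable_fun setT dom.
Proof.
exact: (@ge0_emeasurable_sum _ _ _ setT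
  (fun m w => ((@weight R d m)%:E * (\1_(bad m) w)%:E)%E) xpredT).
Qed.

Lemma dom_ge0 w : (0 <= dom w)%E.
Proof. exact: nneseries_ge0. Qed.

Lemma dom_integrable : P.-integrable setT dom.
Proof.
apply/integrableP; split; first exact: dom_measurable.
rewrite (eq_integral dom); last by move=> w _; rewrite gee0_abs// dom_ge0.
rewrite /dom integral_nneseries//.
rewrite (eq_eseriesr (g := fun m => ((@weight R d m)%:E * P (bad m))%E)).
  exact: bad_summable.
move=> m _; rewrite ge0_integralZl//.
- by rewrite integral_indic// setIT.
- by apply/measurable_EFinP; exact: measurable_indic.
- by rewrite lee_fin weight_ge0.
Qed.

Lemma dom_ge m w : bad m w -> ((@weight R d m)%:E <= dom w)%E.
Proof.
move=> bw; apply: (le_trans _ (@nneseries_lim_ge _ _ xpredT 0 m.+1 _)) => //.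
rewrite big_nat_recr//= [\1_(bad m) w]indicE mem_set// mule1.
by rewrite leeDr// sume_ge0.
Qed.

(** Up to the good level n0 the volume of the box is below [weight n0.-1]. Beyond it the value has
    stabilized and equals the one at level n0, reached at index n0 - M. *)
Lemma innerL_dom n (r : R) w : r <= b%:R -> ((`|innerL n r w|)%:E <= (2 * C)%:E * dom w)%E.
Proof.
move=> rb; have [n0 [gn Mn bn]] := good_ex w.
have n00 : (0 < n0)%N by apply: leq_trans Mn; exact: leq_trans bM.
have H (m : nat) : (M + m <= n0)%N ->
    ((`|innerL m r w|)%:E <= (2 * C)%:E * dom w)%E.
  move=> mn; apply: (@le_trans _ _ ((2 * C)%:E * (@weight R d n0.-1)%:E)%E).
    rewrite -EFinM lee_fin.
    apply: (le_trans (inner_le hs (fin m) phi_bdd phi_meas (muLP m) r w)).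
    apply: ler_wpM2l; first by rewrite mulr_ge0.
    rewrite /lam /weight; apply: lerXn2r; rewrite ?nnegrE ?mulr_ge0//.
    by rewrite ler_pM2l// ler_nat prednK// (leq_trans mn).
  by apply: lee_wpmul2l; [rewrite lee_fin mulr_ge0|exact: dom_ge].
have [mn|/ltnW nm] := leqP (M + n) n0; first exact: H.
have [_ E1] := good_local gn Mn nm rb (muLP n).
have [_ E2] : phi (height (N w) s r) = phi (sig N (M + (n0 - M))%:R b%:R s r w) /\
    gen phi (height (N w) s r) = (innerL (n0 - M) r w)%:E.
  by apply: (good_local gn Mn _ rb (muLP (n0 - M))); rewrite subnKC.
have -> : innerL n r w = innerL (n0 - M) r w.
  by apply: EFin_inj; rewrite -E2 E1.
by apply: H; rewrite subnKC.
Qed.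

Lemma cvg_eventually (U : topologicalType) (f : nat -> U) (l : U) :
  (exists n0 : nat, forall n, (n0 <= n)%N -> f n = l) -> f n @[n --> \oo] --> l.
Proof. by move=> [n0 hn]; apply: cvg_near_cst; exists n0. Qed.

Let domC_integrable : P.-integrable setT (fun w => ((2 * C)%:E * dom w)%E).
Proof. exact: integrableZl dom_integrable. Qed.

Lemma innerL_measurable n (r : R) : 0 <= r -> r <= b%:R -> measurable_fun setT (innerL n r).
Proof.
move=> r0 rb; exact: (inner_measurable HN (Lpos n) hs (fin n) (qLn n) phi_bdd phi_meas (muLP n)).
Qed.

(** For every w the sequence is eventually constant; its limit, the full generator, thereby becomes
    measurable in w. *)
Lemma meangen_cvg (r : R) : 0 <= r -> r <= b%:R ->
  (\int[P]_w (innerL n r w)%:E)%E @[n --> \oo] --> (\int[P]_w gen phi (height (N w) s r))%E.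
Proof.
move=> r0 rb.
have mI n : measurable_fun setT (fun w => (innerL n r w)%:E).
  by apply/measurable_EFinP; exact: innerL_measurable.
have cvgI w : setT w -> (innerL n r w)%:E @[n --> \oo] --> gen phi (height (N w) s r).
  move=> _; apply: cvg_eventually; have [n0 hn0] := innerL_eventually w.
  by exists n0 => n n0n; have [_ ->] := hn0 n r n0n rb.
have mg := @emeasurable_fun_cvg _ _ _ setT (fun n w => (innerL n r w)%:E)
  (fun w => gen phi (height (N w) s r)) mI cvgI.
have [||_ _ //] := @dominated_convergence _ _ _ P setT measurableT
  (fun n w => (innerL n r w)%:E) (fun w => gen phi (height (N w) s r))
  (fun w => ((2 * C)%:E * dom w)%E) mI mg _ domC_integrable _.
- by apply: aeW.
- by apply: aeW => w n _; exact: innerL_dom.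
Qed.

Lemma meanphi_cvg (r : R) : 0 <= r -> r <= b%:R ->
  (\int[P]_w (phi (sig N (M + n)%:R b%:R s r w))%:E)%E @[n --> \oo] -->
  (\int[P]_w (phi (height (N w) s r))%:E)%E.
Proof.
move=> r0 rb.
have mI n : measurable_fun setT (fun w => (phi (sig N (M + n)%:R b%:R s r w))%:E).
  apply/measurable_EFinP.
  exact: (phi_sig_measurable HN (Lpos n) hs (fin n) (qLn n) phi_meas).
have cvgI w : setT w -> (phi (sig N (M + n)%:R b%:R s r w))%:E @[n --> \oo] -->
    (phi (height (N w) s r))%:E.
  move=> _; apply: cvg_eventually; have [n0 hn0] := innerL_eventually w.
  by exists n0 => n n0n; have [-> _] := hn0 n r n0n rb.
have mg := @emeasurable_fun_cvg _ _ _ setT (fun n w => (phi (sig N (M + n)%:R b%:R s r w))%:E)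
  (fun w => (phi (height (N w) s r))%:E) mI cvgI.
have [|||_ _ //] := @dominated_convergence _ _ _ P setT measurableT
  (fun n w => (phi (sig N (M + n)%:R b%:R s r w))%:E) (fun w => (phi (height (N w) s r))%:E)
  (cst C%:E) mI mg.
- by apply: aeW.
- exact: finite_measure_integrable_cst.
- apply: aeW => w n _; rewrite lee_fin; apply: phi_bdd.
  exact: height_finite_Sigma.
Qed.

Lemma nice_dynkin (t : R) : 0 < t -> t <= b%:R ->
  (\int[P]_w (phi (height (N w) s t))%:E - (phi s)%:E
   = \int[@lebesgue_measure R]_(r in `[0%R, t])
       \int[P]_w gen phi (height (N w) s r))%E.
Proof.
move=> t0 tb.
pose mG n r := meangen P N (M + n)%:R b%:R s phi (muL n) r.
have EG n (r : R) : 0 <= r -> r <= b%:R -> (mG n r)%:E = (\int[P]_w (innerL n r w)%:E)%E.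
  move=> r0 rb; rewrite /mG /meangen /Rintegral fineK//.
  exact: integrable_fin_num (inner_integrable HN (Lpos n) hs (fin n) (qLn n)
    phi_bdd phi_meas (muLP n) r0 rb).
have Ephi n : (meanphi P N (M + n)%:R b%:R s phi t)%:E =
    (\int[P]_w (phi (sig N (M + n)%:R b%:R s t w))%:E)%E.
  rewrite /meanphi /Rintegral fineK//.
  exact: integrable_fin_num (phi_sig_integrable HN (Lpos n) hs (fin n) (qLn n)
    phi_bdd phi_meas (ltW t0) tb).
have domf : (\int[P]_w ((2 * C)%:E * dom w))%E \is a fin_num.
  exact: integrable_fin_num domC_integrable.
(* This bound is free of both n and r, so a constant dominates in the second passage to the limit,
   over [0, t]. *)
pose K := fine (\int[P]_w ((2 * C)%:E * dom w))%E.
have GK n (r : R) : 0 <= r -> r <= b%:R -> ((`|mG n r|)%:E <= K%:E)%E.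
  move=> r0 rb; rewrite -[(`|_|)%:E]/(`|(mG n r)%:E|)%E EG// /K fineK//.
  have mI : measurable_fun setT (fun w => (innerL n r w)%:E).
    by apply/measurable_EFinP; exact: innerL_measurable.
  apply: (le_trans (le_abse_integral _ measurableT mI)).
  apply: ge0_le_integral => //.
  - exact: measurableT_comp.
  - by have /integrableP[] := domC_integrable.
  - by move=> w _; exact: innerL_dom.
have sub0 (r : R) : `[0%R, t]%classic r -> 0 <= r /\ r <= b%:R.
  by rewrite /= in_itv/= => /andP[r0 rt]; split=> //; exact: le_trans rt tb.
have mI n : measurable_fun (`[0, t]%classic : set (measurableTypeR R)) (fun r => (mG n r)%:E).
  apply/measurable_EFinP.
  exact: (meangen_measurable HN (Lpos n) hs (fin n) (qLn n) phi_bdd phi_meas (muLP n) t0 tb).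
have cvgI (r : measurableTypeR R) : `[0%R, t]%classic r -> (mG n r)%:E @[n --> \oo] -->
    (\int[P]_w gen phi (height (N w) s r))%E.
  move=> /sub0[r0 rb]; rewrite (_ : (fun n => _) = fun n => (\int[P]_w (innerL n r w)%:E)%E).
    exact: meangen_cvg.
  by apply/funext => n; rewrite EG.
have mg := @emeasurable_fun_cvg _ _ _ (`[0, t]%classic : set (measurableTypeR R))
  (fun n r => (mG n r)%:E) (fun r => \int[P]_w gen phi (height (N w) s r))%E mI cvgI.
have [|||_ _ cR] := @dominated_convergence _ _ _ (@lebesgue_measure R)
  (`[0, t]%classic : set (measurableTypeR R)) (measurable_itv _)
  (fun n r => (mG n r)%:E) (fun r => \int[P]_w gen phi (height (N w) s r))%E
  (cst K%:E) mI mg.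
- by apply: aeW.
- apply: measurable_bounded_integrable => //.
  + by have := lebesgue_measure_itv `[0%R, t] => /= ->; rewrite lte_fin t0 oppr0 adde0 ltry.
  + exists `|K|; split; first exact: num_real.
    by move=> x Kx y _; exact: ltW.
- by apply: aeW => r n /sub0[r0 rb]; exact: GK.
have cL := meanphi_cvg (ltW t0) tb.
have cL' : (\int[P]_w (phi (sig N (M + n)%:R b%:R s t w))%:E - (phi s)%:E)%E
    @[n --> \oo] --> (\int[P]_w (phi (height (N w) s t))%:E - (phi s)%:E)%E.
  by apply: cvgeB => //; [rewrite fin_num_adde_defl|exact: cvg_cst].
have E n : (\int[P]_w (phi (sig N (M + n)%:R b%:R s t w))%:E - (phi s)%:E)%E =
    (\int[@lebesgue_measure R]_(r in `[0%R, t]) (mG n r)%:E)%E.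
  rewrite -Ephi -EFinB.
  exact: (truncated_dynkin HN d0 (Lpos n) hs (fin n) (qLn n) phi_bdd phi_meas (muLP n) t0 tb).
rewrite (_ : (fun n => _) = fun n => (\int[@lebesgue_measure R]_(r in `[0%R, t]) (mG n r)%:E)%E) in cL';
  last by apply/funext => n; rewrite E.
exact: (cvg_unique _ cL' cR).
Qed.

End limit.

(** * Return to the given configuration *)

Import HBNNSimple.

(* [f] and [g] may be non-measurable, so the comparison is made on the simple
   functions below them, cut off outside [G]. *)
Lemma integral_eq_conull {dT : measure_display} {T : measurableType dT} {R : realType}
    (m : {measure set T -> \bar R}) (G : set T) (f g : T -> \bar R) :
  measurable G -> m (~` G) = 0%E -> (forall x, G x -> f x = g x) ->
  (\int[m]_x f x = \int[m]_x g x)%E.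
Proof.
move=> mG mG0.
have H (u v : T -> \bar R) : (forall x, (0 <= v x)%E) -> (forall x, G x -> u x = v x) ->
    (ereal_sup [set sintegral m h | h in [set h : {nnsfun T >-> R} |
       forall x, ((h x)%:E <= u x)%E]] <=
     ereal_sup [set sintegral m h | h in [set h : {nnsfun T >-> R} |
       forall x, ((h x)%:E <= v x)%E]])%E.
  move=> v0 uv; apply: le_ereal_sup => _ [h hf <-].
  exists (proj_nnsfun h mG).
    move=> x; rewrite -mrestrict patchE; case: ifPn => [|_]; last exact: v0.
    by rewrite inE => Gx; rewrite -uv.
  rewrite -!integralT_nnsfun; apply: ae_eq_integral => //.
  - by apply/measurable_EFinP; exact: measurable_funP.
  - by apply/measurable_EFinP; exact: measurable_funP.
  exists (~` G); split=> //; first exact: measurableC.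
  move=> x /= hx Gx; apply: hx => _.
  by rewrite /mindic indicE mem_set// mulr1.
have K (u v : T -> \bar R) : (forall x, (0 <= u x)%E) -> (forall x, (0 <= v x)%E) ->
   (forall x, G x -> u x = v x) ->
    ereal_sup [set sintegral m h | h in [set h : {nnsfun T >-> R} |
       forall x, ((h x)%:E <= u x)%E]] =
     ereal_sup [set sintegral m h | h in [set h : {nnsfun T >-> R} |
       forall x, ((h x)%:E <= v x)%E]].
  by move=> u0 v0 uv; apply/eqP; rewrite eq_le !H// => x /uv.
move=> fg; rewrite /integral; congr (_ - _)%E; apply: K => x.
- exact: funepos_ge0.
- exact: funepos_ge0.
- by move=> Gx; rewrite !funeposE !patch_setT fg.
- exact: funeneg_ge0.
- exact: funeneg_ge0.
- by move=> Gx; rewrite !funenegE !patch_setT fg.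
Qed.

Theorem theorem3p1 (R : realType) (d : nat) (hd : (2 <= d)%N)
  (dO : measure_display) (Omega : measurableType dO) (P : probability Omega R)
  (N : Omega -> set (stpt R d)) (HN : is_rate1_PPP P N)
  (q : R) (hq : 0 < q) (phi : state R d -> R)
  (phi_bdd : exists C : R, forall s, in_Sigma s -> `|phi s| <= C)
  (phi_meas : supported_measurable q phi)
  (s : state R d) (hs : in_Sigma s) (t : R) (ht : 0 < t) :
  (\int[P]_w (phi (height (N w) s t))%:E - (phi s)%:E
   = \int[@lebesgue_measure R]_(r in `[0%R, t])
       \int[P]_w gen phi (height (N w) s r))%E.
Proof.
have d0 : (0 < d)%N by exact: ltnW.
have [G mG [G0 niceG]] := nice_modification d0 HN.
have HN' := poisson_modification HN mG G0.
set N' := fun w => _ in HN'.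
have NE w : G w -> N w = N' w by move=> Gw; rewrite /N' asboolT.
have [C hC] := phi_bdd.
pose b := (Num.trunc (q + t)).+1.
have hb : q + t < b%:R by exact: truncnS_gt.
have qb : q <= b%:R by lra.
have tb : t <= b%:R by lra.
have qb' : 0 < q <= b%:R by rewrite hq.
have [M0 M0pos hM0] := height_localized_eq hs qb'.
(* Besides the localization threshold, M must exceed b, for the tail bounds, and q + 1, the margin
   that keeps the points just above the cube inside every box. *)
pose M := maxn M0 (maxn b (Num.trunc (q + 1)).+1).
have bM : (b <= M)%N by rewrite !leq_max leqnn orbT.
have M0M : (M0 <= M)%N by rewrite leq_max leqnn.
have qM : q + 1 <= M%:R.
  apply: (@le_trans _ _ (Num.trunc (q + 1)).+1%:R); first exact/ltW/truncnS_gt.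
  by rewrite ler_nat !leq_max leqnn !orbT.
have dyn := @nice_dynkin _ _ _ _ P N' HN' d0 niceG s q C phi hs hC phi_meas b M isT bM qM
  (fun Nw ms L Mms => hM0 Nw ms L (leq_trans M0M Mms)) t ht tb.
(* The integrands for [N] and [N'] agree on the conull set [G]; those for [N] need not be
   measurable, hence the comparison by [integral_eq_conull]. *)
transitivity (\int[P]_w (phi (height (N' w) s t))%:E - (phi s)%:E)%E.
  by congr (_ - _)%E; apply: (integral_eq_conull mG G0) => w /NE ->.
rewrite dyn; apply: eq_integral => r _.
by apply/esym; apply: (integral_eq_conull mG G0) => w /NE ->.
Qed.
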